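(* For $\alpha\in(0,\infty)$ consider the four types $A$ (with an even and an odd version), $B$, $C$, $D$ of infinite determinantal point processes on the cylinder $\mathbb R\times\mathbb S^1(2\pi\alpha)$ with background measure $\lambda_{{\rm N}(0,1/4)}(dx_{\rm R})\lambda_{[0,2\pi\alpha)}(dx_{\rm I})$ and correlation kernels $K^{A,{\rm even}}_{\mathbb R\times\mathbb S^1(2\pi\alpha)}$, $K^{A,{\rm odd}}_{\mathbb R\times\mathbb S^1(2\pi\alpha)}$, $K^{B}_{\mathbb R\times\mathbb S^1(2\pi\alpha)}$, $K^{C}_{\mathbb R\times\mathbb S^1(2\pi\alpha)}$, $K^{D}_{\mathbb R\times\mathbb S^1(2\pi\alpha)}$ defined in the context. The following limit transitions, as $\alpha\to\infty$, to the three types of Ginibre determinantal point processes on $\mathbb C$ are established: $$\big(\Xi,K^{A,\sharp}_{\mathbb R\times\mathbb S^1(2\pi\alpha)},\lambda_{{\rm N}(0,1/4)}(dx_{\rm R})\lambda_{[0,2\pi\alpha)}(dx_{\rm I})\big)\Longrightarrow\big(\Xi,K^A_{\rm Ginibre},\lambda_{{\rm N}(0,1;\mathbb C)}(dx)\big),\quad\sharp={\rm even},{\rm odd},$$ $$\big(\Xi,K^{R}_{\mathbb R\times\mathbb S^1(2\pi\alpha)},\lambda_{{\rm N}(0,1/4)}(dx_{\rm R})\lambda_{[0,2\pi\alpha)}(dx_{\rm I})\big)\Longrightarrow\big(\Xi,K^C_{\rm Ginibre},\lambda_{{\rm N}(0,1;\mathbb C)}(dx)\big),\quad R=B,C,$$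 $$\big(\Xi,K^{D}_{\mathbb R\times\mathbb S^1(2\pi\alpha)},\lambda_{{\rm N}(0,1/4)}(dx_{\rm R})\lambda_{[0,2\pi\alpha)}(dx_{\rm I})\big)\Longrightarrow\big(\Xi,K^D_{\rm Ginibre},\lambda_{{\rm N}(0,1;\mathbb C)}(dx)\big).$$
   Context: A determinantal point process (DPP) $(\Xi,K,\lambda)$ on a locally compact Hausdorff space $S$ with countable base and Radon measure $\lambda$ is a simple point process $\Xi=\sum_j\delta_{X_j}$ whose $n$-point correlation functions with respect to $\lambda^{\otimes n}$ are $\det_{1\le j,k\le n}[K(x_j,x_k)]$ for every $n\in\mathbb N$. The arrow $\Longrightarrow$ denotes weak convergence of DPPs in the vague topology. For $x\in\mathbb C$ write $x=x_{\rm R}+ix_{\rm I}$. The surface of the cylinder $\mathbb R\times\mathbb S^1(2\pi\alpha)$, of infinite length and with periodicity $2\pi\alpha$ in the circumference direction, is identified with the strip $D_{2\pi\alpha}=\{z\in\mathbb C:0\le\Im z<2\pi\alpha\}$ with periodicity of $2\pi i\alpha$. The background measure is $$\lambda_{{\rm N}(0,1/4)}(dx_{\rm R})\lambda_{[0,2\pi\alpha)}(dx_{\rm I})=\frac{1}{\sqrt2\,\pi^{3/2}\alpha}e^{-2x_{\rm R}^2}\mathbf 1_{D_{2\pi\alpha}}(x)\,dx_{\rm R}dx_{\rm I},$$ i.e. the product of the normal distribution with mean $0$ and variance $1/4$ and the uniform probability measure on $[0,2\pi\alpha)$. Limit processes on $\mathbb C$: $\lambda_{{\rm N}(0,1;\mathbb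 C)}(dx)=\pi^{-1}e^{-|x|^2}dx_{\rm R}dx_{\rm I}$, $K^A_{\rm Ginibre}(x,x')=e^{x\overline{x'}}$, $K^C_{\rm Ginibre}(x,x')=\sinh(x\overline{x'})$, $K^D_{\rm Ginibre}(x,x')=\cosh(x\overline{x'})$. With $z=e^{v\pi i}$, $q=e^{\tau\pi i}$, $\Im\tau>0$: $\vartheta_2(v;\tau)=\sum_{n\in\mathbb Z}q^{(n-1/2)^2}z^{2n-1}$, $\vartheta_3(v;\tau)=\sum_{n\in\mathbb Z}q^{n^2}z^{2n}$. Put $\tau_\alpha=\frac{i}{2\pi\alpha^2}$, $v_\pm=\frac{i(x\pm\overline{x'})}{2\pi\alpha}$. Then, for $x,x'\in\mathbb R\times\mathbb S^1(2\pi\alpha)$, $K^{A,{\rm even}}_{\mathbb R\times\mathbb S^1(2\pi\alpha)}(x,x')=\vartheta_2(v_+;\tau_\alpha)$, $K^{A,{\rm odd}}_{\mathbb R\times\mathbb S^1(2\pi\alpha)}(x,x')=\vartheta_3(v_+;\tau_\alpha)$, $K^{B}_{\mathbb R\times\mathbb S^1(2\pi\alpha)}(x,x')=\frac12\{\vartheta_2(v_+;\tau_\alpha)-\vartheta_2(v_-;\tau_\alpha)\}$, $K^{C}_{\mathbb R\times\mathbb S^1(2\pi\alpha)}(x,x')=\frac12\{\vartheta_3(v_+;\tau_\alpha)-\vartheta_3(v_-;\tau_\alpha)\}$, $K^{D}_{\mathbb R\times\mathbb S^1(2\pi\alpha)}(x,x')=\frac12\{\vartheta_3(v_+;\tau_\alpha)+\vartheta_3(v_-;\tau_\alpha)\}$.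 *)

(* Defs.v *)
From HB Require Import structures.
From mathcomp Require Import all_boot all_order all_algebra.
From mathcomp Require Import all_classical all_reals all_analysis.
From mathcomp Require Import measurable_realfun complex.

Set Implicit Arguments.
Unset Strict Implicit.
Unset Printing Implicit Defensive.

Import Order.TTheory GRing.Theory Num.Theory.
Import numFieldNormedType.Exports.
Import ComplexField.

Local Open Scope classical_set_scope.
Local Open Scope ring_scope.

Section with_density.
Context d (T : measurableType d) (R : realType).
Variables (mu : {measure set T -> \bar R}) (f : T -> R).

Definition with_density (A : set T) : \bar R := (\int[mu]_(x in A) (f x)%:E)%E.

Hypotheses (f0 : forall x, 0 <= f x) (mf : measurable_fun setT f).

Lemma with_density0 : with_density set0 = 0%E.
Proof. exact: integral_set0. Qed.

Lemma with_density_ge0 A : (0 <= with_density A)%E.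
Proof. by apply: integral_ge0 => x _; rewrite lee_fin. Qed.

Lemma with_density_sigma_additive : semi_sigma_additive with_density.
Proof.
move=> F mF tF mUF; rewrite /with_density ge0_integral_bigcup//.
- apply: is_cvg_ereal_nneg_natsum_cond => n _ _; exact: with_density_ge0.
- by apply/measurable_EFinP; exact: measurable_funTS.
- by move=> x _; rewrite lee_fin.
Qed.

End with_density.

Lemma with_density_sigma_finite d (T : measurableType d) (R : realType)
    (mu : {sigma_finite_measure set T -> \bar R}) (f : T -> R) :
  (forall x, 0 <= f x) -> measurable_fun setT f ->
  sigma_finite setT (with_density mu f).
Proof.
move=> f0 mf; have /sigma_finiteP[F [TF ndF Foo]] := sigma_finiteT mu.
pose G n := F n `&` [set x | f x <= n%:R].
have mG n : measurable (G n).
  apply: measurableI; first exact: (Foo n).1.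
  rewrite -[X in measurable X]setTI.
  have -> : [set x | f x <= n%:R] = f @^-1` `]-oo, n%:R]%classic.
    by apply/seteqP; split => x /=; rewrite in_itv.
  exact: mf.
exists G => [|k].
  apply/seteqP; split => // x _.
  have : (\bigcup_n F n) x by rewrite -TF.
  case=> n _ Fnx; exists (maxn n (Num.truncn (f x)).+1) => //; split.
    have /subsetPset := ndF _ _ (leq_maxl n (Num.truncn (f x)).+1); exact.
  rewrite /= (le_trans (ltW (truncnS_gt _)))// ler_nat leq_max leqnn orbT//.
split=> //; apply: (@le_lt_trans _ _ (\int[mu]_(x in G k) (k%:R)%:E)%E).
  apply: ge0_le_integral => //=.
  - by move=> x _; rewrite lee_fin.
  - by apply/measurable_EFinP; exact: measurable_funTS.
  - by move=> x [].
rewrite integral_cst// lte_mul_pinfty ?lee_fin//.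
apply: (le_lt_trans _ (Foo k).2); apply: le_measure; rewrite ?inE//.
  exact: (Foo k).1.
by move=> x [].
Qed.

(* The library's sigma-finite instance on mu \x nu is not found by unification:
   it is shadowed by the one for products of subprobabilities. *)
Lemma product_sigma_finite d1 d2 (T1 : measurableType d1)
    (T2 : measurableType d2) (R : realType)
    (m1 : {sigma_finite_measure set T1 -> \bar R})
    (m2 : {sigma_finite_measure set T2 -> \bar R}) :
  sigma_finite setT (m1 \x m2)%E.
Proof.
have /sigma_finiteP[F [TF ndF Foo]] := sigma_finiteT m1.
have /sigma_finiteP[G [TG ndG Goo]] := sigma_finiteT m2.
exists (fun n => F n `*` G n).
  apply/seteqP; split => // -[x y] _.
  have [n _ Fnx] : (\bigcup_n F n) x by rewrite -TF.
  have [k _ Gky] : (\bigcup_n G n) y by rewrite -TG.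
  exists (maxn n k) => //; split => /=.
    have /subsetPset := ndF _ _ (leq_maxl n k); exact.
  have /subsetPset := ndG _ _ (leq_maxr n k); exact.
move=> k; have [? ?] := Foo k; have [? ?] := Goo k.
split; first exact: measurableX.
by rewrite product_measure1E// lte_mul_pinfty// ge0_fin_numE.
Qed.

(* tuple_power mu n is the n-fold product measure on n-tuples, obtained from
   mu \x tuple_power mu n.-1 along the bijection T * T^(n-1) -> T^n. *)
Section tuple_power.
Context d (T : measurableType d) (R : realType).

Definition tuple_consp n (p : T * n.-tuple T) : n.+1.-tuple T :=
  [tuple of p.1 :: p.2].

Lemma measurable_tuple_consp n : measurable_fun setT (@tuple_consp n).
Proof.
apply measurable_cons; [exact: measurable_fst | exact: measurable_snd].
Qed.

Variable mu : {sigma_finite_measure set T -> \bar R}.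

Section step.
Variables (n : nat) (nu : {sigma_finite_measure set (n.-tuple T) -> \bar R}).

Definition tuple_power_step : set (n.+1.-tuple T) -> \bar R :=
  pushforward (mu \x nu)%E (@tuple_consp n).

Let step0 : tuple_power_step set0 = 0%E.
Proof. by rewrite /tuple_power_step /pushforward preimage_set0 measure0. Qed.

Let step_ge0 A : (0 <= tuple_power_step A)%E.
Proof. by rewrite /tuple_power_step /pushforward. Qed.

Let step_sigma_additive : semi_sigma_additive tuple_power_step.
Proof.
have mc := @measurable_tuple_consp n.
move=> F mF tF mUF; rewrite /tuple_power_step /pushforward preimage_bigcup.
apply: measure_semi_sigma_additive.
- by move=> k; rewrite -[X in measurable X]setTI; exact: mc.
- apply/trivIsetP => /= i j _ _ ij; rewrite -preimage_setI.
  by move/trivIsetP : tF => /(_ _ _ _ _ ij) ->//; rewrite preimage_set0.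
- by rewrite -preimage_bigcup -[X in measurable X]setTI; exact: mc.
Qed.

HB.instance Definition _ := isMeasure.Build _ _ _ tuple_power_step
  step0 step_ge0 step_sigma_additive.

Let step_sigma_finite : sigma_finite setT tuple_power_step.
Proof.
have [F TF Foo] := product_sigma_finite mu nu.
pose u (t : n.+1.-tuple T) : T * n.-tuple T := (thead t, [tuple of behead t]).
have mu_ : measurable_fun setT u.
  apply: measurable_fun_pair; last exact: measurable_behead.
  exact: (@measurable_tnth _ T n.+1 ord0).
have uK : cancel (@tuple_consp n) u.
  by case=> x t; congr pair; apply/val_inj.
exists (fun k => u @^-1` (F k)) => [|k].
  by rewrite -preimage_bigcup -TF preimage_setT.
split; first by rewrite -[X in measurable X]setTI; apply: mu_; [|exact: (Foo k).1].
rewrite /tuple_power_step /pushforward -comp_preimage.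
rewrite (_ : _ \o _ = id) ?preimage_id; first exact: (Foo k).2.
by apply/funext => p /=; rewrite uK.
Qed.

HB.instance Definition _ := Measure_isSigmaFinite.Build _ _ _ tuple_power_step
  step_sigma_finite.

End step.

Fixpoint tuple_power n : {sigma_finite_measure set (n.-tuple T) -> \bar R} :=
  match n with
  | 0 => \d_[tuple]
  | n.+1 => tuple_power_step (tuple_power n)
  end.

End tuple_power.

Section plane.
Variable R : realType.

Definition plane : Type := (measurableTypeR R * measurableTypeR R)%type.

Definition toC (x : plane) : R[i] := (x.1 +i* x.2)%C.

Definition area : set plane -> \bar R :=
  (@lebesgue_measure R \x @lebesgue_measure R)%E.

HB.instance Definition _ := Measure.on area.

Lemma area_sigma_finite : sigma_finite setT area.
Proof. exact: product_sigma_finite. Qed.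

HB.instance Definition _ := Measure_isSigmaFinite.Build _ _ _ area
  area_sigma_finite.

End plane.

(* Locally finite \sum_j \d_(x j); the points x j may be repeated. *)
Record conf (R : realType) := Conf {
  conf_measure :> {measure set (plane R) -> \bar R} ;
  conf_atomic : exists (J : set nat) (x : nat -> plane R),
    forall B : set (plane R), measurable B ->
      conf_measure B = \esum_(j in J) \d_(x j) B ;
  conf_locally_finite : forall B : set (plane R),
    measurable B -> bounded_set B -> (conf_measure B < +oo)%E }.

HB.instance Definition _ (R : realType) := gen_eqMixin (conf R).
HB.instance Definition _ (R : realType) := gen_choiceMixin (conf R).

Section vague.
Variable R : realType.

Record test_function := TestFunction {
  test_fun :> plane R -> R ;
  test_fun_continuous : continuous test_fun ;
  test_fun_compact : compact (closure [set x | test_fun x != 0]) }.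

Definition vague_eval (xi : conf R) :
    prod_topology (fun _ : test_function => R) :=
  fun f => \int[xi]_x f x.

Definition vague_conf : topologicalType := initial_topology vague_eval.

End vague.

Section dpp.
Variable R : realType.
Context d (Omega : measurableType d) (P : probability Omega R).
Implicit Type Xi : Omega -> conf R.

(* Measurability for the sigma-algebra on configurations generated by the
   counts xi |-> xi B, which is the Borel sigma-algebra of vague_conf. *)
Definition point_process Xi :=
  forall B, measurable B -> measurable_fun setT (fun w => Xi w B).

Definition simple_point_process Xi :=
  point_process Xi /\ {ae P, forall w, forall x, (Xi w [set x] <= 1)%E}.

(* L_0, ..., L_{m-1} are disjoint bounded Borel sets and the map c lists, in
   some order, n of these indices, the index j occurring k_j times; then
     E[\prod_j Xi(L_j)! / (Xi(L_j) - k_j)!]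
       = \int_{L_(c 0) x ... x L_(c (n-1))} rho d(lambda^n).
   The factor Xi(L)! / (Xi(L) - k)!, which is 0 if Xi(L) < k, is written
   Xi(L) (Xi(L) - 1) ... (Xi(L) - k + 1). *)
Definition correlation_function Xi
    (lambda : {sigma_finite_measure set (plane R) -> \bar R})
    n (rho : n.-tuple (plane R) -> R) :=
  [/\ forall t, 0 <= rho t,
      measurable_fun setT rho &
      forall m (L : 'I_m -> set (plane R)) (c : 'I_n -> 'I_m),
        (forall j, measurable (L j) /\ bounded_set (L j)) ->
        trivIset setT L ->
        ('E_P[fun w => (\prod_(j < m) \prod_(i < #|[pred l | c l == j]|)
                          (fine (Xi w (L j)) - i%:R))%R]
         = \int[tuple_power lambda n]_(t in [set t | forall l,
                                  L (c l) (tnth t l)]) (rho t)%:E)%E].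

Definition is_dpp Xi (K : plane R -> plane R -> R[i])
    (lambda : {sigma_finite_measure set (plane R) -> \bar R}) :=
  simple_point_process Xi /\
  forall n, exists rho : n.-tuple (plane R) -> R,
    (forall t, (rho t)%:C%C = \det (\matrix_(j, k) K (tnth t j) (tnth t k))) /\
    correlation_function Xi lambda rho.

End dpp.

Definition weak_vague_cvg (R : realType)
    (d : R -> measure_display) (Omega : forall alpha, measurableType (d alpha))
    (P : forall alpha, probability (Omega alpha) R)
    (Xi : forall alpha, Omega alpha -> conf R)
    (d' : measure_display) (Omega' : measurableType d')
    (P' : probability Omega' R) (Xi' : Omega' -> conf R) :=
  forall F : vague_conf R -> R,
    continuous F -> (exists M, forall xi, `|F xi| <= M) ->
    'E_(P alpha)[fun w => F (Xi alpha w)]%E @[alpha --> +oo]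
      --> 'E_P'[fun w => F (Xi' w)]%E.

Section cylinder.
Variable R : realType.

Definition strip (alpha : R) : set (plane R) :=
  [set x | 0 <= x.2 < 2 * pi * alpha].

Definition cylinder_density (alpha : R) (x : plane R) : R :=
  (Num.sqrt 2 * pi `^ (3 / 2) * alpha)^-1 * expR (- 2 * x.1 ^+ 2)
  * \1_(strip alpha) x.

Lemma measurable_strip alpha : measurable (strip alpha).
Proof.
have -> : strip alpha = setT `*` `[0, 2 * pi * alpha[%classic.
  by apply/seteqP; split => -[x y] /=; rewrite in_itv /strip /=; [|case].
by apply: measurableX => //; exact: measurable_itv.
Qed.

Lemma cylinder_density_ge0 alpha x : 0 <= cylinder_density alpha x.
Proof.
rewrite /cylinder_density indicE; case: (boolP (x \in _)); last first.
  by rewrite mulr0.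
rewrite inE => -[/= /andP[x0 xa]]; rewrite mulr1.
have a0 : 0 < alpha.
  have := le_lt_trans x0 xa; rewrite pmulr_rgt0// mulr_gt0 ?pi_gt0//.
by rewrite mulr_ge0 ?expR_ge0// invr_ge0 !mulr_ge0// ?powR_ge0 ?sqrtr_ge0 ?ltW.
Qed.

Lemma measurable_cylinder_density alpha :
  measurable_fun setT (cylinder_density alpha).
Proof.
apply: measurable_funM; last first.
  by apply: measurable_indic; exact: measurable_strip.
apply: measurable_funM => //; apply: measurableT_comp => //.
by apply: measurable_funM => //; exact: measurable_funX.
Qed.

Definition cylinder_measure alpha : set (plane R) -> \bar R :=
  with_density (@area R) (cylinder_density alpha).

HB.instance Definition _ alpha := isMeasure.Build _ _ _
  (cylinder_measure alpha)
  (with_density0 _ _)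
  (with_density_ge0 _ (cylinder_density_ge0 alpha))
  (with_density_sigma_additive (cylinder_density_ge0 alpha)
     (measurable_cylinder_density alpha)).

HB.instance Definition _ alpha := Measure_isSigmaFinite.Build _ _ _
  (cylinder_measure alpha)
  (with_density_sigma_finite _ (cylinder_density_ge0 alpha)
     (measurable_cylinder_density alpha)).

(* The strip 0 <= Im z < 2 pi alpha has period 2 pi i alpha. recenter moves its
   upper half by one period, to the fundamental domain
   - pi alpha <= Im z < pi alpha, whose limit as alpha -> +oo is all of C
   (that of the strip itself is the closed upper half-plane). *)
Definition recenter (alpha : R) (x : plane R) : plane R :=
  if pi * alpha <= x.2 then (x.1, x.2 - 2 * pi * alpha) else x.

Lemma measurable_recenter alpha : measurable_fun setT (recenter alpha).
Proof.
rewrite /recenter; apply: measurable_fun_ifT => //.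
  by apply: measurable_fun_ler => //; exact: measurable_snd.
apply: measurable_fun_pair; first exact: measurable_fst.
by apply: measurable_funB => //; exact: measurable_snd.
Qed.

Lemma bounded_recenter alpha (B : set (plane R)) :
  bounded_set B -> bounded_set (recenter alpha @^-1` B).
Proof.
rewrite /= /bounded_near; near_simpl => bB.
have [M [_ HM]] := bB; have {HM} BM x : B x -> `|x| <= M + 1.
  by move=> Bx; apply: (HM (M + 1)) => //; rewrite ltrDl.
exists (M + 1 + `|2 * pi * alpha|); split => [|N MN]; first exact: num_real.
move=> x /BM; rewrite /recenter /=; case: ifPn => _ xM; last first.
  by apply: (le_trans xM); apply: le_trans (ltW MN); rewrite lerDl.
apply: le_trans (ltW MN).
have -> : x = ((x.1, x.2 - 2 * pi * alpha) : plane R) + (0, 2 * pi * alpha).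
  by case: x {xM} => a b; congr pair => /=; rewrite ?addr0 ?subrK.
apply: (le_trans (ler_normD _ _)); apply: lerD => //.
by rewrite prod_normE /= normr0 ge_max lexx normr_ge0.
Qed.

Section conf_recenter.
Variables (alpha : R) (xi : conf R).

Definition recenter_measure : set (plane R) -> \bar R :=
  pushforward xi (recenter alpha).

Let recenter0 : recenter_measure set0 = 0%E.
Proof. by rewrite /recenter_measure /pushforward preimage_set0 measure0. Qed.

Let recenter_ge0 A : (0 <= recenter_measure A)%E.
Proof. by rewrite /recenter_measure /pushforward. Qed.

Let mrecenter A : measurable A -> measurable (recenter alpha @^-1` A).
Proof.
by move=> mA; rewrite -[X in measurable X]setTI; exact: measurable_recenter.
Qed.

Let recenter_sigma_additive : semi_sigma_additive recenter_measure.
Proof.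
move=> F mF tF mUF; rewrite /recenter_measure /pushforward preimage_bigcup.
apply: measure_semi_sigma_additive.
- by move=> k; exact: mrecenter.
- apply/trivIsetP => /= i j _ _ ij; rewrite -preimage_setI.
  by move/trivIsetP : tF => /(_ _ _ _ _ ij) ->//; rewrite preimage_set0.
- by rewrite -preimage_bigcup; exact: mrecenter.
Qed.

HB.instance Definition _ := isMeasure.Build _ _ _ recenter_measure
  recenter0 recenter_ge0 recenter_sigma_additive.

Let recenter_atomic : exists (J : set nat) (x : nat -> plane R),
  forall B : set (plane R), measurable B ->
    recenter_measure B = \esum_(j in J) \d_(x j) B.
Proof.
have [J [x xiE]] := conf_atomic xi; exists J, (recenter alpha \o x) => B mB.
by rewrite /recenter_measure /pushforward xiE//; exact: mrecenter.
Qed.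

Let recenter_locally_finite (B : set (plane R)) :
  measurable B -> bounded_set B -> (recenter_measure B < +oo)%E.
Proof.
move=> mB bB; apply: conf_locally_finite; first exact: mrecenter.
exact: bounded_recenter.
Qed.

Definition conf_recenter : conf R :=
  @Conf R recenter_measure recenter_atomic recenter_locally_finite.

End conf_recenter.

End cylinder.

Section kernels.
Variable R : realType.
Local Open Scope complex_scope.

Definition expC (z : R[i]) : R[i] :=
  (expR (complex.Re z))%:C * (cos (complex.Im z) +i* sin (complex.Im z)).
Definition sinhC (z : R[i]) : R[i] := (expC z - expC (- z)) / 2.
Definition coshC (z : R[i]) : R[i] := (expC z + expC (- z)) / 2.

(* The sum over -N <= n <= N, N -> +oo, taken on real and imaginary parts; all
   the series below converge absolutely for Im tau > 0. *)
Definition zseries (a : int -> R[i]) : R[i] :=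
  let S N := \sum_(k < N.*2.+1) a (k%:Z - N%:Z) in
  limn (fun N => complex.Re (S N)) +i* limn (fun N => complex.Im (S N)).

(* With q = e^(tau pi i), the non-integral powers q^s are e^(s tau pi i). *)
Definition theta2 (v tau : R[i]) : R[i] :=
  let q s := expC (s * tau * pi%:C * 'i) in
  let z := expC (v * pi%:C * 'i) in
  zseries (fun n => q ((n%:~R - 1 / 2) ^+ 2) * z ^ (2 * n - 1)).

Definition theta3 (v tau : R[i]) : R[i] :=
  let q := expC (tau * pi%:C * 'i) in
  let z := expC (v * pi%:C * 'i) in
  zseries (fun n => q ^ (n ^+ 2) * z ^ (2 * n)).

Section cylinder_kernels.
Variables (alpha : R) (x x' : plane R).

Let tau : R[i] := 'i / (2 * pi * alpha ^+ 2)%:C.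
Let vp : R[i] := 'i * (toC x + (toC x')^*) / (2 * pi * alpha)%:C.
Let vm : R[i] := 'i * (toC x - (toC x')^*) / (2 * pi * alpha)%:C.

Definition K_cylinder_A_even : R[i] := theta2 vp tau.
Definition K_cylinder_A_odd : R[i] := theta3 vp tau.
Definition K_cylinder_B : R[i] := (1 / 2) * (theta2 vp tau - theta2 vm tau).
Definition K_cylinder_C : R[i] := (1 / 2) * (theta3 vp tau - theta3 vm tau).
Definition K_cylinder_D : R[i] := (1 / 2) * (theta3 vp tau + theta3 vm tau).

End cylinder_kernels.

Definition K_Ginibre_A (x x' : plane R) : R[i] := expC (toC x * (toC x')^*).
Definition K_Ginibre_C (x x' : plane R) : R[i] := sinhC (toC x * (toC x')^*).
Definition K_Ginibre_D (x x' : plane R) : R[i] := coshC (toC x * (toC x')^*).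

End kernels.

Section Ginibre_measure.
Variable R : realType.

Definition Ginibre_density (x : plane R) : R :=
  pi^-1 * expR (- (x.1 ^+ 2 + x.2 ^+ 2)).

Lemma Ginibre_density_ge0 x : 0 <= Ginibre_density x.
Proof. by rewrite mulr_ge0 ?expR_ge0// invr_ge0 pi_ge0. Qed.

Lemma measurable_Ginibre_density : measurable_fun setT Ginibre_density.
Proof.
apply: measurable_funM => //; apply: measurableT_comp => //.
apply: measurableT_comp => //; apply: measurable_funD.
  by apply: measurable_funX; exact: measurable_fst.
by apply: measurable_funX; exact: measurable_snd.
Qed.

Definition Ginibre_measure : set (plane R) -> \bar R :=
  with_density (@area R) Ginibre_density.

HB.instance Definition _ := isMeasure.Build _ _ _ Ginibre_measure
  (with_density0 _ _) (with_density_ge0 _ Ginibre_density_ge0)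
  (with_density_sigma_additive Ginibre_density_ge0 measurable_Ginibre_density).

HB.instance Definition _ := Measure_isSigmaFinite.Build _ _ _ Ginibre_measure
  (with_density_sigma_finite _ Ginibre_density_ge0 measurable_Ginibre_density).

End Ginibre_measure.

(* (Xi, K alpha, lambda alpha) ==> (Xi, K', lambda') as alpha -> +oo, for
   processes on the cylinders of circumference 2 pi alpha (in the strip
   coordinates) and a limit process on C. *)
Definition cylinder_dpp_cvg (R : realType)
    (K : R -> plane R -> plane R -> R[i])
    (lambda : R -> {sigma_finite_measure set (plane R) -> \bar R})
    (K' : plane R -> plane R -> R[i])
    (lambda' : {sigma_finite_measure set (plane R) -> \bar R}) : Prop :=
  forall (d : R -> measure_display)
    (Omega : forall alpha, measurableType (d alpha))
    (P : forall alpha, probability (Omega alpha) R)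
    (Xi : forall alpha, Omega alpha -> conf R)
    (d' : measure_display) (Omega' : measurableType d')
    (P' : probability Omega' R) (Xi' : Omega' -> conf R),
    (forall alpha, 0 < alpha ->
       is_dpp (P alpha) (Xi alpha) (K alpha) (lambda alpha)) ->
    is_dpp P' Xi' K' lambda' ->
    weak_vague_cvg P (fun alpha w => conf_recenter alpha (Xi alpha w)) P' Xi'.

(* Main.v *)
(* Everything is pulled back to the plane: a recentered process on the cylinder
   has correlation densities det [K_alpha (x_j, x_k)] * prod_j h_alpha (x_j)
   with respect to area, h_alpha being the Gaussian weight on the centered strip.

   Weak convergence in the vague topology follows from pointwise convergence of
   these densities and a bound by B ^ n: the bound makes the factorial moments of
   the counts of disjoint bounded sets converge and controls E 6 ^ N, so bounded
   functions of the counts have convergent expectations; and a continuous function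
   on configurations is approximated, uniformly on a compact set carrying almost
   all the mass, by a function of the counts in the cells of a fine grid.

   For the kernels, Theta = sum_n exp (- nu_n ^ 2 / 2 - nu_n s) over the nodes
   nu_n = (n - delta) / alpha, with delta = 0 or 1 / 2, is alpha times a Riemann sum of
   the Gaussian integral sqrt (2 pi) exp (s ^ 2 / 2). With s = x + conj x' or x - conj x',
   the factors exp (x ^ 2 / 2) and exp (conj x' ^ 2 / 2) are absorbed by the determinant
   and turn the weight exp (- 2 x_R ^ 2) into exp (- |x| ^ 2). Every kernel is positive
   semidefinite, being a Gram kernel evaluated at the points x and - x, so the bound
   B ^ n follows from a bound of the diagonal, as in Hadamard's inequality. *)
Require Import Defs.
From HB Require Import structures.
From mathcomp Require Import finmap.
From mathcomp Require Import all_boot all_order all_algebra.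
From mathcomp Require Import all_classical all_reals all_analysis.
From mathcomp Require Import measurable_realfun complex spectral ring lra zify.

Set Implicit Arguments.
Unset Strict Implicit.
Unset Printing Implicit Defensive.

Import Order.TTheory GRing.Theory Num.Theory.
Import numFieldNormedType.Exports.

Local Open Scope classical_set_scope.
Local Open Scope ring_scope.

(** * Configurations and their vague topology *)

(** Continuous functions of configurations are handled without a metric: if the uniform
    approximation failed, there would be counterexamples on finer and finer grids, and along an
    ultrafilter these configurations and their discretisations would converge to one common
    configuration, against continuity. The same approximation, applied to one sample at a time,
    shows that a continuous function of a point process is measurable. The base 6 is 3 * 2: a
    truncated binomial inversion is bounded by a multiple of 3 ^ N, and 2 ^ N pays for a gain of 2 ^
    - T beyond the truncation order T. Recentering is compatible with [theta2], which changes sign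
    over one period: the sign multiplies a row and the matching column, so determinants do not
    change. Estimates are made for alpha >= 1, where rounding a point to its node displaces it by at
    most 2; one integrable majorant then serves all the Riemann sums. *)

Section conf_points.
Variable R : realType.
Implicit Types (xi : conf R) (D B : set (plane R)).

(** Infinitely many indices with an atom in [D] would give mass +oo, so local finiteness leaves
    finitely many. They form a list rather than a set because atoms may be repeated. *)
Lemma conf_points xi D : measurable D -> bounded_set D ->
  exists s : seq (plane R), {in s, forall y, D y} /\
    forall B, measurable B -> xi (B `&` D) = (\sum_(y <- s) \1_B y)%:E.
Proof.
move=> mD bD; have [J [x xiE]] := conf_atomic xi.
pose S := [set j | J j /\ D (x j)].
have SE B : measurable B -> xi (B `&` D) = \esum_(j in S) \d_(x j) B.
  move=> mB; rewrite xiE; last exact: measurableI.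
  rewrite esum_mkcond [RHS]esum_mkcond; apply: eq_esum => j _.
  rewrite !diracE in_setI; have [Jj|nJ] := pselect (J j); last first.
    by rewrite !memNset//= => -[].
  rewrite (mem_set Jj); have [Dj|nD] := pselect (D (x j)).
    by rewrite (mem_set Dj) andbT (mem_set (conj Jj Dj : S j)).
  by rewrite (memNset nD) andbF memNset// => -[].
have finS : finite_set S.
  apply: contrapT => infS; have := conf_locally_finite xi mD bD.
  have -> : xi D = xi (setT `&` D) by rewrite setTI.
  rewrite SE// (_ : esum _ _ = +oo%E)// -(infinite_card_dirac _ infS).
  by apply: eq_esum => j Sj; rewrite !diracE in_setT mem_set.
exists [seq x j | j <- enum_fset (fset_set S)]; split.
  by move=> y /mapP[j + ->]; rewrite in_fset_set// => /set_mem[].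
move=> B mB; rewrite SE// esum_fset// fsbig_finite//= big_map -sumEFin.
by apply: eq_bigr => j _; rewrite diracE indicE.
Qed.

(** On measurable subsets of [D] the measure is a finite sum of Dirac masses, which settles
    nonnegative integrands; the signed case splits [g] into its positive and negative parts. *)
Lemma conf_integral_points xi D (s : seq (plane R)) (g : plane R -> R) :
  measurable D -> {in s, forall y, D y} ->
  (forall B, measurable B -> xi (B `&` D) = (\sum_(y <- s) \1_B y)%:E) ->
  measurable_fun setT g ->
  (\int[xi]_(y in D) (g y)%:E)%E = (\sum_(y <- s) g y)%:E.
Proof.
move=> mD sD xiE mg.
have ge0E (h : plane R -> R) : (forall y, 0 <= h y) -> measurable_fun setT h ->
    (\int[xi]_(y in D) (h y)%:E)%E = (\sum_(y <- s) h y)%:E.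
  move=> h0 mh.
  pose m_ k : {measure set (plane R) -> \bar R} :=
    @dirac _ (plane R) (nth (0 : plane R) s k) R.
  rewrite (@eq_measure_integral _ _ _ D (msum m_ (size s))) => [|A mA AD].
    rewrite ge0_integral_measure_sum//; last 2 first.
    - by move=> y _; rewrite lee_fin.
    - by apply/measurable_EFinP; exact: measurable_funTS.
    rewrite (big_nth 0) big_mkord -sumEFin; apply: eq_bigr => i _.
    rewrite integral_dirac//; last first.
      by apply/measurable_EFinP; exact: measurable_funTS.
    by rewrite diracE mem_set ?mul1e//; apply: sD; rewrite mem_nth.
  rewrite -[in LHS](setIidl AD) xiE// (big_nth 0) big_mkord -sumEFin.
  by apply: eq_bigr => i _; rewrite /m_/= diracE indicE.
rewrite integralE.
rewrite (_ : (fun x => _) = EFin \o (fun y => Num.max (g y) 0)); last first.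
  by apply/funext => y; rewrite funeposE /= EFin_max.
rewrite (_ : (EFin \o g)^\-%E = EFin \o (fun y => Num.max (- g y) 0)); last first.
  by apply/funext => y; rewrite funenegE /= EFin_max.
rewrite !ge0E ?EFinB//; last 4 first.
- by move=> y; rewrite le_max lexx orbT.
- by apply: measurable_maxr => //; exact: measurable_funN.
- by move=> y; rewrite le_max lexx orbT.
- by apply: measurable_maxr.
rewrite -EFinB -sumrB; congr EFin; apply: eq_bigr => y _.
by rewrite !maxEle; case: ifPn; case: ifPn; lra.
Qed.

Lemma conf_nat xi D : measurable D -> bounded_set D ->
  exists n : nat, xi D = n%:R%:E.
Proof.
move=> mD bD; have [s [_ sE]] := conf_points xi mD bD.
exists (size s); rewrite -[in LHS](setTI D) sE//.
under eq_bigr do rewrite indicT.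
by rewrite big_const_seq count_predT iter_addr_0.
Qed.

End conf_points.

(** * Configurations built from a countable family of atoms *)

Section conf_of_atoms.
Variables (R : realType) (I : countType) (J : set I) (x : I -> plane R).

Definition atom_measure (n : nat) : {measure set (plane R) -> \bar R} :=
  if @pickle_inv I n is Some i then
    if `[< J i >] then (@dirac _ (plane R) (x i) R : {measure set _ -> \bar _})
    else mzero
  else mzero.

Definition atoms_measure : {measure set (plane R) -> \bar R} :=
  mseries atom_measure 0.

Lemma atoms_measureE B : atoms_measure B = \esum_(i in J) \d_(x i) B.
Proof.
rewrite /atoms_measure /= /mseries nneseries_esumT//.
rewrite [RHS](_ : _ = \esum_(n in pickle @` J) atom_measure n B).
  rewrite [RHS]esum_mkcond; apply: eq_esum => n _; rewrite /atom_measure.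
  case: ifPn => // /negP nJ; have := @pickle_invK I n.
  case: (@pickle_inv I n) => [i /= iE|//]; case: asboolP => // Ji.
  by exfalso; apply: nJ; apply/mem_set; exists i.
rewrite esum_image => [|i j _ _]; last exact: (pcan_inj pickleK).
apply: eq_esum => i Ji.
by rewrite /atom_measure pickleK_inv asboolT.
Qed.

Hypothesis fin : forall r, finite_set [set i | J i /\ `|x i| <= r].

Lemma atoms_measure_setI (D : set (plane R)) (s : seq I) :
  uniq s -> (forall i, i \in s <-> J i /\ D (x i)) ->
  forall B, atoms_measure (B `&` D) = (\sum_(i <- s) \1_B (x i))%:E.
Proof.
move=> us sE B; rewrite atoms_measureE.
rewrite (_ : esum _ _ = \esum_(i in [set` s]) \d_(x i) B); last first.
  rewrite esum_mkcond [RHS]esum_mkcond; apply: eq_esum => i _.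
  have [/sE[Ji Di]|nis] := boolP (i \in s).
    by rewrite mem_set// mem_set/= ?sE// !diracE in_setI (mem_set Di) andbT.
  rewrite [in RHS]memNset//=; last exact/negP.
  case: ifPn => // /set_mem Ji; rewrite diracE memNset// => -[_ Di].
  by move/negP : nis; apply; exact/sE.
rewrite esum_fset//; last exact: finite_seq.
rewrite -fsbig_seq// -sumEFin; apply: eq_bigr => i _.
by rewrite diracE indicE.
Qed.

Let atomic : exists (J : set nat) (x : nat -> plane R),
  forall B, measurable B -> atoms_measure B = \esum_(j in J) \d_(x j) B.
Proof.
exists (pickle @` J), (fun n => if @pickle_inv I n is Some i then x i else 0).
move=> B _; rewrite atoms_measureE esum_image => [|i j _ _]; last first.
  exact: (pcan_inj pickleK).
by apply: eq_esum => i _; rewrite pickleK_inv.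
Qed.

Let locally_finite (B : set (plane R)) :
  measurable B -> bounded_set B -> (atoms_measure B < +oo)%E.
Proof.
move=> mB; rewrite /= /bounded_near; near_simpl => -[M [_ HM]].
have BM y : B y -> `|y| <= M + 1 by move=> By; apply: (HM (M + 1)) => //; rewrite ltrDl.
have /finite_seqP[s sE] := fin (M + 1).
have -> : B = B `&` [set y | `|y| <= M + 1].
  by apply/esym/setIidl.
rewrite (@atoms_measure_setI _ (undup s)) ?ltry ?undup_uniq// => i.
rewrite mem_undup; have -> : i \in s = [set` s] i :> Prop by [].
by rewrite -sE.
Qed.

Definition conf_of_atoms : conf R := Conf atomic locally_finite.

Lemma conf_of_atoms_integral (D : set (plane R)) (s : seq I) g :
  measurable D -> uniq s -> (forall i, i \in s <-> J i /\ D (x i)) ->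
  measurable_fun setT g ->
  (\int[conf_of_atoms]_(y in D) (g y)%:E)%E = (\sum_(i <- s) g (x i))%:E.
Proof.
move=> mD us sE mg; rewrite (@conf_integral_points _ _ _ (map x s))//.
- by rewrite big_map.
- by move=> y /mapP[i /sE[_ Di] ->].
- by move=> B mB; rewrite big_map/= (atoms_measure_setI us sE).
Qed.

End conf_of_atoms.

(** * Limits of configurations along ultrafilters *)

Section vague_limits.
Variable R : realType.
Implicit Types (xi : conf R).

(** In an initial topology for a product, convergence is tested one coordinate at a time, here one
    test function at a time. The filter is arbitrary because the lemma is applied along an
    ultrafilter. *)
Lemma vague_cvg (T : Type) (U : set_system T) (xi : T -> conf R) (zeta : conf R)
    (F : vague_conf R -> R) : Filter U -> continuous F ->
  (forall f : test_function R,
     (\int[xi m]_x f x) @[m --> U] --> \int[zeta]_x f x) ->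
  F (xi m) @[m --> U] --> F zeta.
Proof.
move=> FU cF cvf.
have cve : (vague_eval (xi m) @[m --> U]) --> vague_eval zeta.
  apply/cvg_sup => f A [_ [[C Co <-] Cz CA]].
  have : nbhs (\int[zeta]_x f x) C by exact: open_nbhs_nbhs.
  move=> /(cvf f) UC; rewrite /= !nbhs_simpl/= in UC *; apply: filterS UC => m Cm.
  by apply: CA.
apply: (@cvg_comp _ _ _ xi F U (nbhs (zeta : vague_conf R))); last exact: cF.
move=> A [_ [[C Co <-] Cz CA]].
have : nbhs (vague_eval zeta) C by exact: open_nbhs_nbhs.
move=> /cve UC; rewrite /= !nbhs_simpl/= in UC *; apply: filterS UC => m Cm.
exact: CA.
Qed.

Lemma ultra_bounded_nat (T : Type) (U : set_system T) (g : T -> nat) M :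
  UltraFilter U -> U [set m | (g m <= M)%N] -> exists n, U [set m | g m = n].
Proof.
move=> UU; elim: M => [|M IH] UM.
  by exists 0%N; apply: filterS UM => m /=; rewrite leqn0 => /eqP.
have [U1|U1] := in_ultra_setVsetC [set m | (g m <= M)%N] UU; first exact: IH.
exists M.+1; apply: filterS2 UM U1 => m /= m1 /negP; rewrite -ltnNge => m2.
by apply/eqP; rewrite eqn_leq m1.
Qed.

Lemma fmap_ultra (S T : Type) (f : S -> T) (U : set_system S) :
  UltraFilter U -> UltraFilter (f @ U).
Proof.
move=> UU; split=> [|G PG sUG]; first exact: fmap_proper_filter.
apply/seteqP; split => [A GA|]; last exact: sUG.
have [//|UA] := in_ultra_setVsetC (f @^-1` A) UU.
have GAC : G (~` A) by exact: sUG.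
have G0 : G set0 by rewrite -(setICr A); exact: filterI.
by have := @filter_not_empty _ _ PG G0.
Qed.

Lemma compact_ball (r : R) : compact [set y : plane R | `|y| <= r].
Proof.
have -> : [set y : plane R | `|y| <= r] = `[- r, r] `*` `[- r, r].
  apply/seteqP; split => -[a b] /=; rewrite prod_normE /= ge_max !ler_norml !in_itv.
    by move=> /andP[].
  by move=> [-> ->].
by apply: compact_setX; exact: segment_compact.
Qed.

Lemma closed_norm_ge (r : R) : closed [set y : plane R | r <= `|y|].
Proof.
apply: (@preimage_closed _ _ (fun y : plane R => `|y|) [set x | r <= x]).
  by move=> y _; exact: norm_continuous.
exact: closed_ge.
Qed.

Lemma measurable_norm_plane : measurable_fun setT (fun y : plane R => `|y|).
Proof.
rewrite (_ : (fun y => _) = (fun y : plane R => Num.max `|y.1| `|y.2|)); last first.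
  by apply/funext => y; rewrite prod_normE.
by apply: measurable_maxr; apply: measurableT_comp.
Qed.

Lemma measurable_norm_itv (i : interval R) :
  measurable [set y : plane R | `|y| \in i].
Proof.
rewrite -[X in measurable X]setTI.
exact: (measurable_norm_plane _ (measurable_itv i)).
Qed.

Lemma bounded_norm_le (r : R) (D : set (plane R)) :
  (forall y, D y -> `|y| <= r) -> bounded_set D.
Proof.
move=> Dr; exists r; split; first exact: num_real.
by move=> M rM y /Dr /le_trans; apply; exact: ltW.
Qed.

Lemma Rintegral_support xi (D : set (plane R)) g :
  (forall y, ~ D y -> g y = 0) ->
  \int[xi]_y g y = fine (\int[xi]_(y in D) (g y)%:E)%E.
Proof.
move=> g0; rewrite /Rintegral [in RHS]integral_mkcond; congr fine.
apply: eq_integral => y _; rewrite patchE; case: ifPn => // /negP yD.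
by rewrite g0// => Dy; apply: yD; exact: mem_set.
Qed.

(* Sequential compactness along an ultrafilter: the atoms of [xi m] in each
   annulus are enumerated, their coordinatewise limits are the atoms of [zeta]. *)
Lemma conf_ultra_limit (U : set_system nat) (xi : nat -> conf R) (N : nat -> nat) :
  UltraFilter U ->
  (forall m k, (xi m [set y | (`|y| <= k%:R)%R] <= (N k)%:R%:E)%E) ->
  exists zeta : conf R, forall (g : nat -> plane R -> R) (f : plane R -> R) (K : nat),
    (forall m, measurable_fun setT (g m)) -> measurable_fun setT f ->
    U [set m | forall y : plane R, K%:R <= `|y| -> g m y = 0] ->
    (forall y : plane R, K%:R <= `|y| -> f y = 0) ->
    (forall (y_ : nat -> plane R) y, y_ @ U --> y -> g m (y_ m) @[m --> U] --> f y) ->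
    (\int[xi m]_y g m y) @[m --> U] --> \int[zeta]_y f y.
Proof.
move=> UU xiN.
(* The half-open annuli [A k] partition the plane and [D K] is the union of the first [K] of them;
   the number of atoms in each is bounded uniformly in [m]. *)
pose A k := [set y : plane R | `|y| \in `[(k%:R : R), k.+1%:R[ ].
pose D k := [set y : plane R | `|y| \in `]-oo, (k%:R : R)[ ].
have mA k : measurable (A k) by exact: measurable_norm_itv.
have mD k : measurable (D k) by exact: measurable_norm_itv.
have bA k : bounded_set (A k).
  by apply: (@bounded_norm_le k.+1%:R) => y; rewrite /A/= in_itv/= => /andP[_ /ltW].
have /choice[s sP] : forall p : nat * nat, exists s : seq (plane R),
    {in s, forall y, A p.2 y} /\
    forall B, measurable B -> xi p.1 (B `&` A p.2) = (\sum_(y <- s) \1_B y)%:E.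
  by move=> p; exact: conf_points.
have DS m B K : measurable B ->
    xi m (B `&` D K) =
    (\sum_(y <- flatten [seq s (m, k) | k <- iota 0 K]) \1_B y)%:E.
  move=> mB; elim: K => [|K IH].
    rewrite (_ : D 0%N = set0) ?setI0 ?measure0 ?big_nil//.
    by apply/seteqP; split => y //; rewrite /D/= in_itv/= normr_lt0.
  rewrite -addn1 iotaD map_cat flatten_cat big_cat EFinD -IH/= cats0 add0n addn1.
  rewrite -(sP (m, K)).2// -measureU//; last 3 first.
  - exact: measurableI.
  - exact: measurableI.
  - apply/seteqP; split => y //= [[_]]; rewrite /D /A/= !in_itv/= => yK [_].
    by rewrite leNgt yK.
  rewrite -setIUr; congr (xi m (B `&` _)); apply/seteqP; split => y;
    rewrite /D /A /= !in_itv/=.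
    by move=> yK; have [?|?] := ltP `|y| (K%:R : R); [left|right; apply/andP].
  by case=> [/lt_le_trans|/andP[_//]]; apply; rewrite ler_nat.
have sizeN m k : (size (s (m, k)) <= N k.+1)%N.
  rewrite -(ler_nat R) -lee_fin; apply: le_trans (xiN m k.+1).
  have -> : (size (s (m, k)))%:R%:E = xi m (setT `&` A k).
    rewrite (sP (m, k)).2//; under eq_bigr do rewrite indicT.
    by rewrite big_const_seq count_predT iter_addr_0.
  apply: le_measure; rewrite ?inE.
  - exact: measurableI.
  - rewrite (_ : mkset _ = [set y : plane R | `|y| \in `]-oo, k.+1%:R]]).
      exact: measurable_norm_itv.
    by apply/seteqP; split => y /=; rewrite in_itv.
  - by move=> y [_]; rewrite /A/= in_itv/= => /andP[_ /ltW].
(* A bounded integer is constant on a member of the ultrafilter, so each annulus contributes a fixed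
   number [n k] of atoms to the limit. *)
have /choice[n nP] : forall k, exists n, U [set m | size (s (m, k)) = n].
  move=> k; apply: (@ultra_bounded_nat _ _ _ (N k.+1)) => //.
  by apply: filterS filterT => m _; exact: sizeN.
(* The [i]-th atoms stay in a compact closed annulus and so converge along [U]. The lower bound on
   the norm of the limit gives local finiteness of the limit family. *)
have /choice[y yP] : forall p : nat * nat, exists y : plane R, (p.2 < n p.1)%N ->
    p.1%:R <= `|y| /\ nth 0 (s (m, p.1)) p.2 @[m --> U] --> y.
  move=> [k i] /=; have [ilt|_] := ltnP i (n k); last by exists 0.
  have : compact ([set y : plane R | `|y| <= k.+1%:R] `&` [set y | k%:R <= `|y|]).
    by apply: compact_closedI; [exact: compact_ball|exact: closed_norm_ge].
  rewrite compact_ultra.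
  move=> /(_ (nth 0 (s (m, k)) i @[m --> U]) (fmap_ultra _ _)) [|z [[zk kz] cvz]].
    apply: (@filterS _ U _ [set m | size (s (m, k)) = n k]) (nP k) => m /= sn.
    have /(sP (m, k)).1 : nth 0 (s (m, k)) i \in s (m, k).
      by rewrite mem_nth// sn.
    by rewrite /A/= in_itv/= => /andP[? /ltW].
  by exists z.
pose J := [set p : nat * nat | (p.2 < n p.1)%N].
pose sK K := flatten [seq [seq (k, i) | i <- iota 0 (n k)] | k <- iota 0 K].
have sKP K p : p \in sK K <-> (p.1 < K)%N /\ J p.
  split=> [/flattenP[_ /mapP[k + ->] /mapP[i + ->]]|].
    by rewrite !mem_iota /J/= !add0n.
  case: p => k i [/= kK ki]; apply/flattenP; exists [seq (k, i) | i <- iota 0 (n k)].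
    by apply: map_f; rewrite mem_iota.
  by apply: map_f; rewrite mem_iota.
have finJ r : finite_set [set p | J p /\ `|y p| <= r].
  apply: (@sub_finite_set _ _ [set` sK (Num.truncn r).+1]) => // p /= [Jp pr].
  apply/sKP; split => //; rewrite ltnS truncn_ge_nat ?(le_trans _ pr)//.
  exact: (yP p Jp).1.
(* The hypothesis [gf] is continuous convergence of [g m] to [f]: it covers both a fixed continuous
   function and the discontinuous step functions of finer and finer grids. *)
exists (conf_of_atoms finJ) => g f K mg mf Ug f0 gf.
have f0' z : ~ D K z -> f z = 0.
  by move=> /negP; rewrite /D/= in_itv/= -leNgt; exact: f0.
rewrite (Rintegral_support _ f0').
rewrite (@conf_of_atoms_integral _ _ _ _ _ _ [seq p <- sK K | `|y p| < K%:R])//; last 2 first.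
- apply/filter_uniq/allpairs_uniq_dep => //; first exact: iota_uniq.
    by move=> k _; exact: iota_uniq.
  by move=> [k i] [k' i'] _ _ /= [-> ->].
- move=> p; rewrite mem_filter; split => [/andP[pK /sKP[_ Jp]]|[Jp]].
    by split => //; rewrite /D/= in_itv.
  rewrite /D/= in_itv/= => pK; rewrite pK; apply/sKP; split => //.
  by rewrite -(ltr_nat R) (le_lt_trans _ pK)//; exact: (yP p Jp).1.
rewrite big_filter big_mkcond/=.
(* A limit of atoms of the half-open annulus [k] can reach norm [k.+1], so some atoms indexed by
   [sK K] may fall outside the open ball [D K]; [f] vanishes there. *)
have -> : \sum_(p <- sK K) (if `|y p| < K%:R then f (y p) else 0) =
    \sum_(p <- sK K | p \in sK K) f (y p).
  rewrite -big_seq; apply: eq_bigr => p _.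
  by case: ltP => // /f0 ->.
have Un k : U [set m | forall j, (j < k)%N -> size (s (m, j)) = n j].
  elim: k => [|k IH]; first by apply: filterS filterT.
  apply: filterS2 IH (nP k) => m /= IH mk j.
  by rewrite ltnS leq_eqVlt => /predU1P[->//|/IH].
have gE : {near U, (fun m => \sum_(p <- sK K | p \in sK K)
    g m (nth 0 (s (m, p.1)) p.2)) =1 (fun m => \int[xi m]_z g m z)}.
  apply: filterS2 Ug (Un K) => m /= g0 sn.
  rewrite (@Rintegral_support _ (D K)); last first.
    by move=> z /negP; rewrite /D/= in_itv/= -leNgt; exact: g0.
  rewrite (@conf_integral_points _ _ _ (flatten [seq s (m, k) | k <- iota 0 K]))//.
  - rewrite -big_seq !big_flatten !big_map /=.
    rewrite big_seq [RHS]big_seq; apply: eq_bigr => k.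
    rewrite mem_iota => kK; rewrite big_map [RHS](big_nth (0 : plane R)) /index_iota subn0 sn//.
  - move=> z /flattenP[_ /mapP[k + ->]]; rewrite mem_iota add0n => /= kK.
    move=> /(sP (m, k)).1; rewrite /A/D/= !in_itv/= => /andP[_ /lt_le_trans]; apply.
    by rewrite ler_nat.
  - by move=> B mB; exact: DS.
apply: cvg_trans (near_eq_cvg gE) _.
apply: cvg_big => //; [exact: add_continuous|].
move=> p /sKP[_ Jp]; apply: gf.
exact: (yP p Jp).2.
Qed.

End vague_limits.

(** * Discretisation of configurations on a grid *)

Section grid.
Variables (R : realType) (m : nat).

(** One parameter both refines the mesh [1 / m.+1] and enlarges the window [[- m, m[]; this is why
    there are [m.*2 * m.+1] cells per side. *)
Definition grid_lo (a : nat) : R := a%:R / m.+1%:R - m%:R.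
Definition grid_idx := ('I_(m.*2 * m.+1) * 'I_(m.*2 * m.+1))%type.
Definition grid_cell (c : grid_idx) : set (plane R) :=
  `[grid_lo c.1, grid_lo c.1.+1[ `*` `[grid_lo c.2, grid_lo c.2.+1[.
Definition grid_corner (c : grid_idx) : plane R := (grid_lo c.1, grid_lo c.2).
Definition grid_step (f : plane R -> R) (y : plane R) : R :=
  \sum_(c : grid_idx) f (grid_corner c) * \1_(grid_cell c) y.

Lemma measurable_grid_cell c : measurable (grid_cell c).
Proof. by apply: measurableX; exact: measurable_itv. Qed.

Lemma grid_lo_inj (a b : nat) (t : R) : grid_lo a <= t < grid_lo a.+1 ->
  grid_lo b <= t < grid_lo b.+1 -> a = b.
Proof.
have m0 : (0 : R) < m.+1%:R by rewrite ltr0n.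
have loE k : (grid_lo k <= t < grid_lo k.+1) =
    (k%:R <= (t + m%:R) * m.+1%:R < k.+1%:R).
  by rewrite /grid_lo lerBlDr ltrBrDr ler_pdivrMr// ltr_pdivlMr.
by rewrite !loE => /truncn_def <- /truncn_def <-.
Qed.

Lemma grid_cell_inj c c' y : grid_cell c y -> grid_cell c' y -> c = c'.
Proof.
case: c c' => [a b] [a' b'] [/= + +] [/= + +]; rewrite !in_itv/= => h1 h2 h3 h4.
by congr (_, _); apply/val_inj; [exact: (grid_lo_inj h1)|exact: (grid_lo_inj h2)].
Qed.

Lemma grid_cell_near c y : grid_cell c y -> `|grid_corner c - y| <= m.+1%:R^-1.
Proof.
case: c y => [a b] [y1 y2] [/=]; rewrite !in_itv/= => /andP[h1 h2] /andP[h3 h4].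
have loS k : grid_lo k.+1 = grid_lo k + m.+1%:R^-1.
  by rewrite /grid_lo -natr1 mulrDl mul1r addrAC.
have near (l t h : R) : l <= t -> t < l + h -> `|l - t| <= h.
  by move=> lt th; rewrite ler_norml; apply/andP; split; lra.
by rewrite prod_normE/= ge_max !near// -loS.
Qed.

Lemma grid_lo_ex (t : R) : `|t| < m%:R ->
  exists a : 'I_(m.*2 * m.+1), grid_lo a <= t < grid_lo a.+1.
Proof.
move=> /ltr_normlP[t1 t2].
have m0 : (0 : R) < m.+1%:R by rewrite ltr0n.
have s0 : 0 <= (t + m%:R) * m.+1%:R by rewrite mulr_ge0//; lra.
have alt : (Num.truncn ((t + m%:R) * m.+1%:R) < m.*2 * m.+1)%N.
  rewrite truncn_lt_nat// natrM ltr_pM2r// -addnn natrD; lra.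
exists (Ordinal alt) => /=; have /andP[h1 h2] := truncn_itv s0.
by rewrite /grid_lo lerBlDr ltrBrDr ler_pdivrMr// ltr_pdivlMr// h1.
Qed.

Lemma grid_cell_ex (y : plane R) : `|y| < m%:R -> exists c, grid_cell c y.
Proof.
case: y => y1 y2; rewrite prod_normE/= gt_max => /andP[/grid_lo_ex[a ha]].
by move=> /grid_lo_ex[b hb]; exists (a, b); split => /=; rewrite in_itv.
Qed.

Lemma grid_cell_norm c y : grid_cell c y -> `|y| <= m%:R.
Proof.
have loN k : - m%:R <= grid_lo k.
  by rewrite /grid_lo lerBrDr addrC subrr divr_ge0.
have loP (k : 'I_(m.*2 * m.+1)) : grid_lo k.+1 <= m%:R.
  rewrite /grid_lo lerBlDr ler_pdivrMr ?ltr0n// -natrD addnn -natrM ler_nat.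
  exact: ltn_ord.
case: c y => [a b] [y1 y2] [/=]; rewrite !in_itv/= => /andP[h1 h2] /andP[h3 h4].
have := (loN a, loN b, loP a, loP b) => -[[[? ?] ?] ?].
rewrite prod_normE/= ge_max !ler_norml; apply/andP; split; apply/andP; split; lra.
Qed.

Lemma bounded_grid_cell c : bounded_set (grid_cell c).
Proof. by apply: (@bounded_norm_le _ m%:R) => y; exact: grid_cell_norm. Qed.

Lemma trivIset_grid_cell : trivIset setT grid_cell.
Proof. by move=> c c' _ _ [y [cy c'y]]; exact: grid_cell_inj cy c'y. Qed.

Lemma grid_stepE f c y : grid_cell c y -> grid_step f y = f (grid_corner c).
Proof.
move=> cy; rewrite /grid_step (bigD1 c)//= indicE mem_set// mulr1.
rewrite big1 ?addr0// => c' c'c; rewrite indicE memNset ?mulr0// => c'y.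
by move/eqP : c'c; apply; exact: grid_cell_inj c'y cy.
Qed.

Lemma grid_step_eq0 f y : (forall c, grid_cell c y -> f (grid_corner c) = 0) ->
  grid_step f y = 0.
Proof.
move=> f0; apply: big1 => c _; have [cy|nc] := pselect (grid_cell c y).
  by rewrite f0// mul0r.
by rewrite indicE memNset// mulr0.
Qed.

Lemma measurable_grid_step f : measurable_fun setT (grid_step f).
Proof.
apply: measurable_sum => c; apply: measurable_funM => //.
by apply: measurable_indic; exact: measurable_grid_cell.
Qed.

Lemma grid_corner_norm c : `|grid_corner c| <= m%:R.
Proof.
apply: (@grid_cell_norm c).
have loS k : grid_lo k < grid_lo k.+1.
  by rewrite /grid_lo ltrD2r ltr_pM2r ?invr_gt0 ?ltr0n// ltr_nat.
by split => /=; rewrite in_itv/= lexx loS.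
Qed.

Definition grid_count (xi : conf R) : {ffun grid_idx -> nat} :=
  [ffun c => Num.truncn (fine (xi (grid_cell c)))].

Lemma grid_countE (xi : conf R) c : (grid_count xi c)%:R = fine (xi (grid_cell c)).
Proof.
rewrite ffunE.
have [n ->] := conf_nat xi (measurable_grid_cell c) (bounded_grid_cell c).
by rewrite /= natrK.
Qed.

Section grid_conf.
Variable n : {ffun grid_idx -> nat}.

Let J := [set p : grid_idx * nat | (p.2 < n p.1)%N].
Let s := flatten [seq [seq (c, i) | i <- iota 0 (n c)] | c <- enum {: grid_idx}].

Let sP p : p \in s <-> J p.
Proof.
split=> [/flattenP[_ /mapP[k + ->] /mapP[i + ->]]|].
  by rewrite !mem_iota /J/= !add0n.
case: p => k i /= ki; apply/flattenP; exists [seq (k, i) | i <- iota 0 (n k)].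
  by apply: map_f; rewrite mem_enum.
by apply: map_f; rewrite mem_iota.
Qed.

Let finJ r : finite_set [set p | J p /\ `|grid_corner p.1| <= r].
Proof.
by apply: (@sub_finite_set _ _ [set` s]) => // p /= [Jp pr]; exact/sP.
Qed.

(* [n c] atoms at the lower left corner of each cell [c]. *)
Definition grid_conf : conf R := conf_of_atoms finJ.

Lemma grid_conf_integral (f : plane R -> R) (K : nat) :
  measurable_fun setT f -> (forall y, K%:R <= `|y| -> f y = 0) ->
  \int[grid_conf]_y f y = \sum_c (n c)%:R * f (grid_corner c).
Proof.
move=> mf f0; pose D := [set y : plane R | `|y| \in `]-oo, (K + m)%:R]].
rewrite (@Rintegral_support _ _ D); last first.
  move=> y /negP; rewrite /D/= in_itv/= -ltNge => Ky; apply: f0.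
  by apply: le_trans (ltW Ky); rewrite ler_nat leq_addr.
rewrite (@conf_of_atoms_integral _ _ _ _ _ _ s)//=.
- rewrite big_flatten big_map -big_enum; apply: eq_bigr => c _.
  by rewrite big_map/= big_const_seq count_predT iter_addr_0 size_iota mulr_natl.
- exact: measurable_norm_itv.
- apply/allpairs_uniq_dep => //; first exact: enum_uniq.
    by move=> k _; exact: iota_uniq.
  by move=> [k i] [k' i'] _ _ /= [-> ->].
- move=> p; split=> [/sP Jp|[/sP//]]; split => //; rewrite /D/= in_itv/=.
  by apply: le_trans (grid_corner_norm _) _; rewrite ler_nat leq_addl.
Qed.

End grid_conf.

(** With [grid_conf_integral] this is a duality: testing the discretised configuration with [f]
    equals testing the original one with the step function of [f]. Convergence of discretised
    configurations thus becomes convergence of test functions. *)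
Lemma grid_step_integral (xi : conf R) f :
  \int[xi]_y grid_step f y = \sum_c (grid_count xi c)%:R * f (grid_corner c).
Proof.
pose D := [set y : plane R | `|y| \in `]-oo, m%:R]].
have mD : measurable D by exact: measurable_norm_itv.
have bD : bounded_set D.
  by apply: (@bounded_norm_le _ m%:R) => y; rewrite /D/= in_itv.
have [s [sD sE]] := conf_points xi mD bD.
rewrite (@Rintegral_support _ _ D); last first.
  move=> y Dy; apply: grid_step_eq0 => c cy; exfalso; apply: Dy.
  by rewrite /D/= in_itv/=; exact: grid_cell_norm cy.
rewrite (conf_integral_points mD sD sE)/=; last exact: measurable_grid_step.
rewrite exchange_big; apply: eq_bigr => c _; rewrite -big_distrr/= [LHS]mulrC.
congr (_ * _); rewrite grid_countE.
have <- : xi (grid_cell c `&` D) = xi (grid_cell c).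
  congr (xi _); apply/setIidl => y cy.
  by rewrite /D/= in_itv/=; exact: grid_cell_norm cy.
by rewrite sE//; exact: measurable_grid_cell.
Qed.

End grid.

(** The point moves together with the mesh, which is the form of convergence that [conf_ultra_limit]
    asks for. The corner of the cell of [y_ j] is within [1 / (m j).+1] of [y_ j], hence tends to
    [y]. *)
Lemma grid_step_cvg (R : realType) (T : Type) (U : set_system T) (m : T -> nat)
    (f : plane R -> R) (y_ : T -> plane R) (y : plane R) :
  Filter U -> m @ U --> \oo -> continuous f -> y_ @ U --> y ->
  grid_step (m j) f (y_ j) @[j --> U] --> f y.
Proof.
move=> FU mU cf yU; apply/cvgrPdist_lt => e e0.
have /cvgrPdist_lt/(_ _ e0) := cf y.
move=> /nbhs_ballP[d /= d0 fd].
have d20 : 0 < d / 2 by rewrite divr_gt0.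
have h1 : \forall j \near U, `|y - y_ j| < d / 2.
  by move/cvgrPdist_lt : yU => /(_ _ d20).
have h2 : \forall j \near U, (m j).+1%:R^-1 < d / 2.
  suff : \forall k \near \oo, k.+1%:R^-1 < d / 2 by move/mU.
  have /cvgrPdist_lt/(_ _ d20) := @cvg_harmonic R.
  by apply: filterS => k /=; rewrite /harmonic/= sub0r normrN ger0_norm.
have h3 : \forall j \near U, `|y| + d / 2 < (m j)%:R.
  have /mU// : \forall k \near \oo, `|y| + d / 2 < k%:R by exact: nbhs_infty_gtr.
near=> j.
have hj1 : `|y - y_ j| < d / 2 by near: j.
have hj2 : (m j).+1%:R^-1 < d / 2 by near: j.
have hj3 : `|y| + d / 2 < (m j)%:R by near: j.
have [c cy] : exists c, @grid_cell R (m j) c (y_ j).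
  apply: grid_cell_ex; apply: le_lt_trans hj3.
  have -> : y_ j = y - (y - y_ j) by rewrite opprB addrCA subrr addr0.
  by apply: (le_trans (ler_normB _ _)); rewrite lerD2l ltW.
rewrite (grid_stepE _ cy); apply: fd; rewrite -ball_normE/=.
have -> : y - grid_corner R c = (y - y_ j) - (grid_corner R c - y_ j).
  by rewrite opprB addrA subrK.
apply: (le_lt_trans (ler_normB _ _)); rewrite [d]splitr; apply: ltrD => //.
exact: le_lt_trans (grid_cell_near cy) hj2.
Unshelve. all: by end_near. Qed.

Section grid_approximation.
Variable R : realType.

Lemma test_function_support (f : test_function R) :
  exists K : nat, forall y, K%:R <= `|y| -> f y = 0.
Proof.
have [M [_ HM]] := compact_bounded (@test_fun_compact _ f).
have MM y : f y != 0 -> `|y| <= M + 1.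
  by move=> fy; apply: (HM (M + 1)); [rewrite ltrDl|exact: subset_closure].
exists (Num.truncn (M + 1)).+1 => y Ky; apply: contrapT => /eqP /MM.
by move=> /(le_trans Ky); rewrite leNgt truncnS_gt.
Qed.

(** The sigma-algebra of [plane] is the product one, so measurability comes from the pointwise limit
    of grid step functions. *)
Lemma measurable_continuous_plane (f : plane R -> R) :
  continuous f -> measurable_fun setT f.
Proof.
move=> cf; apply: (@measurable_fun_cvg _ _ _ _ (fun m => @grid_step R m f)).
  by move=> m; exact: measurable_grid_step.
by move=> y _; apply: (@grid_step_cvg R _ _ id f (fun=> y)) => //; exact: cvg_cst.
Qed.

(** The bounds [N k] confine [xi] to a class where ultrafilter limits exist. Counterexamples [xi j]
    at scales [mm j] tending to infinity would have, along an ultrafilter, the same limit as their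
    discretisations, so both values of [F] would tend to [F zeta]. *)
Lemma grid_approx (F : vague_conf R -> R) (N : nat -> nat) (e : R) :
  continuous F -> 0 < e ->
  exists m0, forall m (xi : conf R), (m0 <= m)%N ->
    (forall k, (xi [set y | (`|y| <= k%:R)%R] <= (N k)%:R%:E)%E) ->
    `|F (@grid_conf R _ (@grid_count R m xi)) - F xi| < e.
Proof.
move=> cF e0; apply: contrapT => /forallNP H.
have /choice[p pP] : forall j, exists p : nat * conf R, [/\ (j <= p.1)%N,
    forall k, (p.2 [set y | (`|y| <= k%:R)%R] <= (N k)%:R%:E)%E &
    e <= `|F (@grid_conf R _ (@grid_count R p.1 p.2)) - F p.2|].
  move=> j; apply: contrapT => /forallNP Hj; apply: (H j) => m xi jm xiN.
  by rewrite ltNge; apply/negP => eF; apply: (Hj (m, xi)).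
pose mm j := (p j).1; pose xi j := (p j).2.
have [U [UU oU]] := @ultraFilterLemma _ \oo _.
have mmU : mm @ U --> \oo.
  move=> A [n0 _ nA]; apply: (@filterS _ U _ [set j | (n0 <= j)%N]).
    by move=> j /= nj; apply: nA => /=; apply: leq_trans nj _; have [] := pP j.
  by apply: oU; exists n0.
have xiN j k : (xi j [set y | (`|y| <= k%:R)%R] <= (N k)%:R%:E)%E.
  by have [] := pP j.
have [zeta zP] := conf_ultra_limit UU xiN.
have c1 : F (xi j) @[j --> U] --> F zeta.
  apply: vague_cvg => // f; have [K fK] := test_function_support f.
  have cf := @test_fun_continuous _ f.
  apply: (zP (fun=> f) f K) => //.
  - by move=> m; exact: measurable_continuous_plane.
  - exact: measurable_continuous_plane.
  - by apply: filterS filterT.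
  - by move=> y_ y yU; apply: continuous_cvg => //; exact: cf.
have c2 : F (@grid_conf R _ (@grid_count R (mm j) (xi j))) @[j --> U] --> F zeta.
  apply: vague_cvg => // f; have [K fK] := test_function_support f.
  have cf := @test_fun_continuous _ f.
  under eq_cvg do rewrite (grid_conf_integral _ (measurable_continuous_plane cf) fK)
    -grid_step_integral.
  (* Corners lie within distance 1 of the points of their cells, so the support bound grows from [K]
     to [K.+1]. *)
  apply: (zP (fun j => @grid_step R (mm j) f) f K.+1) => //.
  - by move=> m; exact: measurable_grid_step.
  - exact: measurable_continuous_plane.
  - apply: filterS filterT => j _ y Ky; apply: grid_step_eq0 => c cy; apply: fK.
    have lin (a b c' d k : R) : a <= b + c' -> c' <= d -> d <= 1 -> k + 1 <= a -> k <= b.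
      by lra.
    apply: (lin `|y| _ _ _ _ _ (grid_cell_near cy)).
    - by rewrite -{1}(subKr (grid_corner R c) y) ler_normB.
    - by rewrite invf_le1 ?ler1n ?ltr0n.
    - by rewrite natr1.
  - by move=> y Ky; apply: fK; apply: le_trans Ky; rewrite ler_nat.
  - by move=> y_ y yU; exact: grid_step_cvg.
have : (F (@grid_conf R _ (@grid_count R (mm j) (xi j))) - F (xi j)) @[j --> U] --> 0.
  by rewrite -(subrr (F zeta)); exact: cvgB.
move=> /cvgrPdist_lt/(_ _ e0) Ue.
have [j] := filter_ex Ue; rewrite sub0r normrN.
by apply/negP; rewrite -leNgt; have [] := pP j.
Qed.

End grid_approximation.

(** * Factorial moments determine the law of the counts *)

Section binomial_expansions.
Variable R : realType.

Lemma prod_ffactr (n k : nat) : \prod_(i < k) (n%:R - i%:R) = (n ^_ k)%:R :> R.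
Proof.
elim: k => [|k IH]; first by rewrite big_ord0 ffactn0.
rewrite big_ord_recr/= IH ffactnSr natrM; have [kn|nk] := leqP k n.
  by rewrite natrB.
by rewrite ffact_small// !mul0r.
Qed.

Lemma coef_Xsub1_exp (k a : nat) :
  (('X - 1 : {poly R}) ^+ k)`_a = (-1) ^+ (k + a) * 'C(k, a)%:R.
Proof.
elim: k a => [|k IH] a; first by rewrite expr0 coef1; case: a => [|a]; rewrite ?mulr1 ?mulr0.
rewrite exprSr mulrBr mulr1 coefB coefMX; case: a => [|a] /=.
  by rewrite IH !addn0 !bin0 sub0r !mulr1 exprS mulN1r.
by rewrite !IH binS natrD !addnS !addSn !exprS; ring.
Qed.

(** Compare the coefficients of degree [a] in [X ^ n = ((X - 1) + 1) ^ n]; the terms with [k > n]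
    vanish, so any [T > n] gives the full sum. *)
Lemma bin_inversion (n a T : nat) : (n < T)%N ->
  \sum_(k < T) ((-1) ^+ (k + a) * 'C(k, a)%:R) * 'C(n, k)%:R = (n == a)%:R :> R.
Proof.
move=> nT; have -> : (n == a)%:R = ((('X - 1 : {poly R}) + 1) ^+ n)`_a :> R.
  by rewrite subrK coefXn eq_sym.
rewrite addrC exprDn coef_sum.
rewrite -(big_mkord predT (fun k => (-1) ^+ (k + a) * 'C(k, a)%:R * 'C(n, k)%:R)).
rewrite (big_cat_nat (leq0n _) nT)/= [X in _ + X]big1_seq ?addr0; last first.
  by move=> i /=; rewrite mem_index_iota => /andP[ni _]; rewrite [X in _ * X%:R]bin_small// mulr0.
rewrite big_mkord; apply: eq_bigr => k _.
by rewrite expr1n mul1r coefMn coef_Xsub1_exp mulr_natr.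
Qed.

Lemma sum_bin_le (k x T : nat) : (\sum_(a < T) 'C(k, a) * x ^ a <= x.+1 ^ k)%N.
Proof.
have -> : (x.+1 ^ k = \sum_(0 <= a < k.+1) 'C(k, a) * x ^ a)%N.
  rewrite -add1n Pascal big_mkord; apply: eq_bigr => i _.
  by rewrite exp1n mul1n.
rewrite -(big_mkord predT (fun a => 'C(k, a) * x ^ a)%N).
have [Tk|kT] := leqP T k.+1; first by rewrite [leqRHS](big_cat_nat (leq0n _) Tk)/= leq_addr.
rewrite (big_cat_nat (leq0n _) (ltnW kT))/= [X in (_ + X)%N]big1_seq ?addn0//.
by move=> i /=; rewrite mem_index_iota => /andP[ki _]; rewrite bin_small.
Qed.

Variables (I : finType) (T : nat).

Definition bin_coef (a k : nat) : R := (-1) ^+ (k + a) * 'C(k, a)%:R.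
(* By binomial inversion the untruncated sum is the indicator of [n = a]. *)
Definition bin_indic (a n : nat) : R := \sum_(k < T) bin_coef a k * 'C(n, k)%:R.
Definition bin_moment (u : I -> nat) (n : I -> nat) : R := \prod_i 'C(n i, u i)%:R.

(** The expansion of [g] over indicators of its arguments, each replaced by its truncated inversion.
    By [bin_truncE] it is a finite linear combination of products of binomial coefficients, whose
    expectations are factorial moments up to factorials. *)
Definition bin_trunc (g : {ffun I -> nat} -> R) (n : I -> nat) : R :=
  \sum_(v : {ffun I -> 'I_T}) g [ffun i => v i : nat] *
    \prod_i bin_indic (v i) (n i).

Definition bin_trunc_coef (g : {ffun I -> nat} -> R) (u : {ffun I -> 'I_T}) : R :=
  \sum_(v : {ffun I -> 'I_T}) g [ffun i => v i : nat] *
    \prod_i bin_coef (v i) (u i).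

Lemma bin_truncE g n : bin_trunc g n =
  \sum_(u : {ffun I -> 'I_T}) bin_trunc_coef g u * bin_moment (fun i => u i) n.
Proof.
rewrite /bin_trunc /bin_trunc_coef.
under [RHS]eq_bigr do rewrite mulr_suml.
rewrite exchange_big; apply: eq_bigr => v _.
rewrite /bin_indic bigA_distr_bigA mulr_sumr; apply: eq_bigr => u _.
by rewrite big_split/= mulrA.
Qed.

(** Summing over [a] first gives [2 ^ k], and then the sum of [C(n, k) 2 ^ k] is at most [3 ^ n]. *)
Lemma bin_indic_sum n : \sum_(a < T) `|bin_indic a n| <= 3%:R ^+ n.
Proof.
apply: (@le_trans _ _ (\sum_(a < T) \sum_(k < T) ('C(k, a) * 'C(n, k))%:R)).
  apply: ler_sum => a _; apply: (le_trans (ler_norm_sum _ _ _)).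
  apply: ler_sum => k _; rewrite /bin_coef !normrM natrM normrX.
  by rewrite normrN1 expr1n mul1r !ger0_norm.
rewrite exchange_big/=.
apply: (@le_trans _ _ (\sum_(k < T) ('C(n, k) * 2 ^ k)%:R)).
  apply: ler_sum => k _; rewrite -natr_sum ler_nat -big_distrl/= mulnC leq_mul2l.
  apply/orP; right; apply: leq_trans (sum_bin_le k 1 T).
  by apply/eq_leq/eq_bigr => a _; rewrite exp1n muln1.
by rewrite -natr_sum -natrX ler_nat; exact: sum_bin_le.
Qed.

(** The truncation is exact if every [n i < T]. Otherwise [T <= t], and the crude bound [2 M 3 ^ t]
    is at most [2 M 2 ^ - T 6 ^ t] because [2 ^ T <= 2 ^ t]. *)
Lemma bin_trunc_error (g : {ffun I -> nat} -> R) (M : R) (n : {ffun I -> nat}) (t : nat) :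
  (forall n, `|g n| <= M) -> (\sum_i n i <= t)%N ->
  `|g n - bin_trunc g n| <= (M *+ 2 / 2 ^+ T) * 6%:R ^+ t.
Proof.
move=> gM nt; have M0 : 0 <= M by apply: le_trans (gM n).
have [nT|] := boolP [forall i, n i < T]%N.
  suff -> : g n = bin_trunc g n.
    by rewrite subrr normr0 mulr_ge0 ?divr_ge0 ?mulrn_wge0 ?exprn_ge0.
  move/forallP in nT.
  rewrite /bin_trunc (bigD1 [ffun i => Ordinal (nT i)])//= [X in _ + X]big1 ?addr0.
    rewrite big1 ?mulr1 => [|i _]; last by rewrite ffunE /bin_indic bin_inversion// eqxx.
    by congr g; apply/ffunP => i; rewrite !ffunE.
  move=> v vn; have [i vi] : exists i, n i != v i.
    apply/existsP; rewrite -negb_forall; apply: contra vn => /forallP vn.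
    by apply/eqP/ffunP => i; apply/val_inj; rewrite ffunE/= (eqP (vn i)).
  rewrite (bigD1 i)//= {1}/bin_indic bin_inversion// (negbTE vi).
  by rewrite mul0r mulr0.
rewrite negb_forall; case/existsP => i; rewrite -leqNgt => Tn.
have Tt : (T <= t)%N.
  by apply: leq_trans nt; rewrite (bigD1 i)//= (leq_trans Tn)// leq_addr.
have n3 : 3%:R ^+ (\sum_i n i) <= 3%:R ^+ t :> R by rewrite ler_weXn2l ?ler1n.
have gT : `|bin_trunc g n| <= M * 3%:R ^+ t.
  apply: (@le_trans _ _ (M * 3%:R ^+ (\sum_i n i))); last by rewrite ler_wpM2l.
  apply: (le_trans (ler_norm_sum _ _ _)).
  apply: (@le_trans _ _ (\sum_(v : {ffun I -> 'I_T}) M * \prod_i `|bin_indic (v i) (n i)|)).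
    apply: ler_sum => v _; rewrite normrM normr_prod ler_wpM2r ?prodr_ge0//.
  rewrite -mulr_sumr ler_wpM2l// -(bigA_distr_bigA (fun i (a : 'I_T) => `|bin_indic a (n i)|)).
  rewrite -prodrXr.
  by apply: ler_prod => j _; rewrite sumr_ge0//= bin_indic_sum.
apply: (@le_trans _ _ (M *+ 2 * 3%:R ^+ t)).
  apply: (le_trans (ler_normB _ _)); rewrite mulr2n mulrDl lerD// (le_trans (gM n))//.
  by rewrite ler_peMr// exprn_ege1// ler1n.
rewrite -mulrA ler_wpM2l ?mulrn_wge0// mulrC ler_pdivlMr ?exprn_gt0//.
have -> : 6%:R ^+ t = 3%:R ^+ t * 2%:R ^+ t :> R by rewrite -exprMn -natrM.
by rewrite ler_wpM2l ?exprn_ge0// ler_weXn2l ?ler1n.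
Qed.

End binomial_expansions.

Lemma Rintegral_sum d (T : measurableType d) (R : realType)
    (mu : {measure set T -> \bar R}) (J : Type) (s : seq J) (F : J -> T -> R) :
  (forall j, mu.-integrable setT (EFin \o F j)) ->
  \int[mu]_w (\sum_(j <- s) F j w) = \sum_(j <- s) \int[mu]_w F j w.
Proof.
move=> iF; elim: s => [|j s IH].
  by under eq_Rintegral do rewrite big_nil; rewrite big_nil Rintegral_cst// mul0r.
under eq_Rintegral do rewrite big_cons; rewrite big_cons -IH RintegralD//.
rewrite (_ : _ \o _ = (fun w => \sum_(j <- s) (F j w)%:E)%E).
  by apply: integrable_sum => // k _; exact: iF.
by apply/funext => w /=; rewrite sumEFin.
Qed.

Lemma measurable_countable d (T : measurableType d) (R : realType)
    (J : countType) (X : T -> J) (g : J -> R) :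
  (forall j, measurable [set w | X w = j]) -> measurable_fun setT (g \o X).
Proof.
move=> mX _ B mB; rewrite setTI.
have -> : (g \o X) @^-1` B = \bigcup_n (if unpickle n is Some j then
    [set w | X w = j /\ B (g j)] else set0).
  apply/seteqP; split => [w Bw|w [n _]].
    by exists (pickle (X w)) => //; rewrite pickleK.
  by case: (unpickle n) => [j /= [<-]|].
apply: bigcup_measurable => n _; case: (unpickle n) => // j.
have [Bj|nBj] := pselect (B (g j)).
  rewrite (_ : mkset _ = [set w | X w = j])//.
  by apply/seteqP; split => w /= => [[]|].
rewrite (_ : mkset _ = set0)//.
by apply/seteqP; split => w //= [].
Qed.

Lemma sum_exp_coeff_le (R : realType) (x : R) n :
  0 <= x -> \sum_(t < n) x ^+ t / t`!%:R <= expR x.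
Proof.
move=> x0; have -> : \sum_(t < n) x ^+ t / t`!%:R = series (exp_coeff x) n.
  by rewrite /series/= big_mkord.
apply: nondecreasing_cvgn_le; last exact: is_cvg_series_exp_coeff.
by apply: nondecreasing_series => k _ _; exact: exp_coeff_ge0.
Qed.

(** * Counts of points, their moments and exponential moments *)

Section counts.
Context d (Om : measurableType d) (R : realType) (P : probability Om R).
Variable Xi : Om -> conf R.
Hypothesis pp : point_process Xi.

Definition count (B : set (plane R)) (w : Om) : nat := Num.truncn (fine (Xi w B)).

Lemma countE (B : set (plane R)) w : measurable B -> bounded_set B ->
  fine (Xi w B) = (count B w)%:R.
Proof.
by move=> mB bB; have [n nE] := conf_nat (Xi w) mB bB; rewrite /count nE/= natrK.
Qed.

Lemma countEE (B : set (plane R)) w : measurable B -> bounded_set B ->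
  Xi w B = (count B w)%:R%:E.
Proof.
move=> mB bB; rewrite -countE// fineK// ge0_fin_numE//.
exact: conf_locally_finite.
Qed.

Lemma measurable_count_eq (B : set (plane R)) n : measurable B -> bounded_set B ->
  measurable [set w | count B w = n].
Proof.
move=> mB bB.
have mf : measurable_fun setT (fun w => fine (Xi w B)).
  by apply: (measurableT_comp (fine_measurable measurableT)) => //; exact: pp.
have := mf measurableT [set n%:R] (measurable_set1 _); rewrite setTI.
rewrite (_ : _ @^-1` _ = [set w | count B w = n])//.
apply/seteqP; split => w /=; rewrite countE//; last by move=> ->.
by move/eqP; rewrite eqr_nat => /eqP.
Qed.

Lemma measurable_count (B : set (plane R)) (phi : nat -> R) :
  measurable B -> bounded_set B -> measurable_fun setT (fun w => phi (count B w)).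
Proof.
move=> mB bB; apply: (@measurable_countable _ _ _ _ (count B) phi) => n.
exact: measurable_count_eq.
Qed.

Section bounded_window.
Variables (W : set (plane R)) (C : R).
Hypotheses (mW : measurable W) (bW : bounded_set W) (C0 : 0 <= C).
Hypothesis momW : forall k : nat,
  ('E_P[fun w => (\prod_(i < k) (fine (Xi w W) - i%:R))%R] <= (C ^+ k)%:E)%E.

Lemma count_moment k :
  (\int[P]_w ('C(count W w, k)%:R : R)%:E <= (C ^+ k / k`!%:R)%:E)%E.
Proof.
have := momW k; rewrite unlock.
rewrite (_ : (fun w => _) =
    fun w => (k`!%:R%:E * ('C(count W w, k)%:R)%:E)%E); last first.
  apply/funext => w; rewrite countE// prod_ffactr -EFinM -natrM mulnC bin_ffact//.
rewrite ge0_integralZl_EFin//; last first.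
  by apply/measurable_EFinP; exact: (@measurable_count W (fun n => 'C(n, k)%:R)).
move=> h; rewrite EFinM lee_pdivlMr ?ltr0n ?fact_gt0//.
by rewrite muleC.
Qed.

(** Expand [6 ^ N = (1 + 5) ^ N] in binomial coefficients of [N] and integrate termwise;
    [count_moment] bounds the result by the exponential series of [5 C]. *)
Lemma count_exp_moment : (\int[P]_w ((6%:R : R) ^+ count W w)%:E <= (expR (5%:R * C))%:E)%E.
Proof.
have m1 t : measurable_fun setT (fun w => (5%:R ^+ t * 'C(count W w, t)%:R : R)%:E).
  apply/measurable_EFinP.
  exact: (@measurable_count W (fun n => 5%:R ^+ t * 'C(n, t)%:R)).
have p1 t w : (0 <= (5%:R ^+ t * 'C(count W w, t)%:R : R)%:E)%E.
  by rewrite lee_fin mulr_ge0// exprn_ge0.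
apply: (@le_trans _ _ (\int[P]_w \sum_(t <oo) (5%:R ^+ t * 'C(count W w, t)%:R)%:E)%E).
  apply: ge0_le_integral => //.
  - by apply/measurable_EFinP; exact: (@measurable_count W (fun n => 6%:R ^+ n)).
  - by apply: ge0_emeasurable_sum => // t _; exact: m1.
  move=> w _; have -> : ((6%:R : R) ^+ count W w)%:E =
      (\sum_(0 <= t < (count W w).+1) (5%:R ^+ t * 'C(count W w, t)%:R)%:E)%E.
    rewrite sumEFin; congr EFin; rewrite -natrX (Pascal 1 5) natr_sum big_mkord.
    by apply: eq_bigr => t _; rewrite exp1n mul1n natrM natrX mulrC.
  by apply: nneseries_lim_ge => t _ _; exact: p1.
rewrite integral_nneseries//; last first.
apply: lime_le.
  apply: is_cvg_ereal_nneg_natsum => t _.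
  by apply: integral_ge0 => w _; exact: p1.
apply: nearW => n.
apply: (@le_trans _ _ (\sum_(0 <= t < n) ((5%:R * C) ^+ t / t`!%:R)%:E)%E).
  apply: lee_sum => t _.
  under eq_integral do rewrite EFinM.
  rewrite ge0_integralZl_EFin ?exprn_ge0//; last first.
    by apply/measurable_EFinP; exact: (@measurable_count W (fun n => 'C(n, t)%:R)).
  rewrite exprMn -mulrA EFinM lee_wpmul2l ?lee_fin ?exprn_ge0//.
  exact: count_moment.
rewrite sumEFin lee_fin big_mkord; apply: sum_exp_coeff_le.
by rewrite mulr_ge0.
Qed.

Lemma integrable_count (phi : Om -> R) c : measurable_fun setT phi ->
  (forall w, `|phi w| <= c * 6%:R ^+ count W w) ->
  P.-integrable setT (EFin \o phi).
Proof.
move=> mphi phic; apply: (@le_integrable _ _ _ _ _ _ _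
    (EFin \o (fun w => c * 6%:R ^+ count W w))) => //.
- by apply/measurable_EFinP.
- by move=> w _ /=; rewrite lee_fin (le_trans (phic w))// ler_norm.
have m6 : measurable_fun setT (fun w => (6%:R : R) ^+ count W w).
  exact: (@measurable_count W (fun n => 6%:R ^+ n)).
apply: (@eq_integrable _ _ _ _ _ measurableT
    (fun w => c%:E * (6%:R ^+ count W w)%:E)%E) => //.
apply: integrableZl => //; apply/integrableP; split; first exact/measurable_EFinP.
apply: le_lt_trans (ltry _); last apply: le_trans count_exp_moment.
rewrite le_eqVlt; apply/orP; left; apply/eqP/eq_integral => w _.
by rewrite /= ger0_norm ?exprn_ge0.
Qed.

Section counts.
Variables (I : finType) (L : I -> set (plane R)).
Hypotheses (mL : forall i, measurable (L i)) (LW : forall i, L i `<=` W).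
Hypothesis tL : trivIset setT L.

Definition counts (w : Om) : {ffun I -> nat} := [ffun i => count (L i) w].

Let bL i : bounded_set (L i).
Proof.
have [M [_ HM]] := bW; apply: (@bounded_norm_le _ (M + 1)) => y /LW Wy.
by apply: (HM (M + 1)) => //; rewrite ltrDl.
Qed.

(** Each atom in [W] belongs to at most one of the disjoint sets [L i]. *)
Lemma sum_counts_le w : (\sum_i counts w i <= count W w)%N.
Proof.
have [s [sW sE]] := conf_points (Xi w) mW bW.
have cE B : measurable B -> B `<=` W -> bounded_set B ->
    (count B w)%:R = \sum_(y <- s) \1_B y :> R.
  by move=> mB BW bB; rewrite -countE// -{1}(setIidl BW) sE.
rewrite -(ler_nat R) natr_sum cE//.
under eq_bigr do rewrite ffunE cE//.
rewrite exchange_big/=; apply: ler_sum => y _.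
have [[i Liy]|nL] := pselect (exists i, L i y); last first.
  by rewrite big1// => i _; rewrite indicE memNset// => Liy; apply: nL; exists i.
rewrite (bigD1 i)//= big1 => [|k ki]; last first.
  rewrite indicE memNset// => Lky; move/eqP : ki; apply.
  by apply: tL => //; exists y.
by rewrite addr0 !indicE !mem_set//; exact: LW Liy.
Qed.

Lemma measurable_counts (g : {ffun I -> nat} -> R) :
  measurable_fun setT (fun w => g (counts w)).
Proof.
apply: (@measurable_countable _ _ _ _ counts g) => n.
rewrite (_ : mkset _ = \bigcap_(i in [set: I]) [set w | count (L i) w = n i]).
  apply: fin_bigcap_measurable => // i _; exact: measurable_count_eq.
apply/seteqP; split => [w /= <- i _ /=|w /= H]; first by rewrite ffunE.
by apply/ffunP => i; rewrite ffunE H.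
Qed.

Lemma bin_moment_le u w : `|bin_moment R u (counts w)| <= 1 * 6%:R ^+ count W w.
Proof.
rewrite /bin_moment mul1r ger0_norm ?prodr_ge0//.
apply: (@le_trans _ _ (\prod_i 2%:R ^+ counts w i)).
  apply: ler_prod => i _; rewrite ler0n/= -natrX ler_nat.
  apply: leq_trans (sum_bin_le _ 1 (u i).+1).
  by rewrite big_ord_recr/= exp1n muln1 leq_addl.
rewrite prodrXr; apply: (@le_trans _ _ (6%:R ^+ (\sum_i counts w i))).
  by rewrite lerXn2r ?nnegrE// ler_nat.
by rewrite ler_weXn2l ?ler1n// sum_counts_le.
Qed.

(** The error depends on the law only through [C], so one truncation order works for a whole
    sequence of processes and for its limit. *)
Lemma counts_trunc (g : {ffun I -> nat} -> R) M T : (forall n, `|g n| <= M) ->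
  `|\int[P]_w g (counts w) - \sum_(u : {ffun I -> 'I_T}) bin_trunc_coef g u *
      \int[P]_w bin_moment R (fun i => u i) (counts w)| <=
  M *+ 2 / 2 ^+ T * expR (5%:R * C).
Proof.
move=> gM; have M0 : 0 <= M by apply: le_trans (gM [ffun=> 0%N]).
have iu (u : {ffun I -> 'I_T}) : P.-integrable setT
    (EFin \o fun w => bin_moment R (fun i => u i) (counts w)).
  apply: (@integrable_count _ 1) => [|w]; last exact: bin_moment_le.
  exact: measurable_counts (bin_moment R (fun i => u i)).
have ig : P.-integrable setT (EFin \o fun w => g (counts w)).
  apply: (@integrable_count _ M) => [|w]; first exact: measurable_counts.
  by apply: (le_trans (gM _)); rewrite ler_peMr// exprn_ege1// ler1n.
have iZ (u : {ffun I -> 'I_T}) : P.-integrable setT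
    (EFin \o fun w => bin_trunc_coef g u * bin_moment R (fun i => u i) (counts w)).
  have := integrableZl measurableT (bin_trunc_coef g u) (iu u).
  by apply: eq_integrable.
have -> : \sum_(u : {ffun I -> 'I_T}) bin_trunc_coef g u *
      \int[P]_w bin_moment R (fun i => u i) (counts w) =
    \int[P]_w bin_trunc T g (counts w).
  under [RHS]eq_Rintegral do rewrite bin_truncE.
  by rewrite Rintegral_sum//; apply: eq_bigr => u _; rewrite RintegralZl.
have iT : P.-integrable setT (EFin \o fun w => bin_trunc T g (counts w)).
  rewrite (_ : _ \o _ = (fun w => \sum_(u : {ffun I -> 'I_T})
    (bin_trunc_coef g u * bin_moment R (fun i => u i) (counts w))%:E)%E).
    by apply: integrable_sum => // u _; exact: iZ.
  by apply/funext => w /=; rewrite bin_truncE sumEFin.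
rewrite -RintegralB//.
have iB : P.-integrable setT (EFin \o fun w => g (counts w) - bin_trunc T g (counts w)).
  exact: (integrableB measurableT ig iT).
have i6 : P.-integrable setT (EFin \o fun w => M *+ 2 / 2 ^+ T * 6%:R ^+ count W w).
  apply: (@integrable_count _ (M *+ 2 / 2 ^+ T)) => [|w].
    exact: (@measurable_count W (fun n => M *+ 2 / 2 ^+ T * 6%:R ^+ n)).
  by rewrite ger0_norm// mulr_ge0 ?divr_ge0 ?mulrn_wge0 ?exprn_ge0.
apply: (le_trans (le_normr_Rintegral _ iB)) => //.
apply: (@le_trans _ _ (\int[P]_w (M *+ 2 / 2 ^+ T * 6%:R ^+ count W w))).
  apply: le_Rintegral => //; last first.
    by move=> w _; apply: bin_trunc_error => //; exact: sum_counts_le.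
  exact: integrable_norm iB.
have i6' : P.-integrable setT (EFin \o fun w => 6%:R ^+ count W w : R).
  apply: (@integrable_count _ 1) => [|w].
    exact: (@measurable_count W (fun n => 6%:R ^+ n)).
  by rewrite mul1r ger0_norm// exprn_ge0.
rewrite RintegralZl// ler_wpM2l ?divr_ge0 ?mulrn_wge0 ?exprn_ge0//.
rewrite -lee_fin fineK ?integrable_fin_num//.
exact: count_exp_moment.
Qed.

End counts.

End bounded_window.

End counts.

(** Correlation functions are indexed by words [c] and binomial moments by multiplicities [u]; the
    word repeating each letter as often as [u] prescribes links the two. *)
Lemma moment_word (I : finType) (u : I -> nat) :
  exists n (c : 'I_n -> 'I_#|I|),
    forall j, #|[pred l | c l == j]| = u (enum_val j).
Proof.
pose s := flatten [seq nseq (u (enum_val j)) j | j <- enum 'I_#|I|].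
exists (size s), (tnth (in_tuple s)) => j.
transitivity (\sum_(l < size s | tnth (in_tuple s) l == j) 1)%N.
  by rewrite sum1_card.
rewrite -(big_tnth _ _ s (pred1 j) (fun=> 1%N)) sum1_count.
rewrite count_flatten -map_comp sumnE big_map big_enum (bigD1 j)//=.
rewrite count_nseq/= eqxx mul1n big1 ?addn0// => i ij.
by rewrite count_nseq/= (negbTE ij).
Qed.

Section moments_of_counts.
Context d (Om : measurableType d) (R : realType) (P : probability Om R).
Variable Xi : Om -> conf R.
Hypothesis pp : point_process Xi.
Variables (W : set (plane R)) (C : R).
Hypotheses (mW : measurable W) (bW : bounded_set W) (C0 : 0 <= C).
Hypothesis momW : forall k : nat,
  ('E_P[fun w => (\prod_(i < k) (fine (Xi w W) - i%:R))%R] <= (C ^+ k)%:E)%E.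
Variables (I : finType) (L : I -> set (plane R)).
Hypotheses (mL : forall i, measurable (L i)) (LW : forall i, L i `<=` W).
Hypothesis tL : trivIset setT L.

Lemma moment_countsE (u : I -> nat) n (c : 'I_n -> 'I_#|I|) :
  (forall j, #|[pred l | c l == j]| = u (enum_val j)) ->
  'E_P[fun w => (\prod_(j < #|I|) \prod_(i < #|[pred l | c l == j]|)
    (fine (Xi w (L (enum_val j))) - i%:R))%R]%E =
  ((\prod_i (u i)`!)%:R * \int[P]_w bin_moment R u (counts Xi L w))%:E.
Proof.
move=> cu.
have bL i : bounded_set (L i).
  have [M [_ HM]] := bW; apply: (@bounded_norm_le _ (M + 1)) => y /LW Wy.
  by apply: (HM (M + 1)) => //; rewrite ltrDl.
have ib : P.-integrable setT (EFin \o fun w => bin_moment R u (counts Xi L w)).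
  apply: (integrable_count pp mW bW C0 momW (c := 1)) => [|w].
    exact: (measurable_counts pp bW mL LW (bin_moment R u)).
  exact: bin_moment_le.
rewrite -RintegralZl// /Rintegral fineK; last first.
  apply: integrable_fin_num => //.
  have := integrableZl measurableT (\prod_i (u i)`!)%:R ib.
  by apply: eq_integrable.
rewrite unlock; apply: eq_integral => w _; congr EFin.
rewrite (reindex (fun j : 'I_#|I| => enum_val j))/=; last first.
  by exists enum_rank => i _; rewrite ?enum_valK ?enum_rankK.
rewrite natr_prod /bin_moment (reindex (fun j : 'I_#|I| => enum_val j))/=; last first.
  by exists enum_rank => i _; rewrite ?enum_valK ?enum_rankK.
rewrite -big_split/=; apply: eq_bigr => j _.
by rewrite countE// prod_ffactr cu ffunE mulrC -natrM bin_ffact.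
Qed.

End moments_of_counts.

Section weak_convergence.
Variable R : realType.
Context (d : nat -> measure_display) (Om : forall n, measurableType (d n)).
Context (P : forall n, probability (Om n) R) (Xi : forall n, Om n -> conf R).
Context (d' : measure_display) (Om' : measurableType d').
Context (P' : probability Om' R) (Xi' : Om' -> conf R).
Hypotheses (pp : forall n, point_process (@Xi n)) (pp' : point_process Xi').
Hypothesis mom_bound : forall W : set (plane R), measurable W -> bounded_set W ->
  exists2 C : R, 0 <= C & forall k : nat,
    (forall n, ('E_(P n)[fun w => (\prod_(i < k) (fine (Xi w W) - i%:R))%R]
       <= (C ^+ k)%:E)%E) /\
    ('E_P'[fun w => (\prod_(i < k) (fine (Xi' w W) - i%:R))%R] <= (C ^+ k)%:E)%E.
Hypothesis mom_cvg : forall m (L : 'I_m -> set (plane R)) n (c : 'I_n -> 'I_m),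
  (forall j, measurable (L j) /\ bounded_set (L j)) -> trivIset setT L ->
  'E_(P a)[fun w => (\prod_(j < m) \prod_(i < #|[pred l | c l == j]|)
                          (fine (Xi w (L j)) - i%:R))%R]%E @[a --> \oo] -->
  'E_P'[fun w => (\prod_(j < m) \prod_(i < #|[pred l | c l == j]|)
                          (fine (Xi' w (L j)) - i%:R))%R]%E.

Section counts_cvg.
Variables (I : finType) (L : I -> set (plane R)).
Variables (W : set (plane R)).
Hypotheses (mW : measurable W) (bW : bounded_set W).
Hypotheses (mL : forall i, measurable (L i)) (LW : forall i, L i `<=` W).
Hypothesis tL : trivIset setT L.

(** Three errors of size [e / 3]: truncation for the process, truncation for the limit, and a finite
    combination of convergent binomial moments between them. *)
Lemma counts_cvg (g : {ffun I -> nat} -> R) M : (forall n, `|g n| <= M) ->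
  \int[P a]_w g (counts (@Xi a) L w) @[a --> \oo] --> \int[P']_w g (counts Xi' L w).
Proof.
move=> gM; have M0 : 0 <= M by apply: le_trans (gM [ffun=> 0%N]).
have [C C0 momW] := mom_bound mW bW.
have momW1 n k := (momW k).1 n.
have momW2 k := (momW k).2.
have bL i : bounded_set (L i).
  have [M' [_ HM]] := bW; apply: (@bounded_norm_le _ (M' + 1)) => y /LW Wy.
  by apply: (HM (M' + 1)) => //; rewrite ltrDl.
have bin_cvg (u : I -> nat) :
    \int[P a]_w bin_moment R u (counts (@Xi a) L w) @[a --> \oo] -->
    \int[P']_w bin_moment R u (counts Xi' L w).
  have [n [c cu]] := moment_word u.
  have tL' : trivIset setT (fun j : 'I_#|I| => L (enum_val j)).
    by move=> i j _ _ ij; apply/enum_val_inj/tL.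
  have := @mom_cvg _ _ _ c (fun j => conj (mL (enum_val j)) (bL (enum_val j))) tL'.
  rewrite (moment_countsE pp' mW bW C0 momW2 mL LW tL cu).
  under eq_cvg => a do
    rewrite (moment_countsE (@pp a) mW bW C0 (momW1 a) mL LW tL cu).
  move=> /fine_cvgP[_]; set q := (X in X * _) => h.
  have q0 : q != 0 :> R.
    by rewrite /q natr_prod; apply/prodf_neq0 => i _; rewrite pnatr_eq0 -lt0n fact_gt0.
  have qK x : q^-1 * (q * x) = x by rewrite mulrA mulVf// mul1r.
  have := cvgM (@cvg_cst _ q^-1 _ \oo _) h.
  rewrite qK => /(_ _ _); apply: cvg_trans; apply: near_eq_cvg; apply: nearW => a /=.
  exact: qK.
apply/cvgrPdist_lt => e e0.
(* [T] is fixed before the index [a]; [2 ^ T > T > b] makes the truncation error small. *)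
have [T TP] : exists T, M *+ 2 / 2 ^+ T * expR (5%:R * C) < e / 3%:R.
  pose b := M *+ 2 * expR (5%:R * C) / (e / 3%:R).
  exists (Num.truncn b).+1; rewrite mulrAC ltr_pdivrMr ?exprn_gt0//.
  rewrite [ltRHS]mulrC -ltr_pdivrMr ?divr_gt0// (lt_trans (truncnS_gt b))//.
  by rewrite -natrX ltr_nat ltn_expl.
pose S a := \sum_(u : {ffun I -> 'I_T}) bin_trunc_coef g u *
      \int[P a]_w bin_moment R (fun i => u i) (counts (@Xi a) L w).
pose S' := \sum_(u : {ffun I -> 'I_T}) bin_trunc_coef g u *
      \int[P']_w bin_moment R (fun i => u i) (counts Xi' L w).
have : S a @[a --> \oo] --> S'.
  apply: cvg_big => //; first exact: add_continuous.
  by move=> u _; apply: cvgMr; exact: bin_cvg.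
have e3 : 0 < e / 3%:R by rewrite divr_gt0.
move=> /cvgrPdist_lt/(_ _ e3); apply: filterS => a Sa.
have h1 := counts_trunc (@pp a) mW bW C0 (momW1 a) mL LW tL T gM.
have h2 := counts_trunc pp' mW bW C0 momW2 mL LW tL T gM.
move: h1 h2; rewrite -/(S a) -/S' => h1 h2.
rewrite (_ : _ - _ = (\int[P']_w g (counts Xi' L w) - S') + (S' - S a) -
  (\int[P a]_w g (counts (@Xi a) L w) - S a)); last by ring.
apply: (le_lt_trans (ler_normB _ _)).
have := ler_normD (\int[P']_w g (counts Xi' L w) - S') (S' - S a).
lra.
Qed.

End counts_cvg.

End weak_convergence.

(** * Tightness and the error of the grid approximation *)

Section tightness.
Context d (Om : measurableType d) (R : realType) (P : probability Om R).
Variable Xi : Om -> conf R.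
Hypothesis pp : point_process Xi.
Variables (F : vague_conf R -> R) (M : R).
Hypotheses (cF : continuous F) (FM : forall xi, `|F xi| <= M).

Let ball (k : nat) := [set y : plane R | (`|y| <= k%:R)%R].

Lemma measurable_ball_nat k : measurable (ball k).
Proof.
rewrite (_ : ball k = [set y : plane R | `|y| \in `]-oo, k%:R]]).
  exact: measurable_norm_itv.
by apply/seteqP; split => y /=; rewrite in_itv.
Qed.

Lemma bounded_ball_nat k : bounded_set (ball k).
Proof. exact: (@bounded_norm_le _ k%:R). Qed.

Lemma grid_countsE m w :
  @grid_count R m (Xi w) = counts Xi (@grid_cell R m) w.
Proof. by []. Qed.

Lemma measurable_grid_counts m (g : {ffun grid_idx m -> nat} -> R) :
  measurable_fun setT (fun w => g (counts Xi (@grid_cell R m) w)).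
Proof.
apply: (@measurable_counts _ _ _ _ pp (ball m)).
- exact: bounded_ball_nat.
- exact: measurable_grid_cell.
- by move=> c y; exact: grid_cell_norm.
Qed.

(** [F (Xi w)] is a pointwise limit of functions of finitely many counts: [grid_approx] is applied
    to each [w] separately, with the counts of [w] itself as bounds. *)
Lemma measurable_vague : measurable_fun setT (fun w => F (Xi w)).
Proof.
apply: (@measurable_fun_cvg _ _ _ _
  (fun m w => F (@grid_conf R m (counts Xi (@grid_cell R m) w)))).
  move=> m; exact: (@measurable_grid_counts m (fun n => F (@grid_conf R m n))).
move=> w _; apply/cvgrPdist_lt => e e0.
have [m0 H] := grid_approx (fun k => count Xi (ball k) w) cF e0.
exists m0 => // m /= mm; rewrite distrC -grid_countsE; apply: H => // k.
rewrite (countEE Xi w (measurable_ball_nat k))//.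
exact: bounded_ball_nat.
Qed.

Lemma bounded_integrable (phi : Om -> R) B : measurable_fun setT phi ->
  (forall w, `|phi w| <= B) -> P.-integrable setT (EFin \o phi).
Proof.
move=> mphi phiB; apply: measurable_bounded_integrable => //.
  by rewrite -ge0_fin_numE// fin_num_measure.
exists B; split; first exact: num_real.
by move=> x Bx w _; exact: le_trans (phiB w) (ltW Bx).
Qed.

Lemma expectation_vague : 'E_P[fun w => F (Xi w)]%E = (\int[P]_w F (Xi w))%:E.
Proof.
rewrite unlock /Rintegral fineK//; apply: integrable_fin_num => //.
by apply: (bounded_integrable measurable_vague) => w; exact: FM.
Qed.

Variables (C : nat -> R) (e : R).
Hypothesis e0 : 0 < e.
Hypothesis momC : forall k,
  ('E_P[fun w => (\prod_(i < 1) (fine (Xi w (ball k)) - i%:R))%R] <= (C k)%:E)%E.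

(* Markov: the exceptional event of radius [k] has probability at most
   [e / 2 ^ k.+1], of total mass [e]. *)
Definition tight_bound k : nat := Num.truncn (C k * 2 ^+ k.+1 / e).

Let bad k := [set w | (tight_bound k < count Xi (ball k) w)%N].

Let mbad k : measurable (bad k).
Proof.
have := measurable_count pp (fun n => (tight_bound k < n)%N%:R : R)
  (measurable_ball_nat k) (bounded_ball_nat k).
move=> /(_ measurableT [set 1] (measurable_set1 _)); rewrite setTI.
rewrite (_ : _ @^-1` _ = bad k)//; apply/seteqP; split => w /=; rewrite /bad/=.
  by case: ltnP => // _ /eqP; rewrite eq_sym oner_eq0.
by move=> ->.
Qed.

Let Pbad k : (P (bad k) <= (e / (2 ^ k.+1)%:R)%:E)%E.
Proof.
have mc := measurable_count pp (fun n => n%:R : R)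
  (measurable_ball_nat k) (bounded_ball_nat k).
have h : (((tight_bound k).+1%:R)%:E * P (bad k) <= (C k)%:E)%E.
  apply: le_trans (momC k); rewrite unlock.
  have -> : (((tight_bound k).+1%:R)%:E * P (bad k) =
      \int[P]_w ((tight_bound k).+1%:R * \1_(bad k) w)%:E)%E.
    under [RHS]eq_integral do rewrite EFinM.
    rewrite ge0_integralZl_EFin//; last exact/measurable_EFinP/measurable_indic.
    by rewrite integral_indic// setIT.
  apply: ge0_le_integral => //.
  - by apply/measurable_EFinP/measurable_funM => //; exact: measurable_indic.
  - apply/measurable_EFinP; apply: eq_measurable_fun mc => w _.
    by rewrite big_ord1 subr0 countE//; [exact: measurable_ball_nat|exact: bounded_ball_nat].
  move=> w _; rewrite big_ord1 subr0 countE; last 2 first.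
  - exact: measurable_ball_nat.
  - exact: bounded_ball_nat.
  rewrite lee_fin indicE; have [wb|nb] := pselect (bad k w).
    by rewrite mem_set// mulr1 ler_nat.
  by rewrite memNset// mulr0.
have t0 : (0 : R) < (tight_bound k).+1%:R by rewrite ltr0n.
rewrite muleC -lee_pdivlMr// in h; apply: (le_trans h); rewrite lee_fin.
rewrite ler_pdivrMr// mulrC -ler_pdivrMr ?divr_gt0 ?ltr0n ?expn_gt0//.
by rewrite invf_div mulrA natrX; apply: ltW; exact: truncnS_gt.
Qed.

(** Off the union of the exceptional events the integrands differ by less than [e]; on it, an event
    of probability at most [e], they differ by at most [2 M]. *)
Lemma grid_error m : (forall xi : conf R,
    (forall k, (xi (ball k) <= (tight_bound k)%:R%:E)%E) ->
    `|F (@grid_conf R m (@grid_count R m xi)) - F xi| < e) ->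
  `|\int[P]_w F (@grid_conf R m (counts Xi (@grid_cell R m) w)) -
    \int[P]_w F (Xi w)| <= e + M *+ 2 * e.
Proof.
move=> He; have M0 : 0 <= M by apply: le_trans (FM (Xi point)).
set G := fun w => F (@grid_conf R m (counts Xi (@grid_cell R m) w)).
have mG : measurable_fun setT G.
  exact: (@measurable_grid_counts m (fun n => F (@grid_conf R m n))).
have iG : P.-integrable setT (EFin \o G).
  by apply: (bounded_integrable mG) => w; exact: FM.
have iF : P.-integrable setT (EFin \o fun w => F (Xi w)).
  by apply: (bounded_integrable measurable_vague) => w; exact: FM.
rewrite -RintegralB//.
have iB : P.-integrable setT (EFin \o fun w => G w - F (Xi w)).
  exact: (integrableB measurableT iG iF).
apply: (le_trans (le_normr_Rintegral _ iB)) => //.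
pose Bad := \bigcup_k bad k.
have mBad : measurable Bad by exact: bigcupT_measurable.
have PBad : fine (P Bad) <= e.
  rewrite -lee_fin fineK ?fin_num_measure//.
  apply: (@le_trans _ _ (\sum_(k <oo) P (bad k))%E).
    exact: measure_sigma_subadditive.
  apply: le_trans (epsilon_trick0 xpredT (ltW e0)).
  by apply: lee_nneseries => // k _; exact: Pbad.
apply: (@le_trans _ _ (\int[P]_w (e + M *+ 2 * \1_Bad w))).
  apply: le_Rintegral => //.
  - exact: integrable_norm iB.
  - apply: (@bounded_integrable _ (e + M *+ 2)) => [|w].
      by apply: measurable_funD => //; apply: measurable_funM => //; exact: measurable_indic.
    rewrite indicE; case: (w \in Bad); rewrite ?mulr1 ?mulr0 ?addr0 ger0_norm//.
    + by rewrite addr_ge0 ?mulrn_wge0// ltW.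
    + by rewrite lerDl mulrn_wge0.
    + exact: ltW.
  move=> w _; rewrite indicE; have [wb|nb] := pselect (Bad w).
    rewrite mem_set// mulr1; apply: (le_trans (ler_normB _ _)).
    have g1 : `|G w| <= M by exact: FM.
    have g2 := FM (Xi w);
    by apply: (le_trans (lerD g1 g2)); rewrite -mulr2n lerDr ltW.
  rewrite memNset// mulr0 addr0; apply/ltW/He => k.
  rewrite (countEE Xi w (measurable_ball_nat k)); last exact: bounded_ball_nat.
  rewrite lee_fin ler_nat leqNgt; apply/negP => kb.
  by apply: nb; exists k.
have i1 : P.-integrable setT (EFin \o fun w => \1_Bad w : R).
  apply: (@bounded_integrable _ 1) => [|w]; first exact: measurable_indic.
  by rewrite indicE; case: (w \in Bad); rewrite ?normr1 ?normr0.
rewrite RintegralD//; last 2 first.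
- by apply: (@bounded_integrable (cst e) e) => // w; rewrite ger0_norm// ltW.
- have := integrableZl measurableT (M *+ 2) i1.
  by apply: eq_integrable.
have -> : \int[P]_(_ in setT) e = e.
  transitivity (e * fine (P setT)); first exact: Rintegral_cst.
  by rewrite probability_setT mulr1.
rewrite RintegralZl// lerD2l ler_wpM2l ?mulrn_wge0//.
by rewrite /Rintegral integral_indic// setIT.
Qed.

End tightness.

Theorem weak_cvg_of_moments (R : realType)
    (d : nat -> measure_display) (Om : forall n, measurableType (d n))
    (P : forall n, probability (Om n) R) (Xi : forall n, Om n -> conf R)
    (d' : measure_display) (Om' : measurableType d')
    (P' : probability Om' R) (Xi' : Om' -> conf R)
    (F : vague_conf R -> R) (M : R) :
  (forall n, point_process (@Xi n)) -> point_process Xi' ->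
  (forall W : set (plane R), measurable W -> bounded_set W ->
    exists2 C : R, 0 <= C & forall k : nat,
      (forall n, ('E_(P n)[fun w => (\prod_(i < k) (fine (Xi n w W) - i%:R))%R]
         <= (C ^+ k)%:E)%E) /\
      ('E_P'[fun w => (\prod_(i < k) (fine (Xi' w W) - i%:R))%R] <= (C ^+ k)%:E)%E) ->
  (forall m (L : 'I_m -> set (plane R)) n (c : 'I_n -> 'I_m),
    (forall j, measurable (L j) /\ bounded_set (L j)) -> trivIset setT L ->
    'E_(P a)[fun w => (\prod_(j < m) \prod_(i < #|[pred l | c l == j]|)
                            (fine (Xi a w (L j)) - i%:R))%R]%E @[a --> \oo] -->
    'E_P'[fun w => (\prod_(j < m) \prod_(i < #|[pred l | c l == j]|)
                            (fine (Xi' w (L j)) - i%:R))%R]%E) ->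
  continuous F -> (forall xi, `|F xi| <= M) ->
  'E_(P a)[fun w => F (Xi a w)]%E @[a --> \oo] --> 'E_P'[fun w => F (Xi' w)]%E.
Proof.
move=> pp pp' mom_bound mom_cvg cF FM.
have M0 : 0 <= M by apply: le_trans (FM (Xi' point)).
rewrite (expectation_vague P' pp' cF FM).
under eq_cvg => a do rewrite (expectation_vague (P a) (@pp a) cF FM).
apply: cvg_EFin; first exact: nearW.
apply/cvgrPdist_le => e e0.
(* Chosen so that the bound of [grid_error] at [b] equals [e / 4]; it occurs twice, and the counts
   contribute a third [e / 4]. *)
pose b := e / (4%:R * (1 + M *+ 2)).
have M1 : 0 < 1 + M *+ 2 by rewrite ltr_wpDr ?mulrn_wge0.
have b0 : 0 < b by rewrite divr_gt0 ?mulr_gt0.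
have bE : b + M *+ 2 * b = e / 4%:R.
  rewrite -[X in X + _]mul1r -mulrDl mulrC /b invfM mulrA.
  by rewrite divfK// lt0r_neq0.
(* The first-moment bounds are common to all the processes, so [tight_bound], and with it the grid
   [m0], does not depend on the process. *)
have /choice[C CP] : forall k, exists C : R,
    (forall n, ('E_(P n)[fun w => (\prod_(i < 1)
        (fine (Xi n w [set y : plane R | (`|y| <= k%:R)%R]) - i%:R))%R] <= C%:E)%E) /\
    ('E_P'[fun w => (\prod_(i < 1)
        (fine (Xi' w [set y : plane R | (`|y| <= k%:R)%R]) - i%:R))%R] <= C%:E)%E.
  move=> k; have [C _ /(_ 1%N)] := mom_bound _ (@measurable_ball_nat R k)
    (@bounded_ball_nat R k).
  by rewrite expr1 => h; exists C.
have [m0 Hm] := grid_approx (tight_bound C b) cF b0.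
have {}Hm := fun xi => Hm m0 xi (leqnn m0).
have E1 a := grid_error (@pp a) cF FM b0
  (fun k => (CP k).1 a) Hm.
have E2 := grid_error pp' cF FM b0 (fun k => (CP k).2) Hm.
have := counts_cvg pp pp' mom_bound mom_cvg (@measurable_ball_nat R m0)
  (@bounded_ball_nat R m0) (@measurable_grid_cell R m0) (@grid_cell_norm R m0)
  (@trivIset_grid_cell R m0) (fun n => FM (@grid_conf R m0 n)).
have e4 : 0 < e / 4%:R by rewrite divr_gt0.
move=> /cvgrPdist_lt/(_ _ e4); apply: filterS => a.
move: (E1 a) E2; rewrite bE.
set x := \int[P a]_w F (Xi a w); set x' := \int[P']_w F (Xi' w).
set y := \int[P a]_w _; set y' := \int[P']_w _ => h1 h2 h3.
rewrite (_ : x' - x = (y - x) - (y' - x') + (y' - y)); last by ring.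
apply: (le_trans (ler_normD _ _)).
have := ler_normB (y - x) (y' - x').
lra.
Qed.

(** * Correlation functions as densities *)

Section integral_density.
Local Open Scope ereal_scope.
Context d (T : measurableType d) (R : realType).
Variables (mu m : {measure set T -> \bar R}) (f : T -> R).
Hypotheses (f0 : forall x, (0 <= f x)%R) (mf : measurable_fun setT f).
Hypothesis mE : forall A, measurable A -> m A = \int[mu]_(x in A) (f x)%:E.

Import HBNNSimple.

Let mfE : measurable_fun setT (EFin \o f).
Proof. exact/measurable_EFinP. Qed.

Let density_nnsfun (h : {nnsfun T >-> R}) :
  \int[m]_x (h x)%:E = \int[mu]_x ((h x)%:E * (f x)%:E).
Proof.
rewrite integralT_nnsfun sintegralE.
under [RHS]eq_integral => x _.
  rewrite (fimfunE h) -fsumEFin// ge0_mule_fsuml; last first.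
    by move=> y; exact: nnfun_muleindic_ge0.
  over.
rewrite ge0_integral_fsum//; last 2 first.
- move=> y; apply: emeasurable_funM => //; apply/measurable_EFinP.
  exact: measurable_funM.
- move=> y x _; apply: mule_ge0; last by rewrite lee_fin.
  by have := nnfun_muleindic_ge0 h y x; rewrite -EFinM.
apply: eq_fsbigr => r; rewrite inE => -[x _ hx].
under [RHS]eq_integral do rewrite EFinM -muleA.
rewrite ge0_integralZl//.
- congr (_ * _); rewrite mE// integral_mkcond; apply: eq_integral => y _.
  by rewrite patchE indicE; case: ifPn => yh; rewrite ?mul1e ?mul0e.
- apply: emeasurable_funM => //; exact/measurable_EFinP.
- by move=> y _; rewrite mule_ge0 ?lee_fin.
- by rewrite lee_fin -hx.
Qed.

Lemma integral_density (g : T -> \bar R) : (forall x, 0 <= g x) ->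
  measurable_fun setT g -> \int[m]_x g x = \int[mu]_x (g x * (f x)%:E).
Proof.
move=> g0 mg; pose h := nnsfun_approx measurableT mg.
have cg x : EFin (h n x) @[n --> \oo] --> g x by exact: cvg_nnsfun_approx.
have -> : \int[m]_x g x = limn (fun n => \int[m]_x (EFin \o h n) x).
  have gE x : setT x -> g x = limn (fun n => (EFin \o h n) x).
    by move=> _; apply/esym/cvg_lim => //; exact: cg.
  under eq_integral => x /[!inE] /gE -> //.
  apply: monotone_convergence => //.
  - by move=> n; exact/measurable_EFinP.
  - by move=> n x _; rewrite lee_fin.
  - by move=> x _ a b ab; rewrite lee_fin; exact/lefP/nd_nnsfun_approx.
have -> : \int[mu]_x (g x * (f x)%:E) =
    limn (fun n => \int[mu]_x ((EFin \o h n) x * (f x)%:E)).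
  have gE x : setT x -> g x * (f x)%:E = limn (fun n => (EFin \o h n) x * (f x)%:E).
    by move=> _; apply/esym/cvg_lim => //; apply: cvgeZr => //; exact: cg.
  under eq_integral => x /[!inE] /gE -> //.
  apply: monotone_convergence => //.
  - by move=> n; apply: emeasurable_funM => //; exact/measurable_EFinP.
  - by move=> n x _; rewrite mule_ge0 ?lee_fin.
  - move=> x _ a b ab; rewrite lee_wpmul2r ?lee_fin//.
    exact/lefP/nd_nnsfun_approx.
by congr (limn _); apply/funext => n; exact: density_nnsfun.
Qed.

End integral_density.

Section tuple_power_integral.
Local Open Scope ereal_scope.
Context d (T : measurableType d) (R : realType).

Lemma tuple_power_integralS (mu : {sigma_finite_measure set T -> \bar R}) n
    (g : n.+1.-tuple T -> \bar R) : (forall t, 0 <= g t) ->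
  measurable_fun setT g ->
  \int[tuple_power mu n.+1]_t g t =
  \int[mu]_x \int[tuple_power mu n]_t g [tuple of x :: t].
Proof.
move=> g0 mg; have mc := @measurable_tuple_consp d T n.
rewrite (@eq_measure_integral _ _ _ _
  (pushforward (mu \x tuple_power mu n) (@tuple_consp d T n)))//.
rewrite ge0_integral_pushforward//.
rewrite preimage_setT fubini_tonelli1//; first exact: measurableT_comp.
by move=> p /=; exact: g0.
Qed.

Lemma tuple_power_integral0 (mu : {sigma_finite_measure set T -> \bar R})
    (g : 0.-tuple T -> \bar R) : (forall t, 0 <= g t) ->
  \int[tuple_power mu 0]_t g t = g [tuple].
Proof.
move=> g0; rewrite integral_dirac//; first by rewrite diracT mul1e.
rewrite (_ : g = cst (g [tuple])); first exact: measurable_cst.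
by apply/funext => t; rewrite (tuple0 t).
Qed.

Lemma measurable_map_tuple n (phi : T -> T) : measurable_fun setT phi ->
  measurable_fun setT (fun t : n.-tuple T => [tuple of map phi t]).
Proof.
move=> mphi; apply/measurable_fun_tnthP => i.
rewrite (_ : _ \o _ = phi \o (@tnth _ T ^~ i)).
  by apply: measurableT_comp => //; exact: measurable_tnth.
by apply/funext => t /=; rewrite tnth_map.
Qed.

Lemma measurable_prod_tnth n (h : T -> R) : measurable_fun setT h ->
  measurable_fun setT (fun t : n.-tuple T => \prod_(i < n) h (tnth t i))%R.
Proof.
move=> mh; apply: measurable_prod => i _.
by apply: (measurableT_comp mh); exact: measurable_tnth.
Qed.

Lemma measurable_cons_tuple n (x : T) :
  measurable_fun setT (fun t : n.-tuple T => [tuple of x :: t]).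
Proof. by apply: measurable_cons => //; exact: measurable_cst. Qed.

(** A change of variables in one point tensorises: by induction, the inner integral over the
    remaining points is a nonnegative measurable function of the first, to which [H] applies. *)
Lemma tuple_power_transfer (lambda mu : {sigma_finite_measure set T -> \bar R})
    (phi : T -> T) (h : T -> R) :
  measurable_fun setT phi -> measurable_fun setT h -> (forall x, (0 <= h x)%R) ->
  (forall g : T -> \bar R, (forall x, 0 <= g x) -> measurable_fun setT g ->
    \int[lambda]_x g (phi x) = \int[mu]_x (g x * (h x)%:E)) ->
  forall n (g : n.-tuple T -> \bar R), (forall t, 0 <= g t) -> measurable_fun setT g ->
    \int[tuple_power lambda n]_t g [tuple of map phi t] =
    \int[tuple_power mu n]_t (g t * (\prod_(i < n) h (tnth t i))%:E).
Proof.
move=> mphi mh h0 H; elim=> [|n IH] g g0 mg.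
  rewrite !tuple_power_integral0//; last first.
    by move=> t; rewrite big_ord0 mule1.
  by rewrite big_ord0 mule1; congr g; exact/val_inj.
have mgm : measurable_fun setT (fun t : n.+1.-tuple T => g [tuple of map phi t]).
  by apply: (measurableT_comp mg); exact: measurable_map_tuple.
rewrite tuple_power_integralS//.
pose G x := \int[tuple_power lambda n]_t g [tuple of x :: map phi t].
pose G' x := \int[tuple_power mu n]_t (g [tuple of x :: t] * (\prod_(i < n) h (tnth t i))%:E).
have GE x : G x = G' x.
  have := IH (fun t => g [tuple of x :: t]) (fun t => g0 _).
  rewrite /G /G' => <-; last by apply: (measurableT_comp mg); exact: measurable_cons_tuple.
  by apply: eq_integral => t _; congr g; exact/val_inj.
have mprod : measurable_fun setT (fun t : n.-tuple T => (\prod_(i < n) h (tnth t i))%:E).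
  by apply/measurable_EFinP; exact: measurable_prod_tnth.
have mG' : measurable_fun setT G'.
  apply: (@measurable_fun_fubini_tonelli_F _ _ _ _ _ (tuple_power mu n)
    (fun p : T * n.-tuple T => g (tuple_consp p) * (\prod_(i < n) h (tnth p.2 i))%:E)).
    apply: emeasurable_funM.
      by apply: (measurableT_comp mg); exact: measurable_tuple_consp.
    by apply: (measurableT_comp mprod); exact: measurable_snd.
  by move=> p; rewrite mule_ge0// lee_fin prodr_ge0.
have G'0 x : 0 <= G' x.
  by apply: integral_ge0 => t _; rewrite mule_ge0// lee_fin prodr_ge0.
transitivity (\int[lambda]_x G' (phi x)).
  apply: eq_integral => x _; rewrite -GE; apply: eq_integral => t _.
  by congr g; exact/val_inj.
rewrite (H _ G'0 mG') tuple_power_integralS; last 2 first.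
- by move=> t; rewrite mule_ge0// lee_fin prodr_ge0.
- by apply: emeasurable_funM => //; apply/measurable_EFinP; exact: measurable_prod_tnth.
apply: eq_integral => x _; rewrite /G' muleC -ge0_integralZl//; last 3 first.
- by apply: emeasurable_funM => //; apply: (measurableT_comp mg); exact: measurable_cons_tuple.
- by move=> t _; rewrite mule_ge0// lee_fin prodr_ge0.
- by rewrite lee_fin.
apply: eq_integral => t _; rewrite big_ord_recl/= tnth0 EFinM muleCA.
congr (_ * (_ * _%:E)).
by apply: eq_bigr => i _; rewrite tnthS.
Qed.

End tuple_power_integral.

(** * Translation invariance and the recentered cylinder measure *)

Section translation.
Variable R : realType.
Implicit Type c : R.

Definition shift c (x : measurableTypeR R) : measurableTypeR R := x - c.

Lemma measurable_shift c : measurable_fun setT (shift c).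
Proof. exact: measurable_funB. Qed.

HB.instance Definition _ c :=
  isMeasurableFun.Build _ _ _ _ (shift c) (@measurable_shift c).

Lemma lebesgue_measure_shift c A : measurable A ->
  lebesgue_measure A = pushforward (@lebesgue_measure R) (shift c) A.
Proof.
apply: lebesgue_measure_unique => X /= [[a b]] _ <-.
rewrite /pushforward.
have -> : shift c @^-1` `]a, b] = `]a + c, b + c]%classic.
  by apply/seteqP; split => x /=; rewrite !in_itv/= /shift ltrBrDr lerBlDr.
by rewrite !lebesgue_measure_itv/= !lte_fin ltrD2r -!EFinD opprD addrACA subrr addr0.
Qed.

Lemma integral_shift c (g : R -> \bar R) :
  (forall x, (0 <= g x)%E) -> measurable_fun setT g ->
  (\int[lebesgue_measure]_x g (x - c)%R = \int[lebesgue_measure]_x g x)%E.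
Proof.
move=> g0 mg; rewrite [RHS](@eq_measure_integral _ _ _ _
  (pushforward lebesgue_measure (shift c))); last first.
  by move=> A mA _; exact: lebesgue_measure_shift.
by rewrite ge0_integral_pushforward.
Qed.

End translation.

Lemma indic_setb (R : realType) (T : Type) (b : T -> bool) (x : T) :
  \1_[set y | b y] x = (b x)%:R :> R.
Proof.
rewrite indicE (_ : (x \in _) = b x)//.
by apply/idP/idP => [/set_mem|bx]//; exact/mem_set.
Qed.

Section cylinder_transfer.
Variable R : realType.
Implicit Types (alpha : R) (g : plane R -> \bar R).

(** Density of the image of [cylinder_measure alpha] under [recenter alpha], as [cylinder_transfer]
    shows. *)
Definition centered_density alpha (x : plane R) : R :=
  (Num.sqrt 2 * pi `^ (3 / 2) * alpha)^-1 * expR (- 2 * x.1 ^+ 2)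
  * \1_[set y : plane R | - (pi * alpha) <= y.2 < pi * alpha] x.

Lemma measurable_slab (a b : R) : measurable [set y : plane R | a <= y.2 < b].
Proof.
have -> : [set y : plane R | a <= y.2 < b] = setT `*` `[a, b[%classic.
  by apply/seteqP; split => -[x y] /=; rewrite in_itv /=; [|case].
by apply: measurableX => //; exact: measurable_itv.
Qed.

Let rho alpha (x1 : R) : R :=
  (Num.sqrt 2 * pi `^ (3 / 2) * alpha)^-1 * expR (- 2 * x1 ^+ 2).

Let rho0 alpha x1 : 0 < alpha -> 0 <= rho alpha x1.
Proof.
by move=> a0; rewrite mulr_ge0 ?expR_ge0// invr_ge0 !mulr_ge0 ?powR_ge0 ?sqrtr_ge0 ?ltW.
Qed.

Let mrho alpha : measurable_fun setT (fun x : plane R => rho alpha x.1).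
Proof.
apply: measurable_funM => //; apply: measurableT_comp => //.
by apply: measurable_funM => //; exact: measurable_funX.
Qed.

Lemma centered_density_ge0 alpha x : 0 < alpha -> 0 <= centered_density alpha x.
Proof. by move=> a0; rewrite mulr_ge0//; exact: rho0. Qed.

Lemma measurable_centered_density alpha :
  measurable_fun setT (centered_density alpha).
Proof.
apply: measurable_funM; first exact: mrho.
by apply: measurable_indic; exact: measurable_slab.
Qed.

Local Open Scope ereal_scope.

Lemma area_integral g : (forall x, 0 <= g x) -> measurable_fun setT g ->
  \int[@area R]_x g x =
  \int[lebesgue_measure]_x1 \int[lebesgue_measure]_x2 g (x1, x2).
Proof.
move=> g0 mg; rewrite (@eq_measure_integral _ _ _ _
  (@lebesgue_measure R \x @lebesgue_measure R)%E)//.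
exact: fubini_tonelli1.
Qed.

(** For fixed [x1] the integrand on the strip is [A x2 + B (x2 - 2 pi alpha)], where [A] lives on
    the lower half of the strip and [B] on the translate of the upper half; translation invariance
    turns it into [A + B], the integrand on the centered strip. *)
Lemma cylinder_transfer alpha g : (0 < alpha)%R -> (forall x, 0 <= g x) ->
  measurable_fun setT g ->
  \int[cylinder_measure alpha]_x g (recenter alpha x) =
  \int[@area R]_x (g x * (centered_density alpha x)%:E).
Proof.
move=> a0 g0 mg.
have mgr : measurable_fun setT (fun x => g (recenter alpha x)).
  by apply: (measurableT_comp mg); exact: measurable_recenter.
have pa0 : (0 < pi * alpha)%R by rewrite mulr_gt0 ?pi_gt0.
rewrite (@integral_density _ _ _ (@area R) _ (cylinder_density alpha))//; last 2 first.
- exact: cylinder_density_ge0.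
- exact: measurable_cylinder_density.
rewrite !area_integral; last 4 first.
- by move=> x; rewrite mule_ge0// lee_fin cylinder_density_ge0.
- apply: emeasurable_funM => //; apply/measurable_EFinP.
  exact: measurable_cylinder_density.
- by move=> x; rewrite mule_ge0// lee_fin centered_density_ge0.
- apply: emeasurable_funM => //; apply/measurable_EFinP.
  exact: measurable_centered_density.
apply: eq_integral => x1 _.
pose k (x2 : R) := g (x1, x2) * (rho alpha x1)%:E.
have k0 x2 : 0 <= k x2 by rewrite mule_ge0// lee_fin rho0.
have mk : measurable_fun setT k.
  apply: emeasurable_funM => //; apply: (measurableT_comp mg).
  by apply: measurable_fun_pair => //; exact: measurable_cst.
have mi (a b : R) : measurable_fun setT (fun x2 : R => (\1_`[a, b[ x2)%:E).
  by apply/measurable_EFinP; apply: measurable_indic; exact: measurable_itv.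
pose A (x2 : R) := k x2 * (\1_`[0%R, (pi * alpha)%R[ x2)%:E.
pose B (x2 : R) := k x2 * (\1_`[(- (pi * alpha))%R, 0%R[ x2)%:E.
have indic0 (a b x2 : R) : 0 <= (\1_`[a, b[ x2 : R)%:E by rewrite lee_fin.
have A0 x2 : 0 <= A x2 by rewrite mule_ge0.
have B0 x2 : 0 <= B x2 by rewrite mule_ge0.
have mA : measurable_fun setT A by exact: emeasurable_funM.
have mB : measurable_fun setT B by exact: emeasurable_funM.
have pt1 (x2 : R) : g (recenter alpha (x1, x2)) * (cylinder_density alpha (x1, x2))%:E =
    A x2 + B (x2 - 2 * pi * alpha)%R.
  rewrite /A /B /k.
  have -> : cylinder_density alpha (x1, x2) =
      (rho alpha x1 * (0 <= x2 < 2 * pi * alpha)%R%:R)%R.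
    by rewrite /cylinder_density /strip indic_setb.
  rewrite /recenter/= !indic_setb !in_itv/=.
  have -> : (2 * pi * alpha = pi * alpha + pi * alpha)%R by rewrite -mulrA mulr_natl mulr2n.
  set p := (pi * alpha)%R in pa0 *; rewrite EFinM.
  case: (boolP (p <= x2)%R) => h1; case: (boolP (0 <= x2 < p + p)%R) => h2;
    case: (boolP (0 <= x2 < p)%R) => h3;
    case: (boolP (- p <= x2 - (p + p) < 0)%R) => h4;
    rewrite /= ?mulr1n ?mulr0n ?mule1 ?mule0 ?adde0 ?add0e//; exfalso;
    clear -h1 h2 h3 h4 pa0; lra.
have pt2 (x2 : R) : A x2 + B x2 = g (x1, x2) * (centered_density alpha (x1, x2))%:E.
  rewrite /A /B /k.
  have -> : centered_density alpha (x1, x2) =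
      (rho alpha x1 * (- (pi * alpha) <= x2 < pi * alpha)%R%:R)%R.
    by rewrite /centered_density indic_setb.
  rewrite !indic_setb !in_itv/= [X in _ = _ * X]EFinM; set p := (pi * alpha)%R in pa0 *.
  case: (boolP (- p <= x2 < 0)%R) => h2; case: (boolP (0 <= x2 < p)%R) => h3;
    case: (boolP (- p <= x2 < p)%R) => h4;
    rewrite /= ?mulr1n ?mulr0n ?mule1 ?mule0 ?adde0 ?add0e//; exfalso; clear -h2 h3 h4 pa0; lra.
transitivity (\int[lebesgue_measure]_x2 (A x2 + B (x2 - 2 * pi * alpha)%R)).
  by apply: eq_integral => x2 _; exact: pt1.
rewrite ge0_integralD//; last first.
  by apply: (measurableT_comp mB); exact: measurable_shift.
rewrite (integral_shift _ B0 mB) -ge0_integralD//.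
by apply: eq_integral => x2 _; exact: pt2.
Qed.

End cylinder_transfer.

Section tuple_box.
Context d (T : measurableType d) (R : realType).
Variable mu : {sigma_finite_measure set T -> \bar R}.
Local Open Scope ereal_scope.

Lemma measurable_tuple_box n (A : 'I_n -> set T) : (forall i, measurable (A i)) ->
  measurable_fun setT (fun t : n.-tuple T => \prod_(i < n) (\1_(A i) (tnth t i) : R))%R.
Proof.
move=> mA; apply: measurable_prod => i _.
apply: (measurableT_comp (measurable_indic (mA i))); exact: measurable_tnth.
Qed.

Lemma tuple_power_box n (A : 'I_n -> set T) : (forall i, measurable (A i)) ->
  \int[tuple_power mu n]_t (\prod_(i < n) (\1_(A i) (tnth t i) : R))%R%:E =
  \prod_(i < n) mu (A i).
Proof.
elim: n A => [|n IH] A mA.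
  rewrite tuple_power_integral0; first by rewrite !big_ord0.
  by move=> t; rewrite big_ord0.
have p0 (k : nat) (B : 'I_k -> set T) t : 0 <= (\prod_(i < k) (\1_(B i) (tnth t i) : R))%R%:E.
  by rewrite lee_fin prodr_ge0.
rewrite tuple_power_integralS//; last first.
  by apply/measurable_EFinP; exact: measurable_tuple_box.
have mA' i : measurable (A (lift ord0 i)) by [].
under eq_integral => x _.
  under eq_integral => t _.
    rewrite big_ord_recl tnth0 EFinM.
    rewrite (eq_bigr (fun i : 'I_n => \1_(A (lift ord0 i)) (tnth t i)))%R; last first.
      by move=> i _; rewrite tnthS.
    over.
  rewrite ge0_integralZl_EFin//; last 2 first.
  - by move=> t _; exact: p0.
  - by apply/measurable_EFinP; exact: measurable_tuple_box.
  rewrite IH//.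
  over.
rewrite ge0_integralZr//; last first.
- by apply: prode_ge0.
- by apply/measurable_EFinP; exact: measurable_indic.
by rewrite integral_indic// setIT big_ord_recl.
Qed.

End tuple_box.

(** * From convergence of densities to weak convergence *)

Section density_convergence.
Variable R : realType.

Definition box_indic m n (L : 'I_m -> set (plane R)) (c : 'I_n -> 'I_m)
    (t : n.-tuple (plane R)) : R :=
  \prod_(l < n) \1_(L (c l)) (tnth t l).

(** The reference measure is [area] for every process, so that densities of processes with different
    background measures can be compared pointwise. *)
Definition has_density d (Om : measurableType d) (P : probability Om R)
    (Xi : Om -> conf R) (f : forall n, n.-tuple (plane R) -> R) :=
  forall m (L : 'I_m -> set (plane R)) n (c : 'I_n -> 'I_m),
    (forall j, measurable (L j) /\ bounded_set (L j)) -> trivIset setT L ->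
  'E_P[fun w => (\prod_(j < m) \prod_(i < #|[pred l | c l == j]|)
                          (fine (Xi w (L j)) - i%:R))%R]%E =
  (\int[tuple_power (@area R) n]_t (box_indic L c t * f n t)%:E)%E.

Lemma area_bounded (W : set (plane R)) : measurable W -> bounded_set W ->
  (@area R W < +oo)%E.
Proof.
move=> mW [M [_ HM]].
have WM y : W y -> `|y| <= M + 1 by move=> Wy; apply: (HM (M + 1)) => //; rewrite ltrDl.
pose B := `[- (M + 1), M + 1]%classic `*` `[- (M + 1), M + 1]%classic : set (plane R).
have mB : measurable B by apply: measurableX; exact: measurable_itv.
apply: (@le_lt_trans _ _ (@area R B)).
  apply: le_measure; rewrite ?inE// => -[a b] /WM.
  by rewrite prod_normE /= ge_max !ler_norml /B/= !in_itv/= => /andP[-> ->].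
rewrite /area product_measure1E//.
have h : (lebesgue_measure (`[(- (M + 1))%R, (M + 1)%R]%classic : set R) < +oo)%E.
  by rewrite lebesgue_measure_itv/=; case: ifPn => // _; rewrite -EFinB ltry.
by apply: lte_mul_pinfty => //; rewrite ge0_fin_numE.
Qed.

Lemma box_integral m n (L : 'I_m -> set (plane R)) (c : 'I_n -> 'I_m) :
  (forall j, measurable (L j) /\ bounded_set (L j)) ->
  (\int[tuple_power (@area R) n]_t (box_indic L c t)%:E =
    (\prod_(l < n) fine (@area R (L (c l))))%:E)%E.
Proof.
move=> mbL; rewrite tuple_power_box => [|i]; last exact: (mbL _).1.
rewrite -prodEFin; apply: eq_bigr => i _; rewrite fineK// ge0_fin_numE//.
by apply: area_bounded; [exact: (mbL _).1|exact: (mbL _).2].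
Qed.

Lemma measurable_box_indic m n (L : 'I_m -> set (plane R)) (c : 'I_n -> 'I_m) :
  (forall j, measurable (L j) /\ bounded_set (L j)) ->
  measurable_fun setT (box_indic L c).
Proof. by move=> mbL; apply: measurable_tuple_box => i; exact: (mbL _).1. Qed.

Lemma box_indic_ge0 m n (L : 'I_m -> set (plane R)) (c : 'I_n -> 'I_m) t :
  0 <= box_indic L c t.
Proof. by apply: prodr_ge0. Qed.

Lemma density_moment_bound d (Om : measurableType d) (P : probability Om R)
    (Xi : Om -> conf R) f (B : R) (W : set (plane R)) (k : nat) :
  has_density P Xi f -> (forall n, measurable_fun setT (f n)) -> 0 <= B ->
  (forall n t, 0 <= f n t <= B ^+ n) -> measurable W -> bounded_set W ->
  ('E_P[fun w => (\prod_(i < k) (fine (Xi w W) - i%:R))%R] <=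
    ((B * fine (@area R W)) ^+ k)%:E)%E.
Proof.
move=> Hf mf B0 fB mW bW.
have mbL (j : 'I_1) : measurable W /\ bounded_set W by [].
have tL : trivIset setT (fun j : 'I_1 => W).
  by move=> i j _ _ _; rewrite (ord1 i) (ord1 j).
have := Hf 1%N (fun=> W) k (fun=> ord0) mbL tL.
rewrite (_ : (fun w => _) = (fun w => (\prod_(i < k) (fine (Xi w W) - i%:R))%R)); last first.
  apply/funext => w; rewrite big_ord1 (_ : #|_| = k)//.
  by rewrite -[RHS]card_ord; apply: eq_card => i; rewrite !inE.
move=> ->; have -> : ((B * fine (@area R W)) ^+ k)%:E =
    (\int[tuple_power (@area R) k]_t
      (B ^+ k * box_indic (fun=> W) (fun _ : 'I_k => @ord0 0) t)%:E)%E.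
  under [RHS]eq_integral do rewrite EFinM.
  rewrite ge0_integralZl_EFin ?exprn_ge0//; last 2 first.
  - by move=> t _; rewrite lee_fin box_indic_ge0.
  - by apply/measurable_EFinP; exact: measurable_box_indic.
  rewrite box_integral//.
  by rewrite big_const_ord iter_mulr_1 exprMn EFinM.
apply: ge0_le_integral => //.
- by move=> t _; rewrite lee_fin mulr_ge0 ?box_indic_ge0//; have /andP[] := fB k t.
- apply/measurable_EFinP; apply: measurable_funM; last exact: mf.
  exact: (@measurable_box_indic _ _ _ (fun=> ord0) mbL).
- apply/measurable_EFinP; apply: measurable_funM => //.
  exact: (@measurable_box_indic _ _ _ (fun=> ord0) mbL).
- move=> t _; rewrite lee_fin mulrC ler_wpM2r ?box_indic_ge0//.
  by have /andP[] := fB k t.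
Qed.

(** The bound [B ^ n] passes to the limit density. It yields the factorial moment bounds with
    [C = B * area W], and [B ^ n] times the indicator of a bounded box dominates the integrals
    giving the mixed moments. *)
Theorem weak_cvg_of_densities
    (d : nat -> measure_display) (Om : forall n, measurableType (d n))
    (P : forall n, probability (Om n) R) (Xi : forall n, Om n -> conf R)
    (d' : measure_display) (Om' : measurableType d')
    (P' : probability Om' R) (Xi' : Om' -> conf R)
    (f : nat -> forall n, n.-tuple (plane R) -> R)
    (f' : forall n, n.-tuple (plane R) -> R) (B : R)
    (F : vague_conf R -> R) (M : R) :
  (forall n, point_process (@Xi n)) -> point_process Xi' ->
  (forall a, has_density (P a) (Xi a) (f a)) -> has_density P' Xi' f' ->
  (forall a n, measurable_fun setT (f a n)) -> (forall n, measurable_fun setT (f' n)) ->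
  0 <= B -> (forall a n t, 0 <= f a n t <= B ^+ n) ->
  (forall n t, f a n t @[a --> \oo] --> f' n t) ->
  continuous F -> (forall xi, `|F xi| <= M) ->
  'E_(P a)[fun w => F (Xi a w)]%E @[a --> \oo] --> 'E_P'[fun w => F (Xi' w)]%E.
Proof.
move=> pp pp' Hf Hf' mf mf' B0 fB ff' cF FM.
have fB' n t : 0 <= f' n t <= B ^+ n.
  have <- : limn (fun a => f a n t) = f' n t by apply: cvg_lim => //; exact: ff'.
  have cf : cvgn (fun a => f a n t) by apply/cvg_ex; eexists; exact: ff'.
  apply/andP; split.
    by apply: limr_ge => //; apply: nearW => a; have /andP[] := fB a n t.
  by apply: limr_le => //; apply: nearW => a; have /andP[] := fB a n t.
apply: weak_cvg_of_moments (FM) => //.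
  move=> W mW bW; exists (B * fine (@area R W)); first by rewrite mulr_ge0// fine_ge0.
  move=> k; split=> [a|].
    exact: (density_moment_bound k (Hf a)).
  exact: (density_moment_bound k Hf').
move=> m L n c mbL tL; rewrite Hf'//.
under eq_cvg => a do rewrite Hf//.
apply: (@dominated_cvg _ _ _ _ _ _ _ _ (fun t => (B ^+ n * box_indic L c t)%:E)) => //.
- move=> a; apply/measurable_EFinP; apply: measurable_funM; last exact: mf.
  exact: measurable_box_indic.
- move=> t _; apply: cvg_EFin; first exact: nearW.
  by apply: cvgMr; exact: ff'.
- apply/integrableP; split.
    by apply/measurable_EFinP; apply: measurable_funM => //; exact: measurable_box_indic.
  under eq_integral => t _.
    rewrite /= ger0_norm ?mulr_ge0 ?exprn_ge0 ?box_indic_ge0// EFinM; over.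
  rewrite ge0_integralZl_EFin ?exprn_ge0//; last 2 first.
  - by move=> t _; rewrite lee_fin box_indic_ge0.
  - by apply/measurable_EFinP; exact: measurable_box_indic.
  by rewrite box_integral// -EFinM ltry.
- move=> a t _; rewrite lee_fin ger0_norm; last first.
    by rewrite mulr_ge0 ?box_indic_ge0//; have /andP[] := fB a n t.
  by rewrite mulrC ler_wpM2r ?box_indic_ge0//; have /andP[] := fB a n t.
Qed.

End density_convergence.

Section dpp_densities.
Variable R : realType.
Local Open Scope complex_scope.

(** An explicit name for the function whose existence [is_dpp] asserts: the determinant equals the
    embedded real [rho], so its real part recovers [rho]. *)
Definition dpp_rho (K : plane R -> plane R -> R[i]) n (t : n.-tuple (plane R)) : R :=
  complex.Re (\det (\matrix_(j, k) K (tnth t j) (tnth t k))).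

Lemma is_dpp_rho d (Om : measurableType d) (P : probability Om R)
    (Xi : Om -> conf R) K (lambda : {sigma_finite_measure set (plane R) -> \bar R}) :
  is_dpp P Xi K lambda -> point_process Xi /\
  forall n, (forall t : n.-tuple (plane R), (dpp_rho K t)%:C =
      \det (\matrix_(j, k) K (tnth t j) (tnth t k))) /\
    correlation_function P Xi lambda (@dpp_rho K n).
Proof.
move=> [[pp _] H]; split => // n; have [rho [rhoE corr]] := H n.
have -> : @dpp_rho K n = rho by apply/funext => t; rewrite /dpp_rho -rhoE.
by split.
Qed.

(** [Xi'] is the image of [Xi] under [phi], so its moments on boxes are those of [Xi] on preimages.
    Invariance of the determinants under [phi] makes the integrand a function of the image points;
    used with [recenter] and with the identity. *)
Lemma dpp_has_density d (Om : measurableType d) (P : probability Om R)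
    (Xi Xi' : Om -> conf R) K (lambda : {sigma_finite_measure set (plane R) -> \bar R})
    (phi : plane R -> plane R) (h : plane R -> R) :
  is_dpp P Xi K lambda -> measurable_fun setT phi -> measurable_fun setT h ->
  (forall x, 0 <= h x) ->
  (forall g : plane R -> \bar R, (forall x, (0 <= g x)%E) -> measurable_fun setT g ->
    (\int[lambda]_x g (phi x) = \int[@area R]_x (g x * (h x)%:E))%E) ->
  (forall B : set (plane R), bounded_set B -> bounded_set (phi @^-1` B)) ->
  (forall w B, measurable B -> Xi' w B = Xi w (phi @^-1` B)) ->
  (forall n (t : n.-tuple (plane R)), dpp_rho K [tuple of map phi t] = dpp_rho K t) ->
  has_density P Xi' (fun n t => dpp_rho K t * \prod_(l < n) h (tnth t l)).
Proof.
move=> /is_dpp_rho[_ dppK] mphi mh h0 H bphi XiE rhophi m L n c mbL tL.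
have [_ [rho0 mrho corr]] := dppK n.
have mphiL j : measurable (phi @^-1` L j).
  by rewrite -[X in measurable X]setTI; apply: mphi => //; exact: (mbL j).1.
have tphiL : trivIset setT (fun j => phi @^-1` L j).
  by move=> i j _ _ [x [/= Lx Ljx]]; apply: tL => //; exists (phi x).
have := corr m (fun j => phi @^-1` L j) c
  (fun j => conj (mphiL j) (bphi _ (mbL j).2)) tphiL.
rewrite (_ : (fun w => _) = fun w => (\prod_(j < m) \prod_(i < #|[pred l | c l == j]|)
    (fine (Xi' w (L j)) - i%:R))); last first.
  apply/funext => w; apply: eq_bigr => j _; apply: eq_bigr => i _.
  by rewrite XiE//; exact: (mbL j).1.
move=> ->; rewrite integral_mkcond.
pose g (t : n.-tuple (plane R)) := (box_indic L c t * dpp_rho K t)%:E.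
transitivity (\int[tuple_power lambda n]_t g [tuple of map phi t])%E.
  apply: eq_integral => t _; rewrite /g rhophi patchE /box_indic.
  under eq_bigr do rewrite tnth_map.
  case: ifPn => [/set_mem Lt|nLt].
    by rewrite big1 ?mul1r// => l _; rewrite indicE mem_set//; exact: Lt.
  have [l nl] : exists l, ~ L (c l) (phi (tnth t l)).
    by apply/existsNP => Lt; move/negP : nLt; apply; apply/mem_set.
  by rewrite (bigD1 l)//= indicE memNset// !mul0r.
rewrite (@tuple_power_transfer _ _ _ lambda (@area R) phi h)//.
- by apply: eq_integral => t _; rewrite /g -EFinM mulrA.
- by move=> t; rewrite lee_fin mulr_ge0// box_indic_ge0.
- apply/measurable_EFinP; apply: measurable_funM => //.
  exact: measurable_box_indic.
Qed.

Lemma cylinder_has_density d (Om : measurableType d) (P : probability Om R)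
    (Xi : Om -> conf R) K (alpha : R) :
  0 < alpha -> is_dpp P Xi K (cylinder_measure alpha) ->
  (forall n (t : n.-tuple (plane R)),
    dpp_rho K [tuple of map (recenter alpha) t] = dpp_rho K t) ->
  has_density P (fun w => conf_recenter alpha (Xi w))
    (fun n t => dpp_rho K t * \prod_(l < n) centered_density alpha (tnth t l)).
Proof.
move=> a0 dppK rhoK; apply: (dpp_has_density dppK (phi := recenter alpha)) => //.
- exact: measurable_recenter.
- exact: measurable_centered_density.
- by move=> x; exact: centered_density_ge0.
- by move=> g g0 mg; exact: cylinder_transfer.
- by move=> B; exact: bounded_recenter.
Qed.

Lemma Ginibre_has_density d (Om : measurableType d) (P : probability Om R)
    (Xi : Om -> conf R) K :
  is_dpp P Xi K (@Ginibre_measure R) ->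
  has_density P Xi
    (fun n t => dpp_rho K t * \prod_(l < n) Ginibre_density (tnth t l)).
Proof.
move=> dppK; apply: (dpp_has_density dppK (phi := id)) => //.
- exact: measurable_Ginibre_density.
- exact: Ginibre_density_ge0.
- move=> g g0 mg; apply: integral_density => //.
  + exact: Ginibre_density_ge0.
  + exact: measurable_Ginibre_density.
- by move=> n t; congr (dpp_rho K); apply/val_inj; rewrite /= map_id.
Qed.

Lemma conf_recenter_point_process d (Om : measurableType d) (Xi : Om -> conf R) alpha :
  point_process Xi -> point_process (fun w => conf_recenter alpha (Xi w)).
Proof.
move=> pp B mB; apply: pp.
by rewrite -[X in measurable X]setTI; exact: measurable_recenter.
Qed.

(** Reduces the limit over real [alpha] to sequences and gathers what the kernels must satisfy:
    invariance under recentering, a geometric bound and pointwise convergence, all for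
    [alpha >= 1]. *)
Lemma cylinder_dpp_cvg_of_densities (K : R -> plane R -> plane R -> R[i])
    (K' : plane R -> plane R -> R[i]) (B : R) :
  (forall alpha n (t : n.-tuple (plane R)), 1 <= alpha ->
    dpp_rho (K alpha) [tuple of map (recenter alpha) t] = dpp_rho (K alpha) t) ->
  0 <= B ->
  (forall alpha n (t : n.-tuple (plane R)), 1 <= alpha ->
    dpp_rho (K alpha) t * \prod_(l < n) centered_density alpha (tnth t l) <= B ^+ n) ->
  (forall (u : nat -> R) n (t : n.-tuple (plane R)), (forall a, 1 <= u a) ->
    u @ \oo --> +oo ->
    dpp_rho (K (u a)) t * \prod_(l < n) centered_density (u a) (tnth t l) @[a --> \oo]
      --> dpp_rho K' t * \prod_(l < n) Ginibre_density (tnth t l)) ->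
  cylinder_dpp_cvg K (fun alpha => cylinder_measure alpha) K' (@Ginibre_measure R).
Proof.
move=> Krec B0 KB Kcvg d Om P Xi d' Om' P' Xi' dppK dppK' F cF [M FM].
have [pp' corr'] := is_dpp_rho dppK'.
have pp alpha : 0 < alpha -> point_process (fun w => conf_recenter alpha (Xi alpha w)).
  by move=> a0; apply: conf_recenter_point_process; have [] := is_dpp_rho (dppK _ a0).
have seqcvg (u : nat -> R) : (forall a, 1 <= u a) -> u @ \oo --> +oo ->
    'E_(P (u a))[fun w => F (conf_recenter (u a) (Xi (u a) w))]%E @[a --> \oo] -->
    'E_P'[fun w => F (Xi' w)]%E.
  move=> u1 uoo; have u0 a : 0 < u a by rewrite (lt_le_trans _ (u1 a)).
  apply: (@weak_cvg_of_densities R _ _ (fun a => P (u a))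
    (fun a w => conf_recenter (u a) (Xi (u a) w)) _ _ P' Xi'
    (fun a n t => dpp_rho (K (u a)) t * \prod_(l < n) centered_density (u a) (tnth t l))
    (fun n t => dpp_rho K' t * \prod_(l < n) Ginibre_density (tnth t l)) B) => //.
  - by move=> a; exact: pp.
  - move=> a; apply: (cylinder_has_density (u0 a) (dppK _ (u0 a))) => n t.
    exact: Krec.
  - exact: (Ginibre_has_density dppK').
  - move=> a n; have [_ /(_ n)[_ [_ mrho _]]] := is_dpp_rho (dppK _ (u0 a)).
    apply: measurable_funM => //; apply: measurable_prod_tnth.
    exact: measurable_centered_density.
  - move=> n; have [_ [_ mrho _]] := corr' n.
    apply: measurable_funM => //; apply: measurable_prod_tnth.
    exact: measurable_Ginibre_density.
  - move=> a n t; have [_ /(_ n)[_ [rho0 _ _]]] := is_dpp_rho (dppK _ (u0 a)).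
    rewrite KB// andbT mulr_ge0// prodr_ge0// => l _.
    exact: centered_density_ge0.
  - by move=> n t; exact: Kcvg.
have finE : forall alpha, 0 < alpha ->
    'E_(P alpha)[fun w => F (conf_recenter alpha (Xi alpha w))]%E \is a fin_num.
  by move=> alpha a0; rewrite (expectation_vague (P alpha) (pp _ a0) cF FM).
have finE' : 'E_P'[fun w => F (Xi' w)]%E \is a fin_num.
  by rewrite (expectation_vague P' pp' cF FM).
rewrite -(fineK finE'); apply: cvg_EFin.
  by exists 0; split => // alpha a0; exact: finE.
(* Any sequence tending to infinity is eventually at least 1; shifting it by [N] makes this true of
   every term. *)
apply/cvg_pinftyP => u uoo.
have [N _ HN] : \forall a \near \oo, 1 <= u a.
  exact: (cvgryPge u).1.
rewrite -(cvg_shiftn N); apply: fine_cvg; rewrite fineK//.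
apply: (seqcvg (fun a => u (a + N)%N)).
  by move=> a; apply: HN => /=; rewrite leq_addl.
by rewrite (cvg_shiftn N).
Qed.

End dpp_densities.

(** * Theta series as Riemann sums of Gaussian integrals *)

Section gaussian_integrals.
Variable R : realType.
Local Notation mu := (@lebesgue_measure R).

Lemma Rintegral_dominated (f_ : nat -> R -> R) (f G : R -> R) :
  (forall n, measurable_fun setT (f_ n)) -> mu.-integrable setT (EFin \o G) ->
  (forall n x, `|f_ n x| <= G x) -> (forall x, f_ n x @[n --> \oo] --> f x) ->
  mu.-integrable setT (EFin \o f) /\
  \int[mu]_x f_ n x @[n --> \oo] --> \int[mu]_x f x.
Proof.
move=> mf iG fG ff.
have cf x : setT x -> (EFin \o f_ n) x @[n --> \oo] --> (EFin \o f) x.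
  by move=> _; apply: cvg_EFin; [exact: nearW|exact: ff].
have mfE n : measurable_fun setT (EFin \o f_ n) by exact/measurable_EFinP.
have bnd n x : setT x -> (`|(EFin \o f_ n) x| <= (EFin \o G) x)%E.
  by move=> _; rewrite lee_fin.
have intf : mu.-integrable setT (EFin \o f).
  apply: (le_integrable measurableT) iG.
    by apply/measurable_EFinP; apply: (@measurable_fun_cvg _ _ _ _ f_) => // x _; exact: ff.
  move=> x _; rewrite /= lee_fin (le_trans _ (ler_norm _))//.
  have <- : limn (fun n => `|f_ n x|) = `|f x|.
    by apply: cvg_lim => //; apply: cvg_norm; exact: ff.
  apply: limr_le; last by apply: nearW => n; exact: fG.
  by apply/cvg_ex; exists `|f x|; apply: cvg_norm; exact: ff.
split => //; rewrite /Rintegral; apply: fine_cvg; rewrite fineK; last first.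
  exact: integrable_fin_num.
apply: (@dominated_cvg _ _ _ mu _ measurableT (fun n => EFin \o f_ n) _ (EFin \o G)) => //.
Qed.

Lemma normal_fun_pdfE m s : s != 0 ->
  normal_fun m s = (fun x => Num.sqrt (s ^+ 2 * pi *+ 2) * normal_pdf m s x) :> (R -> R).
Proof.
move=> s0; apply/funext => x; rewrite normal_pdfE// /normal_peak mulrA divff ?mul1r//.
by have := normal_peak_gt0 s0; rewrite /normal_peak invr_gt0 => /lt0r_neq0.
Qed.

Lemma integrable_normal_fun m s : s != 0 ->
  mu.-integrable setT (EFin \o (normal_fun m s : R -> R)).
Proof.
move=> s0; rewrite normal_fun_pdfE//.
by have := integrableZl measurableT (Num.sqrt (s ^+ 2 * pi *+ 2)) (integrable_normal_pdf m s);
  apply: eq_integrable.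
Qed.

Lemma Rintegral_normal_fun m s : s != 0 ->
  \int[mu]_x normal_fun m s x = Num.sqrt (s ^+ 2 * pi *+ 2).
Proof.
move=> s0; rewrite normal_fun_pdfE// RintegralZl//; last exact: integrable_normal_pdf.
by rewrite /Rintegral integral_normal_pdf mulr1.
Qed.

(** The fundamental theorem of calculus on [[- n, n]], followed by dominated convergence with
    majorant [|h'|]. *)
Lemma Rintegral_derive_eq0 (h h' : R -> R) :
  (forall x : R, is_derive x (1 : R) (h : R -> R) (h' x)) -> continuous h' ->
  mu.-integrable setT (EFin \o h') ->
  h n%:R @[n --> \oo] --> 0 -> h (- n%:R) @[n --> \oo] --> 0 ->
  \int[mu]_x h' x = 0.
Proof.
move=> dh ch' ih' hn hNn.
have mh' : measurable_fun setT h' by exact: continuous_measurable_fun.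
pose I n := `[- (n%:R : R), n%:R]%classic.
pose f_ n x := h' x * \1_(I n) x.
have mI n : measurable (I n) by exact: measurable_itv.
have [_ c1] : mu.-integrable setT (EFin \o h') /\
    \int[mu]_x f_ n x @[n --> \oo] --> \int[mu]_x h' x.
  apply: (@Rintegral_dominated f_ h' (fun x => `|h' x|)).
  - by move=> n; apply: measurable_funM => //; exact: measurable_indic.
  - exact: integrable_norm ih'.
  - move=> n x; rewrite /f_ normrM indicE; case: (_ \in _).
      by rewrite normr1 mulr1.
    by rewrite normr0 mulr0.
  - move=> x; apply: cvg_near_cst; near=> n; rewrite /f_ indicE mem_set ?mulr1//.
    rewrite /I/= in_itv/= -ler_norml; near: n; exact: nbhs_infty_ger.
have c2 : \int[mu]_x f_ n x @[n --> \oo] --> 0.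
  rewrite -[X in _ --> X](subrr (0 : R)).
  apply: cvg_trans (cvgB hn hNn); apply: near_eq_cvg; near=> n.
  have n_gt0 : 0 < n%:R :> R by near: n; exact: nbhs_infty_gtr.
  have n0 : - n%:R < n%:R :> R by rewrite gtrN.
  have ftc : (\int[mu]_(x in I n) (h' x)%:E = (h n%:R)%:E - (h (- n%:R))%:E)%E.
    apply: continuous_FTC2 => //.
    - exact: continuous_subspaceT.
    - have ch x : {for x, continuous h}.
        by apply: differentiable_continuous; apply/derivable1_diffP; have [] := dh x.
      split.
      + by move=> x _; have [] := dh x.
      + by apply: cvg_at_right_filter; exact: ch.
      + by apply: cvg_at_left_filter; exact: ch.
    - by move=> x _; rewrite derive1E; have [_ ->] := dh x.
  rewrite /Rintegral (_ : (\int[mu]_x (f_ n x)%:E = \int[mu]_(x in I n) (h' x)%:E)%E).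
    by rewrite ftc.
  rewrite [RHS]integral_mkcond; apply: eq_integral => x _.
  by rewrite patchE /f_ indicE; case: (_ \in _); rewrite ?mulr1 ?mulr0.
exact: (cvg_unique _ c1 c2).
Unshelve. all: by end_near. Qed.

Lemma expR_natN_cvg (c : R) : c * expR (- n%:R) @[n --> \oo] --> (0 : R).
Proof.
rewrite -[X in _ --> X](mulr0 c); apply: cvgMr.
apply: (@cvg_comp _ _ _ (fun n : nat => n%:R : R) (fun x => expR (- x)) _ +oo).
  exact: cvgr_idn.
exact: cvgr_expR.
Qed.

Lemma gauss_tail (a : R) : expR (- (n%:R + a) ^+ 2 / 2) @[n --> \oo] --> (0 : R).
Proof.
apply: (@squeeze_cvgr _ _ _ _ (cst 0) (fun n : nat => expR (2^-1 - a) * expR (- n%:R))).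
(* [(n + a - 1) ^ 2 >= 0] gives [(n + a) ^ 2 / 2 >= n + a - 1 / 2], whence the constant. *)
- apply: nearW => n; rewrite expR_ge0/= -expRD ler_expR.
  have := sqr_ge0 (n%:R + a - 1); nra.
- exact: cvg_cst.
- exact: expR_natN_cvg.
Qed.

Section phase.
Variables (a phi : R).

(** The free phase [phi] lets one cosine integrand serve both the real and the imaginary part of
    [gaussC]. *)
Definition gauss_phase (b u : R) : R :=
  expR (- (u + a) ^+ 2 / 2) * cos ((u + a) * b + phi).

Let dphase (b u : R) : R :=
  expR (- (u + a) ^+ 2 / 2) * (- (u + a) * sin ((u + a) * b + phi)).

Let gaussE u : expR (- (u + a) ^+ 2 / 2) = normal_fun (- a) 1 u.
Proof. by rewrite /normal_fun expr1n opprK. Qed.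

Let mgauss : measurable_fun setT (fun u : R => expR (- (u + a) ^+ 2 / 2)).
Proof. by under eq_fun do rewrite gaussE; exact: measurable_normal_fun. Qed.

Let marg b : measurable_fun setT (fun u : R => (u + a) * b + phi).
Proof.
by apply: measurable_funD => //; apply: measurable_funM => //; exact: measurable_funD.
Qed.

Lemma integrable_gauss_phase b : mu.-integrable setT (EFin \o gauss_phase b).
Proof.
apply: (le_integrable measurableT _ _ (integrable_normal_fun (- a) (oner_neq0 R))).
  apply/measurable_EFinP/measurable_funM => //.
  by apply: (measurableT_comp (continuous_measurable_fun (@continuous_cos R))) => //; exact: marg.
move=> u _; rewrite /= lee_fin /gauss_phase normrM gaussE ler_piMr//.
by rewrite ler_norml cos_geN1 cos_le1.
Qed.

Let dbound : mu.-integrable setT (EFin \o (normal_fun (- a) (Num.sqrt 2))).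
Proof. by apply: integrable_normal_fun; rewrite sqrtr_eq0 -ltNge. Qed.

Let dphase_le b u : `|dphase b u| <= normal_fun (- a) (Num.sqrt 2) u.
Proof.
rewrite /dphase /normal_fun sqr_sqrtr// opprK !normrM ger0_norm ?expR_ge0//.
set w := u + a.
(* [|w| <= 1 + w ^ 2 / 4 <= exp (w ^ 2 / 4)]: the linear factor costs half of the exponent, so the
   majorant is the Gaussian of variance 2. *)
apply: (@le_trans _ _ (expR (- w ^+ 2 / 2) * (expR (w ^+ 2 / 4) * 1))).
  rewrite ler_wpM2l ?expR_ge0//; apply: ler_pM => //.
    rewrite normrN; apply: le_trans (expR_ge1Dx _).
    have := sqr_ge0 (`|w| / 2 - 1); rewrite sqrrB1 exprMn real_normK ?num_real//; lra.
  by rewrite ler_norml sin_geN1 sin_le1.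
rewrite mulr1 -expRD ler_expR; lra.
Qed.

Let iphase b : mu.-integrable setT (EFin \o dphase b).
Proof.
apply: (le_integrable measurableT _ _ dbound).
  apply/measurable_EFinP/measurable_funM => //; apply: measurable_funM.
    by apply: measurable_funN; exact: measurable_funD.
  by apply: (measurableT_comp (continuous_measurable_fun (@continuous_sin R))) => //; exact: marg.
by move=> u _; rewrite /= lee_fin (le_trans (dphase_le b u))// ler_norm.
Qed.

Let is_derive_phase_b b u :
  is_derive b (1 : R) (gauss_phase ^~ u) (dphase b u).
Proof.
rewrite /gauss_phase /dphase; apply: is_derive_eq.
rewrite /GRing.scale/=; ring.
Qed.

Lemma is_derive_gauss_phase b :
  is_derive b (1 : R) (fun b => \int[mu]_u gauss_phase b u) (\int[mu]_u dphase b u).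
Proof.
have Ib : [set` `]b - 1, b + 1[] b by rewrite /= in_itv/= ltrBlDr ltrDl ltr01.
have h1 (x : R) : [set` `]b - 1, b + 1[] x -> mu.-integrable setT (EFin \o gauss_phase x).
  by move=> _; exact: integrable_gauss_phase.
have h2 (x u : R) : [set` `]b - 1, b + 1[] x -> setT u -> derivable (gauss_phase ^~ u) x 1.
  by move=> _ _; have [] := is_derive_phase_b x u.
have dE x u : partial1of2 gauss_phase x u = dphase x u.
  by rewrite partial1of2E; have [_ ->] := is_derive_phase_b x u.
have h3 (x u : R) : [set` `]b - 1, b + 1[] x -> setT u ->
    `|partial1of2 gauss_phase x u| <= normal_fun (- a) (Num.sqrt 2) u.
  by move=> _ _; rewrite dE; exact: dphase_le.
have G0 u : 0 <= normal_fun (- a) (Num.sqrt 2) u by exact: normal_fun_ge0.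
apply: DeriveDef.
  exact: (derivable_under_integral measurableT Ib h1 h2 G0 dbound h3).
rewrite -derive1E.
rewrite (differentiation_under_integral measurableT Ib h1 h2 G0 dbound h3)//.
by apply: eq_Rintegral => u _; rewrite dE.
Qed.

(** Integration by parts: the sum of [dphase b] and [b * gauss_phase b] is the derivative of the
    same Gaussian times a sine, which vanishes at infinity. *)
Lemma dphaseE b : \int[mu]_u dphase b u = - b * \int[mu]_u gauss_phase b u.
Proof.
pose h u := expR (- (u + a) ^+ 2 / 2) * sin ((u + a) * b + phi).
pose h' u := dphase b u + b * gauss_phase b u.
have dh (u : R) : is_derive u (1 : R) h (h' u).
  rewrite /h /h' /dphase /gauss_phase; apply: is_derive_eq.
  by rewrite /GRing.scale/=; field.
have ib : mu.-integrable setT (EFin \o fun u => b * gauss_phase b u).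
  by have := integrableZl measurableT b (integrable_gauss_phase b); apply: eq_integrable.
have ih' : mu.-integrable setT (EFin \o h').
  exact: (integrableD measurableT (iphase b) ib).
have h0 (v : nat -> R) : expR (- (v n + a) ^+ 2 / 2) @[n --> \oo] --> (0 : R) ->
    h (v n) @[n --> \oo] --> (0 : R).
  move=> v0; apply/norm_cvg0P.
  apply: (@squeeze_cvgr _ _ _ _ (cst 0) (fun n => expR (- (v n + a) ^+ 2 / 2))) => //.
    apply: nearW => n; rewrite normr_ge0/= /h normrM ger0_norm ?expR_ge0//.
    by rewrite ler_piMr ?expR_ge0// ler_norml sin_geN1 sin_le1.
  exact: cvg_cst.
have ch' : continuous h'.
  move=> w; apply: differentiable_continuous; apply/derivable1_diffP.
  by rewrite /h' /dphase /gauss_phase; apply: ex_derive.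
have tail1 : h n%:R @[n --> \oo] --> (0 : R) by apply: h0; exact: gauss_tail.
have tail2 : h (- n%:R) @[n --> \oo] --> (0 : R).
  apply: h0; rewrite (_ : (fun n => _) = (fun n : nat => expR (- (n%:R - a) ^+ 2 / 2))).
    exact: gauss_tail.
  have sq n : (- n%:R + a) ^+ 2 = (n%:R - a) ^+ 2 by rewrite -sqrrN opprD opprK.
  by apply/funext => n; rewrite sq.
have := Rintegral_derive_eq0 dh ch' ih' tail1 tail2.
rewrite (RintegralD measurableT (iphase b) ib).
rewrite RintegralZl//; last exact: integrable_gauss_phase.
by move/eqP; rewrite addr_eq0 mulNr => /eqP.
Qed.

(* As a function of [b] the integral [J] satisfies [J' = - b J]. *)
Lemma Rintegral_gauss_phase b :
  \int[mu]_u gauss_phase b u = Num.sqrt (pi *+ 2) * (expR (- b ^+ 2 / 2) * cos phi).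
Proof.
pose J b := \int[mu]_u gauss_phase b u.
have dJ (c : R) : is_derive c (1 : R) J (- c * J c).
  by rewrite /J -dphaseE; exact: is_derive_gauss_phase.
have J0 : J 0 = Num.sqrt (pi *+ 2) * cos phi.
  rewrite /J /gauss_phase.
  under eq_Rintegral do rewrite mulr0 add0r gaussE.
  rewrite RintegralZr//; last exact: (integrable_normal_fun _ (oner_neq0 R)).
  by rewrite Rintegral_normal_fun// expr1n mul1r.
(* The integrating factor of the equation [J' = - b J]: [M] is constant. *)
pose M b := J b * expR (b ^+ 2 / 2).
have dM (c : R) : is_derive c (1 : R) M 0.
  by rewrite /M; apply: is_derive_eq; rewrite /GRing.scale/=; field.
have Mb : M b = M 0 by exact: is_derive_0_is_cst.
have : M b * expR (- b ^+ 2 / 2) = J b.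
  by rewrite /M -mulrA -expRD -mulrDl subrr mul0r expR0 mulr1.
rewrite -/(J b) => <-; rewrite Mb /M expr0n/= mul0r expR0 mulr1 J0; ring.
Qed.

End phase.

End gaussian_integrals.

(** * The complex exponential and limits of complex sequences *)

Section complex_exponential.
Variable R : realType.
Implicit Types (z w : R[i]) (x : R).
Local Open Scope complex_scope.

Lemma Re_mulc z w :
  complex.Re (z * w) = complex.Re z * complex.Re w - complex.Im z * complex.Im w.
Proof. by case: z w => a b [c d]. Qed.

Lemma Im_mulc z w :
  complex.Im (z * w) = complex.Re z * complex.Im w + complex.Im z * complex.Re w.
Proof. by case: z w => a b [c d]. Qed.

Lemma expCD z w : expC (z + w) = expC z * expC w.
Proof.
case: z => a b; case: w => c d; rewrite /expC /= expRD cosD sinD.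
by apply/eqP; rewrite eq_complex /=; apply/andP; split; apply/eqP; ring.
Qed.

Lemma expC_real x : expC x%:C = (expR x)%:C.
Proof.
rewrite /expC /= cos0 sin0; apply/eqP.
by rewrite eq_complex /= !(mulr0, mulr1, mul0r, subr0, addr0) !eqxx.
Qed.

Lemma expC0 : expC (0 : R[i]) = 1.
Proof. by rewrite (expC_real 0) expR0. Qed.

Lemma expCN z : expC z * expC (- z) = 1.
Proof. by rewrite -expCD subrr expC0. Qed.

Lemma expC_neq0 z : expC z != 0.
Proof. by have /eqP := expCN z; apply: contraTneq => ->; rewrite mul0r eq_sym oner_eq0. Qed.

Lemma expCV z : expC (- z) = (expC z)^-1.
Proof. by apply: (mulfI (expC_neq0 z)); rewrite expCN divff// expC_neq0. Qed.

Lemma expCMn z n : expC (n%:R * z) = expC z ^+ n.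
Proof. by elim: n => [|n IHn]; rewrite ?mul0r ?expC0// -natr1 mulrDl mul1r expCD IHn exprSr. Qed.

Lemma expCMz z (n : int) : expC (n%:~R * z) = expC z ^ n.
Proof.
case: n => n; first exact: expCMn.
by rewrite NegzE rmorphN/= mulNr expCV expCMn.
Qed.

Lemma conjCM z w : Num.conj (z * w) = Num.conj z * Num.conj w.
Proof. exact: rmorphM. Qed.

Lemma conjCD z w : Num.conj (z + w) = Num.conj z + Num.conj w.
Proof. exact: rmorphD. Qed.

Lemma conjCN z : Num.conj (- z) = - Num.conj z.
Proof. exact: rmorphN. Qed.

Lemma conjC_sum (I : Type) (r : seq I) (P : pred I) (F : I -> R[i]) :
  Num.conj (\sum_(i <- r | P i) F i) = \sum_(i <- r | P i) Num.conj (F i).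
Proof. exact: rmorph_sum. Qed.

Lemma conjC_real x : Num.conj (x%:C : R[i]) = x%:C.
Proof. exact: conjc_real. Qed.

Lemma conj_expC z : Num.conj (expC z) = expC (Num.conj z).
Proof.
case: z => a b; rewrite /expC /= cosN sinN.
by apply/eqP; rewrite eq_complex /=; apply/andP; split; apply/eqP; ring.
Qed.

(** Componentwise, as in [zseries], so that real integrals can be used for each part. *)
Definition cvgC (u : nat -> R[i]) (l : R[i]) :=
  complex.Re (u n) @[n --> \oo] --> complex.Re l /\
  complex.Im (u n) @[n --> \oo] --> complex.Im l.

Lemma cvgC_cst l : cvgC (fun=> l) l.
Proof. by split; exact: cvg_cst. Qed.

Let eq_cvgr (f g : nat -> R) (k : R) :
  f =1 g -> g n @[n --> \oo] --> k -> f n @[n --> \oo] --> k.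
Proof. by move=> /funext ->. Qed.

Lemma cvgCD u v k l : cvgC u k -> cvgC v l -> cvgC (fun n => u n + v n) (k + l).
Proof.
case: k l => [a b] [c d] [u1 u2] [v1 v2].
by split; [apply: (eq_cvgr _ (cvgD u1 v1))|apply: (eq_cvgr _ (cvgD u2 v2))] => n;
  case: (u n) => ? ?; case: (v n).
Qed.

Lemma cvgCN u k : cvgC u k -> cvgC (fun n => - u n) (- k).
Proof.
case: k => [a b] [u1 u2].
by split; [apply: (eq_cvgr _ (cvgN u1))|apply: (eq_cvgr _ (cvgN u2))] => n; case: (u n).
Qed.

Lemma cvgCB u v k l : cvgC u k -> cvgC v l -> cvgC (fun n => u n - v n) (k - l).
Proof. by move=> uk vl; apply: cvgCD => //; exact: cvgCN. Qed.

Lemma cvgC_conj u k : cvgC u k -> cvgC (fun n => Num.conj (u n)) (Num.conj k).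
Proof.
case: k => [a b] [u1 u2].
by split; [apply: (eq_cvgr _ u1)|apply: (eq_cvgr _ (cvgN u2))] => n; case: (u n).
Qed.

Lemma cvgCM u v k l : cvgC u k -> cvgC v l -> cvgC (fun n => u n * v n) (k * l).
Proof.
case: k l => [a b] [c d] [u1 u2] [v1 v2].
split.
  apply: (eq_cvgr _ (cvgB (cvgM u1 v1) (cvgM u2 v2))) => n.
  exact: Re_mulc.
apply: (eq_cvgr _ (cvgD (cvgM u1 v2) (cvgM u2 v1))) => n.
exact: Im_mulc.
Qed.

Lemma cvgCZ k u l : cvgC u l -> cvgC (fun n => k * u n) (k * l).
Proof. by apply: cvgCM; exact: cvgC_cst. Qed.

Lemma cvgC_sum (I : Type) (s : seq I) (P : pred I) (u : I -> nat -> R[i]) (l : I -> R[i]) :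
  (forall i, cvgC (u i) (l i)) ->
  cvgC (fun n => \sum_(i <- s | P i) u i n) (\sum_(i <- s | P i) l i).
Proof.
move=> ul; elim: s => [|i s IHs].
  by rewrite big_nil; under eq_fun do rewrite big_nil; exact: cvgC_cst.
rewrite big_cons; under eq_fun do rewrite big_cons.
by case: ifP => // _; exact: cvgCD.
Qed.

Lemma cvgC_prod (I : Type) (s : seq I) (P : pred I) (u : I -> nat -> R[i]) (l : I -> R[i]) :
  (forall i, cvgC (u i) (l i)) ->
  cvgC (fun n => \prod_(i <- s | P i) u i n) (\prod_(i <- s | P i) l i).
Proof.
move=> ul; elim: s => [|i s IHs].
  by rewrite big_nil; under eq_fun do rewrite big_nil; exact: cvgC_cst.
rewrite big_cons; under eq_fun do rewrite big_cons.
by case: ifP => // _; exact: cvgCM.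
Qed.

Lemma cvgC_det n (A : nat -> 'M[R[i]]_n) (B : 'M[R[i]]_n) :
  (forall i j, cvgC (fun a => A a i j) (B i j)) -> cvgC (fun a => \det (A a)) (\det B).
Proof.
move=> AB; rewrite /determinant; apply: cvgC_sum => s; apply: cvgCZ.
by apply: cvgC_prod => i; exact: AB.
Qed.

Lemma cvgC_near u v l : (\forall n \near \oo, u n = v n) -> cvgC v l -> cvgC u l.
Proof.
by move=> uv [v1 v2]; split; [apply: cvg_trans v1|apply: cvg_trans v2];
  apply: near_eq_cvg; apply: filterS uv => n ->.
Qed.

Lemma cvgC_unique u k l : cvgC u k -> cvgC u l -> k = l.
Proof.
case: k l => [a b] [c d] [u1 u2] [v1 v2]; congr (_ +i* _).
  exact: (cvg_unique _ u1 v1).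
exact: (cvg_unique _ u2 v2).
Qed.

Lemma cvgC_ge0 u l : (forall n, 0 <= u n) -> cvgC u l -> 0 <= l.
Proof.
move=> u0 [u1 u2]; rewrite lecE; apply/andP; split.
  have c0 : complex.Im (u n) @[n --> \oo] --> (0 : R).
    by apply: (@eq_cvgr _ (fun=> 0)); [move=> n; exact: ger0_Im|exact: cvg_cst].
  by apply/eqP; exact: (cvg_unique _ u2 c0).
have <- : limn (fun n => complex.Re (u n)) = complex.Re l by exact/cvg_lim.
apply: limr_ge; first by apply/cvg_ex; eexists; exact: u1.
by apply: nearW => n; have := u0 n; rewrite lecE => /andP[].
Qed.

Lemma zseriesP (a : int -> R[i]) l :
  cvgC (fun N => \sum_(k < N.*2.+1) a (k%:Z - N%:Z)) l -> zseries a = l.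
Proof.
by case: l => [x y] [a1 a2]; rewrite /zseries; congr (_ +i* _); exact/cvg_lim.
Qed.

End complex_exponential.

(** * Riemann sums of functions with a Gaussian bound *)

Section riemann_sums.
Variable R : realType.
Local Notation mu := (@lebesgue_measure R).
Variables (g : R -> R) (D m delta : R).
Implicit Types (alpha : R) (z : int).
Hypotheses (cg : continuous g) (gD : forall u, `|g u| <= D * normal_fun m 1 u).
Hypotheses (delta0 : 0 <= delta) (delta1 : delta <= 1).

Definition grid_node alpha (z : int) : R := (z%:~R - delta) / alpha.

Definition riemann_sum alpha N : R :=
  \sum_(k < N.*2.+1) g (grid_node alpha (k%:Z - N%:Z)).

(* [riemann_sum / alpha] is the integral of the truncated step function [g \o node]. *)
Let node alpha u := grid_node alpha (Num.floor (alpha * u)).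

Let cell alpha (z : int) : set R := `[z%:~R / alpha, (z + 1)%:~R / alpha[%classic.

Let cellE alpha z u : 0 < alpha -> \1_(cell alpha z) u = (Num.floor (alpha * u) == z)%:R :> R.
Proof.
move=> a0; rewrite indicE; congr (_%:R); congr nat_of_bool; apply/idP/idP.
  rewrite inE /cell /= in_itv/= ler_pdivrMr// ltr_pdivlMr// (mulrC u) => H.
  by rewrite floor_eq.
move=> /eqP <-; rewrite inE /cell /= in_itv/= ler_pdivrMr// ltr_pdivlMr// (mulrC u).
exact: floor_itv.
Qed.

Let step alpha N u := \sum_(k < N.*2.+1)
  g (grid_node alpha (k%:Z - N%:Z)) * \1_(cell alpha (k%:Z - N%:Z)) u.

Let mu_cell alpha z : 0 < alpha -> mu (cell alpha z) = (alpha^-1)%:E.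
Proof.
move=> a0; have := lebesgue_measure_itv `[z%:~R / alpha : R, (z + 1)%:~R / alpha : R[.
rewrite /= lte_fin ltr_pM2r ?invr_gt0// ltr_int ltrDl ltr01 -EFinD -mulrBl -rmorphB/=.
by rewrite addrAC subrr add0r mul1r.
Qed.

Let icell alpha z : 0 < alpha -> mu.-integrable setT (EFin \o (\1_(cell alpha z) : R -> R)).
Proof.
move=> a0; apply/integrableP; split.
  by apply/measurable_EFinP/measurable_indic; exact: measurable_itv.
under eq_integral do rewrite /= ger0_norm//.
rewrite integral_indic//; last exact: measurable_itv.
by rewrite setIT [ltLHS](mu_cell z a0) ltry.
Qed.

Let Rintegral_cell alpha z : 0 < alpha -> \int[mu]_u (\1_(cell alpha z) u) = alpha^-1.
Proof.
move=> a0; rewrite /Rintegral integral_indic//; last exact: measurable_itv.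
by rewrite setIT [X in fine X](mu_cell z a0).
Qed.

Let Rintegral_step alpha N : 0 < alpha ->
  \int[mu]_u step alpha N u = riemann_sum alpha N / alpha.
Proof.
move=> a0; rewrite Rintegral_sum.
  rewrite /riemann_sum mulr_suml; apply: eq_bigr => k _.
  by rewrite RintegralZl// ?Rintegral_cell//; exact: icell.
move=> k; have := integrableZl measurableT (g (grid_node alpha (k%:Z - N%:Z)))
  (icell (k%:Z - N%:Z) a0).
exact: eq_integrable.
Qed.

Let stepE alpha N u : 0 < alpha ->
  step alpha N u = g (node alpha u) * (`|Num.floor (alpha * u)|%N <= N)%N%:R.
Proof.
move=> a0; rewrite /step /node; set z := Num.floor _.
under eq_bigr do rewrite cellE// -/z.
have [zN|zN] := leqP; last first.
  rewrite mulr0 big1// => k _; rewrite (_ : (z == _) = false) ?mulr0//.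
  by have kN := ltn_ord k; apply: contraTF zN => /eqP ->; rewrite -leqNgt; lia.
have kN : (absz (z + N%:Z)%R < N.*2.+1)%N by lia.
have kE : (absz (z + N%:Z)%R)%:Z - N%:Z = z by lia.
rewrite (bigD1 (Ordinal kN))//= kE eqxx big1 ?addr0// => k kneq.
rewrite (_ : (z == _) = false) ?mulr0//; apply: contraNF kneq => /eqP zE.
by apply/eqP/val_inj => /=; lia.
Qed.

Let node_near alpha u : 1 <= alpha -> `|node alpha u - u| <= 2 / alpha.
Proof.
move=> a1; have a0 : 0 < alpha by rewrite (lt_le_trans _ a1).
have /andP[f1 f2] := floor_itv (alpha * u).
rewrite /node /grid_node -[X in _ - X](mulfK (lt0r_neq0 a0)) -mulrBl normrM.
rewrite (gtr0_norm (_ : 0 < alpha^-1)) ?invr_gt0// ler_pM2r ?invr_gt0//.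
rewrite ler_norml; move: f2; rewrite intrD (mulrC u) => f2.
have d0 := delta0; have d1 := delta1.
by apply/andP; split; lra.
Qed.

(** A majorant independent of [alpha]: with [p] the distance of the node to [m] and [|q| <= 2] the
    displacement, [(p - q) ^ 2 <= 2 p ^ 2 + 8]. Rounding thus costs a factor [exp 2] and doubles the
    variance. *)
Let g_node alpha u : 1 <= alpha ->
  `|g (node alpha u)| <= D * expR 2 * normal_fun m (Num.sqrt 2) u.
Proof.
move=> a1; apply: le_trans (gD _) _.
have D0 : 0 <= D.
  have := le_trans (normr_ge0 _) (gD m).
  by rewrite pmulr_lge0// /normal_fun expR_gt0.
rewrite -mulrA ler_wpM2l// /normal_fun -expRD ler_expR sqr_sqrtr// expr1n.
have : `|node alpha u - u| <= 2.
  apply: le_trans (node_near u a1) _; rewrite ler_pdivrMr ?(lt_le_trans _ a1)//.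
  by rewrite ler_peMr.
set r := node alpha u; rewrite ler_norml => /andP[r1 r2].
have h1 : (r - u) ^+ 2 <= 4 by nra.
have -> : u - m = (r - m) - (r - u) by rewrite opprB [RHS]addrC subrKA.
move: h1; set p := r - m; set q := r - u => h1.
have e4 : 2 *+ 2 = 4 :> R by rewrite -mulrnA.
have -> : (p - q) ^+ 2 = 2 * p ^+ 2 + 2 * q ^+ 2 - (p + q) ^+ 2 by ring.
by rewrite e4; have := sqr_ge0 (p + q); lra.
Qed.

Let ibound : mu.-integrable setT (EFin \o (fun u => D * expR 2 * normal_fun m (Num.sqrt 2) u)).
Proof.
have s0 : Num.sqrt 2 != 0 :> R by rewrite sqrtr_eq0 -ltNge.
by have := integrableZl measurableT (D * expR 2) (integrable_normal_fun m s0); apply: eq_integrable.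
Qed.

Let mstep alpha N : measurable_fun setT (step alpha N).
Proof.
apply: measurable_sum => k; apply: measurable_funM => //; apply: measurable_indic.
exact: measurable_itv.
Qed.

Let inode alpha : 1 <= alpha -> mu.-integrable setT (EFin \o (g \o node alpha)) /\
  riemann_sum alpha N / alpha @[N --> \oo] --> \int[mu]_u g (node alpha u).
Proof.
move=> a1; have a0 : 0 < alpha by rewrite (lt_le_trans _ a1).
under eq_cvg do rewrite -Rintegral_step//.
apply: Rintegral_dominated ibound _ _ => //.
- move=> N u; rewrite stepE//; case: (_ <= _)%N; rewrite ?mulr1 ?mulr0 ?normr0.
    exact: g_node.
  exact: le_trans (normr_ge0 _) (g_node u a1).
- move=> u; apply: cvg_near_cst.
  by exists `|Num.floor (alpha * u)|%N => // N /= HN; rewrite stepE// HN mulr1.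
Qed.

Definition riemann_limit alpha : R := alpha * \int[mu]_u g (node alpha u).

Lemma riemann_sum_cvg alpha : 1 <= alpha ->
  riemann_sum alpha N @[N --> \oo] --> riemann_limit alpha.
Proof.
move=> a1; have a0 : alpha != 0 by rewrite gt_eqF// (lt_le_trans _ a1).
rewrite (_ : riemann_sum alpha = fun N => alpha * (riemann_sum alpha N / alpha)).
  by apply: cvgMr; exact: (inode a1).2.
by apply/funext => N; rewrite mulrC divfK.
Qed.

(** The constant is the integral of the majorant of [g_node]. The linear growth in [alpha] is later
    cancelled by the factor [1 / alpha] of the cylinder density. *)
Lemma riemann_limit_le alpha : 1 <= alpha ->
  `|riemann_limit alpha| <= alpha * (D * expR 2 * Num.sqrt (pi *+ 4)).
Proof.
move=> a1; have a0 : 0 < alpha by rewrite (lt_le_trans _ a1).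
rewrite normrM gtr0_norm// ler_pM2l//.
have [ig _] := inode a1.
apply: le_trans (le_normr_Rintegral measurableT ig) _.
have s0 : Num.sqrt 2 != 0 :> R by rewrite sqrtr_eq0 -ltNge.
apply: (@le_trans _ _ (\int[mu]_u (D * expR 2 * normal_fun m (Num.sqrt 2) u))).
  apply: le_Rintegral => //; first exact: integrable_norm ig.
  by move=> u _; exact: g_node.
rewrite RintegralZl//; last exact: integrable_normal_fun.
by rewrite Rintegral_normal_fun// sqr_sqrtr// mulr_natl -mulrnA.
Qed.

Lemma riemann_limit_cvg (u : nat -> R) : (forall a, 1 <= u a) -> u @ \oo --> +oo ->
  riemann_limit (u a) / u a @[a --> \oo] --> \int[mu]_x g x.
Proof.
move=> u1 uoo.
have u0 a : u a != 0 by rewrite gt_eqF// (lt_le_trans _ (u1 a)).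
rewrite (_ : (fun a => _) = fun a => \int[mu]_x g (node (u a) x)); last first.
  by apply/funext => a; rewrite /riemann_limit mulrC mulKf.
apply: (Rintegral_dominated _ ibound _ _).2.
- move=> a; apply/measurable_EFinP; have [] := inode (u1 a).
  by move=> /measurable_int.
- by move=> a x; exact: g_node.
- move=> x; apply: (@cvg_comp _ _ _ (fun a => node (u a) x) g _ (nbhs x)); last exact: cg.
  apply/cvgrPdist_le => e e0; near=> a.
  rewrite distrC; apply: le_trans (node_near x (u1 a)) _.
  rewrite ler_pdivrMr ?(lt_le_trans _ (u1 a))// mulrC -ler_pdivrMr//.
  by near: a; exact: (cvgryPge u).1.
Unshelve. all: by end_near.
Qed.

End riemann_sums.

(** * Theta series and their Gaussian limits *)

Section theta_limits.
Variable R : realType.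
Implicit Types (s : R[i]) (alpha delta u : R).
Local Notation mu := (@lebesgue_measure R).
Local Open Scope complex_scope.

Definition gaussC s u : R[i] := expC (- (u ^+ 2 / 2)%:C - u%:C * s).

(** Completing the square in [- u ^ 2 / 2 - u a]; the phase is re-expressed in [u + a]
    accordingly. *)
Let gaussC_factor (a b u : R) (phi : R) :
  expR (- (u ^+ 2 / 2) - u * a) * cos (- (u * b) - phi) =
  expR (a ^+ 2 / 2) * gauss_phase a (phi - a * b) b u.
Proof.
rewrite /gauss_phase mulrA -expRD; congr (expR _ * _); first by field.
by rewrite -cosN; congr cos; ring.
Qed.

Lemma Re_gaussC s u : complex.Re (gaussC s u) =
  expR (complex.Re s ^+ 2 / 2) *
    gauss_phase (complex.Re s) (0 - complex.Re s * complex.Im s) (complex.Im s) u.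
Proof.
rewrite -gaussC_factor subr0; case: s => a b.
by rewrite /gaussC /expC /= !(mul0r, subr0, add0r, addr0, oppr0).
Qed.

Lemma Im_gaussC s u : complex.Im (gaussC s u) =
  expR (complex.Re s ^+ 2 / 2) *
    gauss_phase (complex.Re s) (pi / 2 - complex.Re s * complex.Im s) (complex.Im s) u.
Proof.
rewrite -gaussC_factor cosB cos_pihalf sin_pihalf mulr0 add0r mulr1; case: s => a b.
by rewrite /gaussC /expC /= !(mul0r, subr0, add0r, addr0, oppr0).
Qed.

Let gaussC_bound (a phi b u : R) :
  `|expR (a ^+ 2 / 2) * gauss_phase a phi b u| <= expR (a ^+ 2 / 2) * normal_fun (- a) 1 u.
Proof.
rewrite normrM ger0_norm ?expR_ge0// ler_wpM2l ?expR_ge0// /gauss_phase normrM.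
rewrite ger0_norm ?expR_ge0// /normal_fun opprK expr1n ler_piMr ?expR_ge0//.
by rewrite ler_norml cos_geN1 cos_le1.
Qed.

Let gaussC_continuous (a phi b : R) :
  continuous (fun u : R => expR (a ^+ 2 / 2) * gauss_phase a phi b u).
Proof.
move=> u; apply: differentiable_continuous; apply/derivable1_diffP.
by rewrite /gauss_phase; apply: ex_derive.
Qed.

Let gaussC_integral (a phi b : R) :
  \int[mu]_u (expR (a ^+ 2 / 2) * gauss_phase a phi b u) =
  Num.sqrt (pi *+ 2) * (expR ((a ^+ 2 - b ^+ 2) / 2) * cos phi).
Proof.
rewrite RintegralZl//; last exact: integrable_gauss_phase.
rewrite Rintegral_gauss_phase mulrCA; congr (_ * _).
by rewrite mulrA -expRD; congr (expR _ * _); field.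
Qed.

Definition Theta delta alpha s : R[i] :=
  riemann_limit (fun u => complex.Re (gaussC s u)) delta alpha +i*
  riemann_limit (fun u => complex.Im (gaussC s u)) delta alpha.

Let ReE s : (fun u => complex.Re (gaussC s u)) = fun u => expR (complex.Re s ^+ 2 / 2) *
    gauss_phase (complex.Re s) (0 - complex.Re s * complex.Im s) (complex.Im s) u.
Proof. by apply/funext => u; exact: Re_gaussC. Qed.

Let ImE s : (fun u => complex.Im (gaussC s u)) = fun u => expR (complex.Re s ^+ 2 / 2) *
    gauss_phase (complex.Re s) (pi / 2 - complex.Re s * complex.Im s) (complex.Im s) u.
Proof. by apply/funext => u; exact: Im_gaussC. Qed.

Let cRe s : continuous (fun u => complex.Re (gaussC s u)).
Proof. by rewrite ReE; exact: gaussC_continuous. Qed.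

Let cIm s : continuous (fun u => complex.Im (gaussC s u)).
Proof. by rewrite ImE; exact: gaussC_continuous. Qed.

Lemma Re_gaussC_le s u : `|complex.Re (gaussC s u)| <=
  expR (complex.Re s ^+ 2 / 2) * normal_fun (- complex.Re s) 1 u.
Proof. by rewrite Re_gaussC; exact: gaussC_bound. Qed.

Lemma Im_gaussC_le s u : `|complex.Im (gaussC s u)| <=
  expR (complex.Re s ^+ 2 / 2) * normal_fun (- complex.Re s) 1 u.
Proof. by rewrite Im_gaussC; exact: gaussC_bound. Qed.

Let exp_half_sqr s : expC (s ^+ 2 / 2) =
  (expR ((complex.Re s ^+ 2 - complex.Im s ^+ 2) / 2))%:C *
  (cos (complex.Re s * complex.Im s) +i* sin (complex.Re s * complex.Im s)).
Proof.
rewrite /expC; have -> : s ^+ 2 / 2 = ((complex.Re s ^+ 2 - complex.Im s ^+ 2) / 2) +i*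
    (complex.Re s * complex.Im s).
  have -> : 2^-1 = (2^-1)%:C :> R[i] by rewrite fmorphV rmorph_nat.
  case: s => a b /=; rewrite expr2.
  by apply/eqP; rewrite eq_complex /=; apply/andP; split; apply/eqP; field.
by [].
Qed.

Let Re_integral s : \int[mu]_u complex.Re (gaussC s u) =
  complex.Re ((Num.sqrt (pi *+ 2))%:C * expC (s ^+ 2 / 2)).
Proof.
rewrite ReE gaussC_integral sub0r cosN exp_half_sqr Re_mulc /= mul0r subr0.
by rewrite mul0r subr0.
Qed.

Let Im_integral s : \int[mu]_u complex.Im (gaussC s u) =
  complex.Im ((Num.sqrt (pi *+ 2))%:C * expC (s ^+ 2 / 2)).
Proof.
rewrite ImE gaussC_integral cosB cos_pihalf sin_pihalf mul0r add0r mul1r.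
rewrite exp_half_sqr Im_mulc /= mul0r addr0.
by rewrite mul0r addr0.
Qed.

Lemma Re_sum (I : Type) (r : seq I) (F : I -> R[i]) :
  complex.Re (\sum_(i <- r) F i) = \sum_(i <- r) complex.Re (F i).
Proof. by apply: (big_morph (@complex.Re R) _ (erefl _)) => -[a b] [c d]. Qed.

Lemma Im_sum (I : Type) (r : seq I) (F : I -> R[i]) :
  complex.Im (\sum_(i <- r) F i) = \sum_(i <- r) complex.Im (F i).
Proof. by apply: (big_morph (@complex.Im R) _ (erefl _)) => -[a b] [c d]. Qed.

Section fixed_shift.
Variable delta : R.
Hypotheses (delta0 : 0 <= delta) (delta1 : delta <= 1).

Lemma Theta_cvg alpha s : 1 <= alpha ->
  cvgC (fun N => \sum_(k < N.*2.+1) gaussC s (grid_node delta alpha (k%:Z - N%:Z)))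
    (Theta delta alpha s).
Proof.
move=> a1; split.
  rewrite (_ : (fun N => _) =
    riemann_sum (fun u => complex.Re (gaussC s u)) delta alpha).
    exact: (@riemann_sum_cvg _ (fun u => complex.Re (gaussC s u)) _ _ delta
      (Re_gaussC_le s) delta0 delta1 _ a1).
  by apply/funext => N; rewrite Re_sum.
rewrite (_ : (fun N => _) =
  riemann_sum (fun u => complex.Im (gaussC s u)) delta alpha).
  exact: (@riemann_sum_cvg _ (fun u => complex.Im (gaussC s u)) _ _ delta
      (Im_gaussC_le s) delta0 delta1 _ a1).
by apply/funext => N; rewrite Im_sum.
Qed.

Definition Theta_bound : R := expR 2 * Num.sqrt (pi *+ 4).

Lemma Re_Theta_le alpha s : 1 <= alpha ->
  `|complex.Re (Theta delta alpha s)| <=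
  alpha * (expR (complex.Re s ^+ 2 / 2) * Theta_bound).
Proof.
move=> a1; rewrite /Theta_bound [X in alpha * X]mulrA.
exact: (@riemann_limit_le _ (fun u => complex.Re (gaussC s u)) _ _ delta
  (Re_gaussC_le s) delta0 delta1 _ a1).
Qed.

Lemma Theta_scaled_cvg (al : nat -> R) s : (forall a, 1 <= al a) -> al @ \oo --> +oo ->
  cvgC (fun a => ((al a)^-1)%:C * Theta delta (al a) s)
    ((Num.sqrt (pi *+ 2))%:C * expC (s ^+ 2 / 2)).
Proof.
move=> al1 aloo.
split.
  rewrite -Re_integral; rewrite (_ : (fun a => _) = fun a =>
      riemann_limit (fun u => complex.Re (gaussC s u)) delta (al a) / al a).
    exact: (@riemann_limit_cvg _ (fun u => complex.Re (gaussC s u))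
      (expR (complex.Re s ^+ 2 / 2)) (- complex.Re s) delta
      (@cRe s) (Re_gaussC_le s) delta0 delta1 al al1 aloo).
  by apply/funext => a; rewrite Re_mulc/= mul0r subr0 mulrC.
rewrite -Im_integral (_ : (fun a => _) = fun a =>
    riemann_limit (fun u => complex.Im (gaussC s u)) delta (al a) / al a).
  exact: (@riemann_limit_cvg _ (fun u => complex.Im (gaussC s u))
      (expR (complex.Re s ^+ 2 / 2)) (- complex.Re s) delta
      (@cIm s) (Im_gaussC_le s) delta0 delta1 al al1 aloo).
by apply/funext => a; rewrite Im_mulc/= mul0r addr0 mulrC.
Qed.

End fixed_shift.

End theta_limits.

Section theta_functions.
Variable R : realType.
Implicit Types (s : R[i]) (alpha delta u : R).
Local Open Scope complex_scope.

Let theta_term_field (F : numFieldType) (i s p a nu : F) : a != 0 -> p != 0 ->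
  nu ^+ 2 * (i / (2 * p * a ^+ 2) * p * i) + 2 * nu * (i * s / (2 * p * a) * p * i) =
  i ^+ 2 * (nu ^+ 2 / (2 * a ^+ 2) + nu / a * s).
Proof. by move=> a0 p0; field; rewrite a0 p0. Qed.

Let theta_term alpha s nu : alpha != 0 ->
  (nu ^+ 2)%:C * ('i / (2 * pi * alpha ^+ 2)%:C * pi%:C * 'i) +
    (2 * nu)%:C * ('i * s / (2 * pi * alpha)%:C * pi%:C * 'i) =
  - ((nu / alpha) ^+ 2 / 2)%:C - (nu / alpha)%:C * s.
Proof.
move=> a0; have p0 : pi != 0 :> R by rewrite gt_eqF ?pi_gt0.
have e2 : 2%:C = 2 :> R[i] by exact: rmorph_nat.
have a0' : alpha%:C != 0 :> R[i] by rewrite fmorph_eq0.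
have p0' : pi%:C != 0 :> R[i] by rewrite fmorph_eq0.
rewrite !(rmorphM, rmorphXn, fmorphV)/= !e2.
rewrite -!complexiE.
move: a0' p0'; set a := alpha%:C; set p := pi%:C; set nu' := nu%:C => a0' p0'.
have -> : nu' ^+ 2 * ('i%C / (2 * p * a ^+ 2) * p * 'i%C) +
    2 * nu' * ('i%C * s / (2 * p * a) * p * 'i%C) =
    'i%C ^+ 2 * (nu' ^+ 2 / (2 * a ^+ 2) + nu' / a * s).
  exact: theta_term_field.
by rewrite sqr_i mulN1r opprD; congr (- _ - _); field.
Qed.

Lemma theta3_Theta alpha s : 1 <= alpha ->
  theta3 ('i * s / (2 * pi * alpha)%:C) ('i / (2 * pi * alpha ^+ 2)%:C) = Theta 0 alpha s.
Proof.
move=> a1; have a0 : alpha != 0 by rewrite gt_eqF// (lt_le_trans _ a1).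
apply: zseriesP; apply: cvgC_near (Theta_cvg (lexx 0) ler01 s a1); apply: nearW => N.
apply: eq_bigr => k _; set n := k%:Z - N%:Z.
rewrite -!expCMz -expCD /gaussC /grid_node subr0; congr expC.
apply: etrans (theta_term s n%:~R a0).
have -> : (n ^+ 2)%:~R = (n%:~R ^+ 2)%:C :> R[i].
  by rewrite !rmorphXn/= rmorph_int.
have -> : (2 * n)%:~R = (2 * n%:~R)%:C :> R[i].
  by rewrite !rmorphM/= rmorph_int (rmorph_nat (real_complex R)).
by [].
Qed.

Lemma theta2_Theta alpha s : 1 <= alpha ->
  theta2 ('i * s / (2 * pi * alpha)%:C) ('i / (2 * pi * alpha ^+ 2)%:C) = Theta (1 / 2) alpha s.
Proof.
move=> a1; have a0 : alpha != 0 by rewrite gt_eqF// (lt_le_trans _ a1).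
have d0 : 0 <= 1 / 2 :> R by [].
have d1 : 1 / 2 <= 1 :> R by lra.
apply: zseriesP; apply: cvgC_near (Theta_cvg d0 d1 s a1); apply: nearW => N.
apply: eq_bigr => k _; set n := k%:Z - N%:Z.
have e2 : 2%:C = 2 :> R[i] by exact: rmorph_nat.
have halfC : (n%:~R - 1 / 2)%:C = n%:~R - 1 / 2 :> R[i].
  by rewrite rmorphB/= rmorph_int rmorphM/= fmorphV/= e2.
rewrite -!expCMz -expCD /gaussC /grid_node; congr expC.
apply: etrans (theta_term s (n%:~R - 1 / 2) a0).
have -> : (n%:~R - 1 / 2) ^+ 2 = ((n%:~R - 1 / 2) ^+ 2)%:C :> R[i].
  by rewrite rmorphXn/= halfC.
have -> : (2 * n - 1)%:~R = (2 * (n%:~R - 1 / 2))%:C :> R[i].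
  rewrite rmorphM/= halfC e2 intrD intrM mulrBr; congr (_ - _).
  by rewrite mul1r divff// pnatr_eq0.
by rewrite !mulrA.
Qed.

Let normal_fun_le (m u : R) : normal_fun m 1 u <= expR (1 / 2 + `|m|) * expR (- `|u|).
Proof.
rewrite /normal_fun expr1n -expRD ler_expR.
have h1 : `|u| <= `|u - m| + `|m| by rewrite -[X in `|X| <= _](subrK m) ler_normD.
have := sqr_ge0 (`|u - m| - 1); rewrite -(real_normK (num_real (u - m))); nra.
Qed.

(** Makes the boundary terms in [ThetaN] vanish. *)
Lemma gaussC_cvg0 s (u : nat -> R) : `|u n| @[n --> \oo] --> +oo ->
  cvgC (fun n => gaussC s (u n)) 0.
Proof.
move=> uoo.
pose D := expR (complex.Re s ^+ 2 / 2) * expR (1 / 2 + `|- complex.Re s|).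
have D0 : D * expR (- `|u n|) @[n --> \oo] --> (0 : R).
  rewrite -[X in _ --> X](mulr0 D); apply: cvgMr.
  exact: (@cvg_comp _ _ _ (fun n => `|u n|) (fun x => expR (- x)) _ +oo _ uoo (@cvgr_expR R)).
have bnd (h : nat -> R) : (forall n, `|h n| <= D * expR (- `|u n|)) ->
    h n @[n --> \oo] --> (0 : R).
  move=> hD; apply/norm_cvg0P;
  apply: (@squeeze_cvgr _ _ _ _ (cst 0) (fun n => D * expR (- `|u n|))) => //.
    by apply: nearW => n; rewrite normr_ge0 hD.
  exact: cvg_cst.
have bG n : expR (complex.Re s ^+ 2 / 2) * normal_fun (- complex.Re s) 1 (u n) <=
    D * expR (- `|u n|).
  by rewrite /D -mulrA ler_wpM2l ?expR_ge0.
by split; apply: bnd => n; apply: le_trans (bG n); [exact: Re_gaussC_le|exact: Im_gaussC_le].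
Qed.

Let affine_cvg alpha (c : R) : 1 <= alpha -> `|(n%:R + c) / alpha| @[n --> \oo] --> +oo.
Proof.
move=> a1; have a0 : 0 < alpha by rewrite (lt_le_trans _ a1).
apply/cvgryPge => A; near=> n; apply: le_trans (ler_norm _).
rewrite ler_pdivlMr// -lerBlDr; near: n; exact: nbhs_infty_ger.
Unshelve. all: by end_near. Qed.

(** The reflection [n -> e - n] negates the nodes. For [e = 1] it shifts the symmetric range of
    summation by one, so partial sums differ by two boundary terms, which tend to 0. *)
Lemma ThetaN alpha s (e : bool) : 1 <= alpha ->
  Theta (e%:R / 2) alpha (- s) = Theta (e%:R / 2) alpha s.
Proof.
move=> a1; set delta := e%:R / 2.
have d0 : 0 <= delta by rewrite divr_ge0.
have d1 : delta <= 1 by rewrite /delta ler_pdivrMr// mul1r ler_nat; case: (e).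
pose a z := gaussC s (grid_node delta alpha z).
have aN N : \sum_(k < N.*2.+1) gaussC (- s) (grid_node delta alpha (k%:Z - N%:Z)) =
    \sum_(k < N.*2.+1) a (k%:Z - N%:Z + e%:Z).
  rewrite (reindex_inj rev_ord_inj)/=; apply: eq_bigr => k _.
  have -> : (N.*2.+1 - k.+1)%N%:Z - N%:Z = - (k%:Z - N%:Z) by have := ltn_ord k; lia.
  rewrite /a /gaussC; move: (k%:Z - N%:Z) => z.
  have -> : grid_node delta alpha (z + e%:Z) = - grid_node delta alpha (- z).
    have eN : (- z)%:~R = - z%:~R :> R by rewrite rmorphN.
    have eZ : e%:Z%:~R = e%:R :> R by [].
    by rewrite /grid_node -[RHS]mulNr opprB eN opprK intrD eZ /delta; congr (_ / _); field.
  by rewrite sqrrN rmorphN/= mulrN mulNr.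
apply: (cvgC_unique (Theta_cvg d0 d1 (- s) a1)).
have TN := Theta_cvg d0 d1 s a1.
have [eT|/negbTE eF] := boolP e; last first.
  by apply: cvgC_near TN; apply: nearW => N; rewrite aN; apply: eq_bigr => k _; rewrite eF addr0.
have aneg : cvgC (fun N : nat => a (- N%:Z)) 0.
  apply: gaussC_cvg0; rewrite (_ : (fun n => _) = fun n : nat => `|(n%:R + delta) / alpha|).
    exact: affine_cvg.
  apply/funext => N; rewrite -[LHS]normrN /grid_node -mulNr opprB.
  by rewrite (rmorphN _ N%:Z)/= opprK addrC.
have apos : cvgC (fun N : nat => a (N%:Z + 1)) 0.
  apply: gaussC_cvg0; rewrite (_ : (fun n => _) = fun n : nat => `|(n%:R + (1 - delta)) / alpha|).
    exact: affine_cvg.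
  by apply/funext => N; rewrite /grid_node intrD addrA.
have := cvgCD (cvgCB TN aneg) apos; rewrite subr0 addr0; apply: cvgC_near.
apply: nearW => N; rewrite aN.
pose b k := a (k%:Z - N%:Z).
have bE : b 0%N + \sum_(i < N.*2.+1) b (bump 0 i) = \sum_(k < N.*2.+1) b k + b N.*2.+1.
  transitivity (\sum_(k < N.*2.+2) b k); first by rewrite [RHS]big_ord_recl.
  by rewrite big_ord_recr.
have -> : \sum_(k < N.*2.+1) a (k%:Z - N%:Z + e%:Z) = \sum_(i < N.*2.+1) b (bump 0 i).
  by apply: eq_bigr => k _; congr a; rewrite eT /bump/=; lia.
have e0 : b 0%N = a (- N%:Z) by rewrite /b sub0r.
have eN : b N.*2.+1 = a (N%:Z + 1) by congr a; lia.
by apply: (addrI (b 0%N)); rewrite bE e0 eN [RHS]addrA subrKC.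
Qed.

Section fixed_shift.
Variable delta : R.
Hypotheses (delta0 : 0 <= delta) (delta1 : delta <= 1).

Lemma conj_Theta alpha s : 1 <= alpha -> (Theta delta alpha s)^*%R = Theta delta alpha s^*%R.
Proof.
move=> a1; apply: (cvgC_unique (cvgC_conj (Theta_cvg delta0 delta1 s a1))).
apply: cvgC_near (Theta_cvg delta0 delta1 s^*%R a1); apply: nearW => N.
rewrite conjC_sum; apply: eq_bigr => k _.
rewrite /gaussC conj_expC conjCD !conjCN conjCM.
by rewrite !conjC_real.
Qed.

Lemma Theta_eigen alpha s w (c : R[i]) : 1 <= alpha ->
  (forall n, expC (- ((grid_node delta alpha n)%:C * w)) = c) ->
  Theta delta alpha (s + w) = c * Theta delta alpha s.
Proof.
move=> a1 wc; apply: (cvgC_unique (Theta_cvg delta0 delta1 (s + w) a1)).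
apply: cvgC_near (cvgCZ c (Theta_cvg delta0 delta1 s a1)); apply: nearW => N.
rewrite mulr_sumr; apply: eq_bigr => k _.
by rewrite -(wc (k%:Z - N%:Z)) /gaussC -expCD; congr expC; rewrite mulrDr opprD; ring.
Qed.

(* [gaussC (x + conj y) u] is a positive weight times [f x u * conj (f y u)]. *)
Lemma Theta_psd alpha (I : finType) (V X : I -> R[i]) : 1 <= alpha ->
  0 <= \sum_j \sum_k V j * (V k)^*%R * Theta delta alpha (X j + (X k)^*%R).
Proof.
move=> a1.
apply: (@cvgC_ge0 _ (fun N => \sum_j \sum_k V j * (V k)^*%R *
    \sum_(l < N.*2.+1) gaussC (X j + (X k)^*%R) (grid_node delta alpha (l%:Z - N%:Z)))) => [N|].
  have -> : \sum_j \sum_k V j * (V k)^*%R *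
      (\sum_(l < N.*2.+1) gaussC (X j + (X k)^*%R) (grid_node delta alpha (l%:Z - N%:Z))) =
    \sum_(l < N.*2.+1) let u := grid_node delta alpha (l%:Z - N%:Z) in
      (expR (- (u ^+ 2 / 2)))%:C * ((\sum_j V j * expC (- (u%:C * X j))) *
       (\sum_j V j * expC (- (u%:C * X j)))^*%R).
    under eq_bigr do under eq_bigr do rewrite mulr_sumr.
    under eq_bigr do rewrite exchange_big/=.
    rewrite exchange_big/=; apply: eq_bigr => l _.
    set u := grid_node _ _ _.
    rewrite conjC_sum mulr_suml mulr_sumr; apply: eq_bigr => j _.
    rewrite mulr_sumr mulr_sumr; apply: eq_bigr => k _.
    rewrite conjCM conj_expC conjCN conjCM conjC_real.
    rewrite /gaussC mulrDr opprD expCD expCD -[- _%:C]rmorphN expC_real; ring.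
  apply: sumr_ge0 => l _ /=; apply: mulr_ge0; first by rewrite ler0c expR_ge0.
  exact: mulcJ_ge0.
apply: cvgC_sum => j; apply: cvgC_sum => k; apply: cvgCZ.
exact: Theta_cvg.
Qed.

End fixed_shift.
End theta_functions.

(** * Determinants of the theta kernels *)

(* Arithmetic-geometric mean inequality for the eigenvalues. *)
Lemma det_psd_le (C : numClosedFieldType) n (A : 'M[C]_n) (B : C) :
  (forall j k, A j k = (A k j)^*) ->
  (forall v : 'I_n -> C, 0 <= \sum_j \sum_k v j * (v k)^* * A j k) ->
  (forall j, A j j <= B) -> \det A <= B ^+ n.
Proof.
move=> Aherm Apsd AB.
have Anormal : A \is normalmx.
  have AtC : map_mx Num.conj A^T = A by apply/matrixP => j k; rewrite !mxE [RHS]Aherm.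
  by apply/normalmxP; rewrite AtC.
set P := spectralmx A; set d := spectral_diag A.
have PU : P \is unitarymx by exact: spectral_unitarymx.
have Pu : P \in unitmx by exact: unitarymx_unit.
have AE : A = invmx P *m diag_mx d *m P by exact/orthomx_spectralP.
have dE : diag_mx d = P *m A *m map_mx Num.conj P^T.
  by rewrite AE -(invmx_unitary PU) !mulmxA mulmxV// mul1mx -mulmxA mulmxV// mulmx1.
have d0 i : 0 <= d 0 i.
  have -> : d 0 i = \sum_j \sum_k P i j * (P i k)^* * A j k.
    have /matrixP/(_ i i) := dE; rewrite !mxE eqxx mulr1n => ->.
    rewrite exchange_big/=; apply: eq_bigr => k _; rewrite !mxE mulr_suml.
    by apply: eq_bigr => j _; rewrite mulrAC.
  exact: Apsd.
have detA : \det A = \prod_i d 0 i.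
  rewrite AE det_mulmx mulrC det_mulmx mulrA -det_mulmx mulmxV// det1 mul1r.
  exact: det_diag.
have trA : \tr A = \sum_i d 0 i.
  by rewrite AE mxtrace_mulC mulmxA mulmxV// mul1mx mxtrace_diag.
have [n0|n0] := posnP n.
  by move: (A) B {AB}; rewrite n0 => M B; rewrite det_mx00 expr0.
have n0' : 0 < n%:R :> C by rewrite ltr0n.
have := leif_AGM (fun i (_ : i \in 'I_n) => d0 i).
rewrite card_ord -trA -detA => -[/le_trans + _]; apply.
rewrite lerXn2r ?nnegrE//.
- by rewrite trA; apply: divr_ge0 => //; exact: sumr_ge0.
(* Nonnegativity of [B] comes from a diagonal entry, by testing positivity on a basis vector. *)
- move: (Ordinal n0) => i; apply: le_trans (AB i).
  have := Apsd (fun j => (j == i)%:R).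
  rewrite (bigD1 i)//= (bigD1 i)//= eqxx conjC1 !mul1r.
  rewrite big1 => [|k /negbTE ->]; last by rewrite conjC0 mulr0 mul0r.
  rewrite addr0 big1 ?addr0// => j /negbTE ->; rewrite big1// => k _.
  by rewrite !mul0r.
rewrite ler_pdivrMr// mulr_natr -[X in _ <= B *+ X]card_ord -sumr_const.
exact: ler_sum.
Qed.

Lemma det_scale (C : comNzRingType) n (u v : 'I_n -> C) (M : 'I_n -> 'I_n -> C) :
  \det (\matrix_(j, k) (u j * M j k * v k)) =
  \prod_j u j * \prod_j v j * \det (\matrix_(j, k) M j k).
Proof.
have -> : \matrix_(j, k) (u j * M j k * v k) =
    diag_mx (\row_j u j) *m (\matrix_(j, k) M j k) *m diag_mx (\row_j v j).
  by apply/matrixP => j k; rewrite mul_mx_diag mul_diag_mx !mxE.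
rewrite !det_mulmx !det_diag mulrAC; congr (_ * _ * _);
  by apply: eq_bigr => j _; rewrite mxE.
Qed.

Section theta_kernels.
Variable R : realType.
Implicit Types (x y : plane R) (alpha : R).
Local Open Scope complex_scope.

Variables (e : bool) (w1 w2 : R).

(* Gram kernel of the weighted points [w1, x] and [w2, - x]: the weights (1, 0)
   give type A, (1/2, - 1/2) types B and C, (1/2, 1/2) type D; [e] selects
   theta2 or theta3. *)
Definition theta_kernel alpha x y : R[i] :=
  (w1 ^+ 2 + w2 ^+ 2)%:C * Theta (e%:R / 2) alpha (toC x + (toC y)^*%R) +
  (2 * w1 * w2)%:C * Theta (e%:R / 2) alpha (toC x - (toC y)^*%R).

Definition Ginibre_kernel x y : R[i] :=
  (w1 ^+ 2 + w2 ^+ 2)%:C * expC (toC x * (toC y)^*%R) +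
  (2 * w1 * w2)%:C * expC (- (toC x * (toC y)^*%R)).

Let delta : R := e%:R / 2.

Let delta0 : 0 <= delta.
Proof. by rewrite divr_ge0. Qed.

Let delta1 : delta <= 1.
Proof. by rewrite /delta ler_pdivrMr// mul1r ler_nat; case: (e). Qed.

Lemma theta_kernel_herm alpha x y : 1 <= alpha ->
  theta_kernel alpha x y = (theta_kernel alpha y x)^*%R.
Proof.
move=> a1; rewrite /theta_kernel conjCD !conjCM !conjC_real !(conj_Theta delta0 delta1)//.
rewrite !conjCD conjCN conjCK [toC x + _]addrC; congr (_ + _ * _).
by rewrite -[RHS]ThetaN// opprB.
Qed.

(** Apply [Theta_psd] to the doubled family of the points [x j] with weight [w1] and [- x j] with
    weight [w2]; by evenness the four resulting terms collapse into the two of [theta_kernel]. *)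
Lemma theta_kernel_psd alpha n (v : 'I_n -> R[i]) (x : 'I_n -> plane R) : 1 <= alpha ->
  0 <= \sum_j \sum_k v j * (v k)^*%R * theta_kernel alpha (x j) (x k).
Proof.
move=> a1.
pose V (p : 'I_n * bool) := v p.1 * (if p.2 then w1 else w2)%:C.
pose X (p : 'I_n * bool) := if p.2 then toC (x p.1) else - toC (x p.1).
have sum_pair (G : 'I_n * bool -> R[i]) : \sum_q G q = \sum_k (G (k, true) + G (k, false)).
  rewrite (eq_bigr (fun q => G (q.1, q.2))); last by case.
  rewrite -(pair_bigA _ (fun k b => G (k, b)))/=.
  by apply: eq_bigr => k _; rewrite big_bool.
have := Theta_psd delta0 delta1 V X a1.
rewrite sum_pair; congr (_ <= _); apply: eq_bigr => j _.
rewrite !sum_pair -big_split/=; apply: eq_bigr => k _.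
rewrite /V /X /= !conjCM !conjC_real conjCN /theta_kernel.
set z := toC (x j); set w := (toC (x k))^*%R.
have T1 : Theta delta alpha (- z - w) = Theta delta alpha (z + w).
  by rewrite -opprD ThetaN.
have T2 : Theta delta alpha (- z + w) = Theta delta alpha (z - w).
  by rewrite -[z - w]opprK opprB addrC ThetaN.
rewrite T1 T2 -/delta rmorphD rmorphXn rmorphXn !rmorphM (rmorph_nat (real_complex R))/=.
ring.
Qed.

Lemma expC_imag (b : R) : expC (b%:C * 'i) = cos b +i* sin b.
Proof.
have -> : b%:C * 'i = 0 +i* b.
  rewrite -complexiE; apply/eqP.
  by rewrite eq_complex /= !(mulr0, mul0r, mulr1, subr0, addr0) !eqxx.
by rewrite /expC /= expR0; apply/eqP; rewrite eq_complex /= !(mul0r, mul1r, subr0, addr0) !eqxx.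
Qed.

Lemma expC_pi : expC (pi%:C * 'i : R[i]) = -1.
Proof. by rewrite expC_imag cospi sinpi; apply/eqP; rewrite eq_complex /= oppr0 !eqxx. Qed.

(** At the node [(n - e / 2) / alpha] one period contributes
    [exp (- 2 pi i (n - e / 2)) = (-1) ^ e], the same for all [n]. *)
Lemma Theta_period alpha s : 1 <= alpha ->
  Theta delta alpha (s + (2 * pi * alpha)%:C * 'i) = (-1) ^+ e * Theta delta alpha s.
Proof.
move=> a1; have a0 : alpha != 0 by rewrite gt_eqF// (lt_le_trans _ a1).
apply: Theta_eigen => // n.
have -> : - ((grid_node delta alpha n)%:C * ((2 * pi * alpha)%:C * 'i)) =
    (e%:Z - n *+ 2)%:~R * (pi%:C * 'i).
  have -> : (e%:Z - n *+ 2)%:~R = (e%:R - n%:~R *+ 2)%:C :> R[i].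
    rewrite -(rmorph_int (real_complex R)); congr (_%:C).
    by rewrite intrD rmorphN rmorphMn.
  rewrite !mulrA -mulNr -!rmorphM -rmorphN; congr (_%:C * _).
  by rewrite /grid_node /delta; field.
rewrite expCMz expC_pi.
have -> : e%:Z - n *+ 2 = e%:Z + 2%:Z * - n by lia.
have sq1 : (-1) ^ (2 : int) = 1 :> R[i] by rewrite -exprnP sqrrN expr1n.
by rewrite expfzDr ?oppr_eq0 ?oner_eq0// -exprz_exp sq1 exp1rz mulr1.
Qed.

Lemma Theta_periodN alpha s : 1 <= alpha ->
  Theta delta alpha (s - (2 * pi * alpha)%:C * 'i) = (-1) ^+ e * Theta delta alpha s.
Proof.
move=> a1; rewrite -[in RHS](subrK ((2 * pi * alpha)%:C * 'i) s) Theta_period//.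
by rewrite mulrA -expr2 sqrr_sign mul1r.
Qed.

Let sgn alpha x : R[i] := if pi * alpha <= x.2 then (-1) ^+ e else 1.

Let toC_recenter alpha x : toC (recenter alpha x) =
  if pi * alpha <= x.2 then toC x - (2 * pi * alpha)%:C * 'i else toC x.
Proof.
rewrite /recenter; case: ifP => // _; rewrite /toC -complexiE /=.
by apply/eqP; rewrite eq_complex/= !(mul0r, mulr0, mulr1, subr0, add0r, oppr0, addr0) !eqxx.
Qed.

(** Conjugation reverses the imaginary shift, so [x + conj y] and [x - conj y] move by different
    numbers of periods; the parities agree, hence both terms acquire the same sign. *)
Lemma theta_kernel_recenter alpha x y : 1 <= alpha ->
  theta_kernel alpha (recenter alpha x) (recenter alpha y) =
  sgn alpha x * theta_kernel alpha x y * sgn alpha y.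
Proof.
move=> a1; rewrite /theta_kernel !toC_recenter /sgn.
set z := toC x; set w := toC y; set c := (2 * pi * alpha)%:C * 'i.
have cJ : c^*%R = - c by rewrite /c conjCM conjC_real conjCi mulrN.
have s2 : (-1) ^+ e * (-1) ^+ e = 1 :> R[i] by rewrite -expr2 sqrr_sign.
have P1 u : Theta delta alpha (u + c) = (-1) ^+ e * Theta delta alpha u by exact: Theta_period.
have P2 u : Theta delta alpha (u - c) = (-1) ^+ e * Theta delta alpha u by exact: Theta_periodN.
case: ifP => _; case: ifP => _; rewrite ?conjCD ?conjCN ?cJ ?opprK ?mul1r ?mulr1 -/delta.
- have -> : z - c + (w^*%R + c) = z + w^*%R by ring.
  have -> : z - c - (w^*%R + c) = z - w^*%R - c - c by ring.
  by rewrite !P2; ring: s2.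
- have -> : z - c + w^*%R = z + w^*%R - c by ring.
  have -> : z - c - w^*%R = z - w^*%R - c by ring.
  by rewrite !P2; ring.
- have -> : z + (w^*%R + c) = z + w^*%R + c by ring.
  have -> : z - (w^*%R + c) = z - w^*%R - c by ring.
  by rewrite P1 P2; ring.
- by [].
Qed.

Lemma dpp_rho_recenter alpha n (t : n.-tuple (plane R)) : 1 <= alpha ->
  dpp_rho (theta_kernel alpha) [tuple of map (recenter alpha) t] =
  dpp_rho (theta_kernel alpha) t.
Proof.
move=> a1; rewrite /dpp_rho; congr complex.Re.
under eq_mx => j k do rewrite !tnth_map theta_kernel_recenter//.
rewrite (det_scale (fun j => sgn alpha (tnth t j)) (fun j => sgn alpha (tnth t j))).
rewrite -big_split big1 ?mul1r// => j _.
rewrite /= /sgn; case: ifP => _; last by rewrite mulr1.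
by rewrite -expr2 sqrr_sign.
Qed.

(** Pointwise factors can be split freely between rows and columns. The bound uses a symmetric
    splitting by square roots, the limit asymmetric ones. *)
Lemma dpp_rho_scale (K : plane R -> plane R -> R[i]) n (t : n.-tuple (plane R))
    (u v : 'I_n -> R[i]) (r : 'I_n -> R) : (forall j, u j * v j = (r j)%:C) ->
  dpp_rho K t * \prod_j r j =
  complex.Re (\det (\matrix_(j, k) (u j * K (tnth t j) (tnth t k) * v k))).
Proof.
move=> uv; rewrite (det_scale u v) -big_split/=.
rewrite (eq_bigr (fun j => (r j)%:C))//.
by rewrite -rmorph_prod/= Re_mulc/= mul0r subr0 mulrC.
Qed.

Definition theta_diag_bound : R :=
  (w1 ^+ 2 + w2 ^+ 2 + `|2 * w1 * w2|) * Theta_bound R * (Num.sqrt 2 * pi `^ (3 / 2))^-1.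

Lemma theta_diag_bound_ge0 : 0 <= theta_diag_bound.
Proof.
rewrite /theta_diag_bound /Theta_bound.
by rewrite !mulr_ge0 ?invr_ge0 ?mulr_ge0 ?addr_ge0 ?sqr_ge0 ?expR_ge0 ?powR_ge0.
Qed.

Lemma theta_kernel_Im0 alpha x : 1 <= alpha -> complex.Im (theta_kernel alpha x x) = 0.
Proof.
move=> a1; have := theta_kernel_herm x x a1.
case: (theta_kernel alpha x x) => p q [/eqP].
by rewrite -addr_eq0 -mulr2n mulrn_eq0/= => /eqP.
Qed.

(** On the diagonal [x + conj x] has real part [2 x_R], so [Theta] grows at most like
    [alpha exp (2 x_R ^ 2)], which the density cancels; [x - conj x] is purely imaginary and obeys
    the same bound. *)
Lemma theta_kernel_diag alpha x : 1 <= alpha ->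
  complex.Re (theta_kernel alpha x x) * centered_density alpha x <= theta_diag_bound.
Proof.
move=> a1; have a0 : 0 < alpha by rewrite (lt_le_trans _ a1).
pose C0 : R := (Num.sqrt 2 * pi `^ (3 / 2))^-1.
have C00 : 0 <= C0 by rewrite invr_ge0 mulr_ge0 ?powR_ge0.
have B0 : 0 <= Theta_bound R by rewrite mulr_ge0 ?expR_ge0.
have p0 : 0 <= w1 ^+ 2 + w2 ^+ 2 by rewrite addr_ge0 ?sqr_ge0.
have hE : `|centered_density alpha x| <= C0 / alpha * expR (- 2 * x.1 ^+ 2).
  rewrite ger0_norm ?centered_density_ge0// /centered_density invfM -/C0.
  apply: ler_piMr; last by rewrite indicE lern1 leq_b1.
  by apply: mulr_ge0; [rewrite divr_ge0// ltW|exact: expR_ge0].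
have k1 : `|complex.Re (Theta delta alpha (toC x + (toC x)^*%R))| <=
    alpha * (expR (2 * x.1 ^+ 2) * Theta_bound R).
  apply: le_trans (Re_Theta_le delta0 delta1 _ a1) _.
  by rewrite /= (_ : (x.1 + x.1) ^+ 2 / 2 = 2 * x.1 ^+ 2)//; field.
have k2 : `|complex.Re (Theta delta alpha (toC x - (toC x)^*%R))| <=
    alpha * (expR (2 * x.1 ^+ 2) * Theta_bound R).
  apply: le_trans (Re_Theta_le delta0 delta1 _ a1) _.
  rewrite /= subrr expr0n/= mul0r expR0 ler_pM2l// ler_wpM2r//.
  by rewrite -expR0 ler_expR mulr_ge0 ?sqr_ge0.
apply: le_trans (ler_norm _) _; rewrite normrM.
apply: (@le_trans _ _ ((w1 ^+ 2 + w2 ^+ 2 + `|2 * w1 * w2|) *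
    (alpha * (expR (2 * x.1 ^+ 2) * Theta_bound R)) * (C0 / alpha * expR (- 2 * x.1 ^+ 2)))).
  apply: ler_pM => //; rewrite /theta_kernel.
  set A := Theta _ _ _ in k1 *; set A' := Theta _ _ _ in k2 *.
  have -> : complex.Re ((w1 ^+ 2 + w2 ^+ 2)%:C * A + (2 * w1 * w2)%:C * A') =
      (w1 ^+ 2 + w2 ^+ 2) * complex.Re A + (2 * w1 * w2) * complex.Re A'.
    by case: A A' {k1 k2} => ? ? [? ?] /=; rewrite !mul0r !subr0.
  move: (complex.Re A) (complex.Re A') k1 k2 => P Q k1 k2.
  move: (2 * w1 * w2) (w1 ^+ 2 + w2 ^+ 2) p0 => q p p0.
  rewrite mulrDl; apply: le_trans (ler_normD _ _) _; rewrite !normrM (ger0_norm p0).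
  by apply: lerD; apply: ler_wpM2l.
rewrite /theta_diag_bound -/C0 le_eqVlt; apply/orP; left; apply/eqP.
rewrite mulNr expRN; field.
by rewrite !gt_eqF ?expR_gt0.
Qed.

(** The square root of the density is put on rows and columns alike, which keeps the matrix
    Hermitian and positive semidefinite, so [det_psd_le] applies. *)
Lemma dpp_rho_theta_le alpha n (t : n.-tuple (plane R)) : 1 <= alpha ->
  dpp_rho (theta_kernel alpha) t * \prod_(l < n) centered_density alpha (tnth t l) <=
  theta_diag_bound ^+ n.
Proof.
move=> a1; have a0 : 0 < alpha by rewrite (lt_le_trans _ a1).
pose r (j : 'I_n) : R := Num.sqrt (centered_density alpha (tnth t j)).
have rr (j : 'I_n) : (r j)%:C * (r j)%:C = (centered_density alpha (tnth t j))%:C.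
  by rewrite -rmorphM/= -expr2 sqr_sqrtr// centered_density_ge0.
rewrite (dpp_rho_scale _ _ rr).
set M := \matrix_(j, k) _.
suff : \det M <= theta_diag_bound%:C ^+ n by rewrite -rmorphXn lecE => /andP[].
apply: det_psd_le.
- by move=> j k; rewrite !mxE !conjCM !conjC_real -theta_kernel_herm//; ring.
- move=> v; have := theta_kernel_psd (fun j => v j * (r j)%:C) (tnth t) a1.
  congr (_ <= _); apply: eq_bigr => j _; apply: eq_bigr => k _.
  by rewrite mxE conjCM conjC_real; ring.
- move=> j; rewrite mxE lecE mulrAC rr Im_mulc Re_mulc.
  rewrite [complex.Im _%:C]/= [complex.Re _%:C]/= !mul0r subr0 addr0.
  by rewrite theta_kernel_Im0// mulr0 eqxx/= mulrC theta_kernel_diag.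
Qed.

Let norm_const : R := (Num.sqrt 2 * pi `^ (3 / 2))^-1.

(** The Gaussian integral contributes [sqrt (2 pi)]; with the constant of the cylinder density it
    gives the Ginibre constant. *)
Let norm_constE : Num.sqrt (pi *+ 2) * norm_const = pi^-1.
Proof.
have p0 : 0 < pi :> R by exact: pi_gt0.
have s2 : Num.sqrt 2 != 0 :> R by rewrite sqrtr_eq0 -ltNge.
have sp : Num.sqrt pi != 0 :> R by rewrite sqrtr_eq0 -ltNge.
rewrite /norm_const (_ : 3 / 2 = 1 + 2^-1); last by field.
rewrite powRD ?(gt_eqF p0) ?implybT// powRr1 ?ltW// powR12_sqrt ?ltW//.
have -> : pi *+ 2 = 2 * pi :> R by rewrite mulr_natl.
rewrite sqrtrM// !invfM.
rewrite mulrACA divff// mul1r mulrCA divff// mulr1//.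
Qed.

(** The same gauge serves [z + w] and [z - w]: in half the square only the sign of the cross term
    [z w] differs. *)
Let gauge x : R[i] := expC (toC x ^+ 2 / 2).

Let gauge_norm x : gauge x * (gauge x)^*%R = (expR (x.1 ^+ 2 - x.2 ^+ 2))%:C.
Proof.
rewrite /gauge conj_expC -expCD -expC_real; congr expC.
have e2 : 2^-1 = (2^-1)%:C :> R[i] by rewrite fmorphV rmorph_nat.
rewrite e2 conjCM conjC_real rmorphXn.
case: x => a b; rewrite !expr2; apply/eqP; rewrite eq_complex/=.
by apply/andP; split; apply/eqP; field.
Qed.

Let theta_kernel_scaled_cvg (al : nat -> R) x y :
  (forall a, 1 <= al a) -> al @ \oo --> +oo ->
  cvgC (fun a => ((al a)^-1)%:C * theta_kernel (al a) x y)
    ((Num.sqrt (pi *+ 2))%:C * gauge x * Ginibre_kernel x y * (gauge y)^*%R).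
Proof.
move=> al1 aloo.
have T s := Theta_scaled_cvg delta0 delta1 s al1 aloo.
rewrite /theta_kernel /Ginibre_kernel /gauge conj_expC.
set z := toC x; set w := (toC y)^*%R.
have wE : (toC y ^+ 2 / 2)^*%R = w ^+ 2 / 2.
  by rewrite conjCM rmorphXn/= fmorphV/= conjC_nat.
have := cvgCD (cvgCZ (w1 ^+ 2 + w2 ^+ 2)%:C (T (z + w))) (cvgCZ (2 * w1 * w2)%:C (T (z - w))).
have -> : expC ((z + w) ^+ 2 / 2) = expC (z ^+ 2 / 2) * expC (z * w) * expC (w ^+ 2 / 2).
  by rewrite -!expCD; congr expC; field.
have -> : expC ((z - w) ^+ 2 / 2) = expC (z ^+ 2 / 2) * expC (- (z * w)) * expC (w ^+ 2 / 2).
  by rewrite -!expCD; congr expC; field.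
rewrite wE; set r := (X in cvgC _ X); set r' := (X in _ -> cvgC _ X).
have -> : r = r' by rewrite /r /r'; ring.
by apply: cvgC_near; apply: nearW => a; rewrite /delta; ring.
Qed.

(** As soon as [al a] exceeds every [|Im x_j|], all the points lie in the centered strip and the
    indicator is 1. *)
Let centered_density_near (al : nat -> R) n (t : n.-tuple (plane R)) :
  al @ \oo --> +oo -> \forall a \near \oo, forall j : 'I_n,
  centered_density (al a) (tnth t j) =
  (al a)^-1 * (norm_const * expR (- 2 * (tnth t j).1 ^+ 2)).
Proof.
move=> aloo; have : \forall a \near \oo, \sum_(j < n) `|(tnth t j).2| + 1 <= al a.
  exact: (cvgryPge al).1.
apply: filterS => a Ha j.
have ha : `|(tnth t j).2| < al a.
  apply: lt_le_trans Ha; rewrite (bigD1 j)//= -addrA ltrDl.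
  by rewrite ltr_wpDl// sumr_ge0.
have a0 : 0 < al a by rewrite (le_lt_trans _ ha).
have pa : al a <= pi * al a
  by apply: ler_peMl; [exact: ltW|apply: le_trans (pi_ge2 R); rewrite ler1n].
rewrite /centered_density indicE mem_set/=; last first.
  move: ha; rewrite ltr_norml => /andP[h1 h2].
  by rewrite (lt_le_trans h2 pa) andbT ltW// (le_lt_trans _ h1)// lerN2.
by rewrite mulr1 invfM -/norm_const mulrAC mulrC mulrA.
Qed.

Lemma dpp_rho_theta_cvg (al : nat -> R) n (t : n.-tuple (plane R)) :
  (forall a, 1 <= al a) -> al @ \oo --> +oo ->
  dpp_rho (theta_kernel (al a)) t * \prod_(l < n) centered_density (al a) (tnth t l)
    @[a --> \oo] -->
  dpp_rho Ginibre_kernel t * \prod_(l < n) Ginibre_density (tnth t l).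
Proof.
move=> al1 aloo.
pose h (j : 'I_n) : R := norm_const * expR (- 2 * (tnth t j).1 ^+ 2).
(* The gauges contribute [exp (x_R ^ 2 - x_I ^ 2)], which with [exp (- 2 x_R ^ 2)] makes
   [exp (- |x| ^ 2)]. *)
have uv (j : 'I_n) : (Num.sqrt (pi *+ 2))%:C * gauge (tnth t j) *
    ((gauge (tnth t j))^*%R * (h j)%:C) = (Ginibre_density (tnth t j))%:C.
  rewrite [_ * gauge _]mulrC mulrACA gauge_norm -!rmorphM/=; congr (_%:C).
  rewrite /h /Ginibre_density -norm_constE [RHS]mulrC.
  have -> : - ((tnth t j).1 ^+ 2 + (tnth t j).2 ^+ 2) =
      ((tnth t j).1 ^+ 2 - (tnth t j).2 ^+ 2) + - 2 * (tnth t j).1 ^+ 2 by ring.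
  by rewrite [in RHS]expRD; ring.
rewrite (dpp_rho_scale _ _ uv).
(* Rows carry [1 / al a], the scaling in which the kernel converges; columns carry the fixed
   Gaussian weight. *)
pose M a : 'M[R[i]]_n := \matrix_(j, k)
  (((al a)^-1)%:C * theta_kernel (al a) (tnth t j) (tnth t k) * (h k)%:C).
apply: cvg_trans (@cvgC_det R n M _ _).1; last first.
- move=> j k; rewrite mxE [X in cvgC _ X]mulrA.
  have := cvgCM (theta_kernel_scaled_cvg (tnth t j) (tnth t k) al1 aloo) (cvgC_cst (h k)%:C).
  by apply: cvgC_near; apply: nearW => a; rewrite mxE.
apply: near_eq_cvg; have := centered_density_near t aloo; apply: filterS => a Ha.
rewrite (eq_bigr _ (fun j _ => Ha j)).
have uv' (j : 'I_n) : ((al a)^-1)%:C * (h j)%:C = ((al a)^-1 * h j)%:C by rewrite -rmorphM.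
by rewrite (dpp_rho_scale _ _ uv').
Qed.

Lemma theta_kernel_cvg (K : R -> plane R -> plane R -> R[i])
    (K' : plane R -> plane R -> R[i]) :
  (forall alpha x y, 1 <= alpha -> K alpha x y = theta_kernel alpha x y) ->
  (forall x y, K' x y = Ginibre_kernel x y) ->
  cylinder_dpp_cvg K (fun alpha => cylinder_measure alpha) K' (@Ginibre_measure R).
Proof.
move=> KE K'E; have {K'E}-> : K' = Ginibre_kernel.
  by apply/funext => x; apply/funext => y.
have KE' alpha : 1 <= alpha -> K alpha = theta_kernel alpha.
  by move=> a1; apply/funext => x; apply/funext => y; exact: KE.
apply: (@cylinder_dpp_cvg_of_densities _ _ _ theta_diag_bound).
- by move=> alpha n t a1; rewrite KE'// dpp_rho_recenter.
- exact: theta_diag_bound_ge0.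
- by move=> alpha n t a1; rewrite KE'//; exact: dpp_rho_theta_le.
- move=> u n t u1 uoo; rewrite (_ : (fun a => _) = fun a => dpp_rho (theta_kernel (u a)) t *
      \prod_(l < n) centered_density (u a) (tnth t l)); first exact: dpp_rho_theta_cvg.
  by apply/funext => a; rewrite KE'.
Qed.

End theta_kernels.

Theorem proposition4p7 (R : realType) :
  cylinder_dpp_cvg (@K_cylinder_A_even R) (fun alpha => cylinder_measure alpha)
    (@K_Ginibre_A R) (@Ginibre_measure R) /\
  cylinder_dpp_cvg (@K_cylinder_A_odd R) (fun alpha => cylinder_measure alpha)
    (@K_Ginibre_A R) (@Ginibre_measure R) /\
  cylinder_dpp_cvg (@K_cylinder_B R) (fun alpha => cylinder_measure alpha)
    (@K_Ginibre_C R) (@Ginibre_measure R) /\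
  cylinder_dpp_cvg (@K_cylinder_C R) (fun alpha => cylinder_measure alpha)
    (@K_Ginibre_C R) (@Ginibre_measure R) /\
  cylinder_dpp_cvg (@K_cylinder_D R) (fun alpha => cylinder_measure alpha)
    (@K_Ginibre_D R) (@Ginibre_measure R).
Proof.
have e0 : (false%:R / 2 : R) = 0 by rewrite mul0r.
have e1 : (true%:R / 2 : R) = 1 / 2 by [].
have p1 : (1 ^+ 2 + 0 ^+ 2 : R) = 1 by rewrite expr1n expr0n addr0.
have q1 : (2 * 1 * 0 : R) = 0 by rewrite mulr0.
have half : (1 / 2)%C%:C%C = 1 / 2 :> R[i].
  by rewrite rmorphM fmorphV/= (rmorph_nat (real_complex R)).
have p2 : ((1 / 2) ^+ 2 + (1 / 2) ^+ 2 : R) = 1 / 2 by field.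
have p3 : ((1 / 2) ^+ 2 + (- (1 / 2)) ^+ 2 : R) = 1 / 2 by field.
have q2 : (2 * (1 / 2) * (1 / 2) : R) = 1 / 2 by field.
have q3 : (2 * (1 / 2) * (- (1 / 2)) : R) = - (1 / 2) by field.
do 4?split.
- apply: (@theta_kernel_cvg R true 1 0) => [alpha x y a1|x y].
    by rewrite /theta_kernel p1 q1 !mul0r addr0 mul1r; exact: theta2_Theta.
  by rewrite /Ginibre_kernel p1 q1 mul0r addr0 mul1r.
- apply: (@theta_kernel_cvg R false 1 0) => [alpha x y a1|x y].
    by rewrite /theta_kernel p1 q1 e0 !mul0r addr0 mul1r; exact: theta3_Theta.
  by rewrite /Ginibre_kernel p1 q1 mul0r addr0 mul1r.
- apply: (@theta_kernel_cvg R true (1 / 2) (- (1 / 2))) => [alpha x y a1|x y].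
    rewrite /K_cylinder_B !theta2_Theta// /theta_kernel p3 q3 rmorphN/= half; ring.
  by rewrite /K_Ginibre_C /sinhC /Ginibre_kernel p3 q3 rmorphN/= half; field.
- apply: (@theta_kernel_cvg R false (1 / 2) (- (1 / 2))) => [alpha x y a1|x y].
    rewrite /K_cylinder_C !theta3_Theta// /theta_kernel e0 p3 q3 rmorphN/= half; ring.
  by rewrite /K_Ginibre_C /sinhC /Ginibre_kernel p3 q3 rmorphN/= half; field.
- apply: (@theta_kernel_cvg R false (1 / 2) (1 / 2)) => [alpha x y a1|x y].
    rewrite /K_cylinder_D !theta3_Theta// /theta_kernel e0 p2 q2 half; ring.
  by rewrite /K_Ginibre_D /coshC /Ginibre_kernel p2 q2 half; field.
Qed.
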